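(* Let $V$ be an irreducible $\tau(B)$-module belonging to $\mathcal{C}_{fin}$ (integrable with finite-dimensional weight spaces). Then $V$ is a single point evaluation module: there exists a unital $\mathbb{C}$-algebra homomorphism $\psi:B\to\mathbb{C}$ such that $(x\otimes b)\cdot v=\psi(b)\,(x\otimes 1)\cdot v$ for all $x\in\tau$, $b\in B$, $v\in V$. Hence $V$ is an irreducible integrable module for the full toroidal Lie algebra $\tau\cong\tau\otimes 1$.
   Context: Let $\dot{\mathfrak g}$ be a finite-dimensional simple Lie algebra over $\mathbb{C}$ with Cartan subalgebra $\dot{\mathfrak h}$, root system $\dot\Delta$, root spaces $\dot{\mathfrak g}_\alpha$, and nondegenerate invariant symmetric bilinear form $(\cdot|\cdot)$. Let $\nu\ge 1$, $A=\mathbb{C}[t_0^{\pm1},\dots,t_\nu^{\pm1}]$; for $\mathbf m=(m_0,\dots,m_\nu)\in\mathbb{Z}^{\nu+1}$ put $t^{\mathbf m}=t_0^{m_0}\cdots t_\nu^{m_\nu}$. Let $d_p=t_p\,\partial/\partial t_p$ and $\mathcal D=\mathrm{Der}A=\bigoplus_{p=0}^\nu A d_p$. Let $\mathcal K$ be spanned by symbols $t^{\mathbf m}k_p$ ($0\le p\le\nu$) subject to the relations $\sum_{p=0}^\nu m_p t^{\mathbf m}k_p=0$ ($\mathbf m\in\mathbb{Z}^{\nu+1}$). The full toroidal Lie algebra is $\tau=(\dot{\mathfrak g}\otimes A)\oplus\mathcal K\oplus\mathcal D$ with brackets: $[x\otimes t^{\mathbf m},y\otimes t^{\mathbf n}]=[x,y]\otimes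 t^{\mathbf m+\mathbf n}+(x|y)\sum_p m_p t^{\mathbf m+\mathbf n}k_p$; $\mathcal K$ commutes with $\dot{\mathfrak g}\otimes A$ and $\mathcal K$; $[t^{\mathbf m}d_a,x\otimes t^{\mathbf n}]=n_a x\otimes t^{\mathbf m+\mathbf n}$; $[t^{\mathbf m}d_a,t^{\mathbf n}k_b]=n_a t^{\mathbf m+\mathbf n}k_b+\delta_{ab}\sum_p m_p t^{\mathbf m+\mathbf n}k_p$; $[t^{\mathbf m}d_a,t^{\mathbf n}d_b]=n_a t^{\mathbf m+\mathbf n}d_b-m_b t^{\mathbf m+\mathbf n}d_a+\phi(t^{\mathbf m}d_a,t^{\mathbf n}d_b)$, where $\phi$ is a fixed linear combination of the cocycles $\phi_1(t^{\mathbf m}d_a,t^{\mathbf n}d_b)=-n_am_b\sum_p m_pt^{\mathbf m+\mathbf n}k_p$ and $\phi_2(t^{\mathbf m}d_a,t^{\mathbf n}d_b)=m_an_b\sum_p m_pt^{\mathbf m+\mathbf n}k_p$. $B$ is a finitely generated commutative associative unital $\mathbb{C}$-algebra, and $\tau(B)=\tau\otimes B$ with $[x\otimes b,y\otimes b']=[x,y]\otimes bb'$. Let $\mathfrak h=\dot{\mathfrak h}\oplus\bigoplus_{i=0}^\nu\mathbb{C}k_i\oplus\bigoplus_{i=0}^\nu\mathbb{C}d_i$, identified with $\mathfrak h\otimes 1\subset\tau(B)$. A $\tau(B)$-module $V$ is integrable if $V=\bigoplus_{\lambda\in\mathfrak h^*}V_\lambda$ with $V_\lambda=\{v: h v=\lambda(h)v\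 \forall h\in\mathfrak h\}$, and each $x_\alpha\otimes t^{\mathbf m}\otimes b$ ($\alpha\in\dot\Delta$, $x_\alpha\in\dot{\mathfrak g}_\alpha$, $\mathbf m\in\mathbb{Z}^{\nu+1}$, $b\in B$) acts locally nilpotently on $V$; integrable $\tau$-modules are defined in the same way (the case $B=\mathbb{C}$). $\mathcal C_{fin}$ is the category of integrable $\tau(B)$-modules all of whose weight spaces $V_\lambda$ are finite dimensional. *)

(* Defs.v *)
From HB Require Import structures.
From mathcomp Require Import all_boot all_order all_algebra.
From mathcomp Require Import ring_quotient.
From mathcomp Require Import boolp reals complex finmap monalg.

Set Implicit Arguments.
Unset Strict Implicit.
Unset Printing Implicit Defensive.

Import GRing.Theory.
Local Open Scope ring_scope.
Local Open Scope quotient_scope.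

Definition is_bilinear (C : fieldType) (U W M : lmodType C)
    (f : U -> W -> M) : Prop :=
  (forall w, linear (f^~ w)) /\ (forall u, linear (f u)).

Section LinearTheory.
Variables (C : fieldType) (U M : lmodType C) (f : U -> M).
Hypothesis f_lin : linear f.

Lemma lin0 : f 0 = 0.
Proof. by have := f_lin (-1) 0 0; rewrite scaler0 addr0 scaleN1r addNr. Qed.

Lemma linD u v : f (u + v) = f u + f v.
Proof. by have := f_lin 1 u v; rewrite !scale1r. Qed.

Lemma linZ a u : f (a *: u) = a *: f u.
Proof. by have := f_lin a u 0; rewrite lin0 !addr0. Qed.

Lemma linN u : f (- u) = - f u.
Proof. by rewrite -scaleN1r linZ scaleN1r. Qed.

Lemma linB u v : f (u - v) = f u - f v.
Proof. by rewrite linD linN. Qed.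

Lemma lin_sum (I : Type) (r : seq I) (P : pred I) (F : I -> U) :
  f (\sum_(i <- r | P i) F i) = \sum_(i <- r | P i) f (F i).
Proof. by apply: (big_morph f linD lin0). Qed.

End LinearTheory.

Lemma lin_comb (C : fieldType) (U M : lmodType C) (F G : U -> M) a :
  linear F -> linear G -> linear (fun v => a *: F v + G v).
Proof.
move=> Fl Gl b u v; rewrite Fl Gl !scalerDr !scalerA mulrC.
by rewrite -!addrA; congr (_ + _); rewrite addrCA.
Qed.

Section LinearQuotient.
Variables (C : fieldType) (M : lmodType C) (S : M -> Prop).

Definition lspan : {pred M} := fun x =>
  `[< forall W : {pred M}, submod_closed W ->
        (forall s, S s -> s \in W) -> x \in W >].

Lemma lspanP (x : M) :
  reflect (forall W : {pred M}, submod_closed W ->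
             (forall s, S s -> s \in W) -> x \in W) (x \in lspan).
Proof. exact: asboolP. Qed.

Lemma lspan_submod : submod_closed lspan.
Proof.
split; first by apply/lspanP => W [].
move=> a u v /lspanP uS /lspanP vS; apply/lspanP => W Wc SW.
by apply: (proj2 Wc); [exact: uS|exact: vS].
Qed.

Lemma mem_lspan x : S x -> x \in lspan.
Proof. by move=> Sx; apply/lspanP => W _; apply. Qed.

HB.instance Definition _ := GRing.isSubmodClosed.Build C M lspan
  (GRing.submod_closed_semi lspan_submod).

Definition lquot : Type := Quotient.quot lspan.

HB.instance Definition _ := GRing.Zmodule.on lquot.
HB.instance Definition _ := EqQuotient.on lquot.

Definition lquot_pi (x : M) : lquot := \pi_lquot x.

Lemma lquot_piP x y : lquot_pi x = lquot_pi y <-> x - y \in lspan.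
Proof.
rewrite /lquot_pi; split => [e|h].
  by rewrite Quotient.idealrBE; apply/eqP.
by apply/eqP; rewrite -Quotient.idealrBE.
Qed.

Lemma lquot_reprK (z : lquot) : lquot_pi (repr z) = z.
Proof. exact: reprK. Qed.

Lemma lquot_piD x y : lquot_pi (x + y) = lquot_pi x + lquot_pi y.
Proof. by rewrite /lquot_pi !piE. Qed.

Definition lquot_scale (a : C) (z : lquot) : lquot := lquot_pi (a *: repr z).

Lemma lquot_piZ a x : lquot_pi (a *: x) = lquot_scale a (lquot_pi x).
Proof.
apply/lquot_piP; rewrite -scalerBr.
by apply: rpredZ; apply/lquot_piP; rewrite lquot_reprK.
Qed.

Lemma lquot_scaleA a b z :
  lquot_scale a (lquot_scale b z) = lquot_scale (a * b) z.
Proof. by rewrite -[z]lquot_reprK -!lquot_piZ scalerA. Qed.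

Lemma lquot_scale1 : left_id 1 lquot_scale.
Proof. by move=> z; rewrite -[z]lquot_reprK -!lquot_piZ scale1r. Qed.

Lemma lquot_scaleDr : right_distributive lquot_scale +%R.
Proof.
move=> a y z; rewrite -[y]lquot_reprK -[z]lquot_reprK.
by rewrite -lquot_piD -!lquot_piZ -lquot_piD scalerDr.
Qed.

Lemma lquot_scaleDl z : {morph lquot_scale^~ z : a b / a + b}.
Proof.
by move=> a b; rewrite -[z]lquot_reprK -!lquot_piZ -lquot_piD scalerDl.
Qed.

HB.instance Definition _ := GRing.Zmodule_isLmodule.Build C lquot
  lquot_scaleA lquot_scale1 lquot_scaleDr lquot_scaleDl.

Lemma lquot_pi_linear : linear lquot_pi.
Proof. by move=> a x y; rewrite lquot_piD lquot_piZ. Qed.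

Lemma lquot_pi_eq0 x : S x -> lquot_pi x = 0.
Proof.
move=> Sx; rewrite -(lin0 lquot_pi_linear).
by apply/lquot_piP; rewrite subr0; exact: mem_lspan.
Qed.

(* The map induced on the quotient by a linear map killing S; on other maps
   the value is junk. *)
Definition lquot_lift (N : Type) (f : M -> N) (z : lquot) : N := f (repr z).

Section Lift.
Variables (N : lmodType C) (f : M -> N).
Hypotheses (f_lin : linear f) (fS : forall s, S s -> f s = 0).

Lemma lquot_liftE x : lquot_lift f (lquot_pi x) = f x.
Proof.
apply/eqP; rewrite -subr_eq0 /lquot_lift -linB //.
have /lquot_piP/lspanP : lquot_pi (repr (lquot_pi x)) = lquot_pi x.
  exact: lquot_reprK.
move=> /(_ (fun u => f u == 0)); apply; last by move=> s /fS /eqP.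
split; first by rewrite unfold_in lin0.
move=> a u v; rewrite !unfold_in => /eqP fu /eqP fv.
by rewrite f_lin fu fv scaler0 addr0.
Qed.

Lemma lquot_lift_linear : linear (lquot_lift f).
Proof.
move=> a y z; rewrite -[y]lquot_reprK -[z]lquot_reprK -lquot_pi_linear.
by rewrite !lquot_liftE f_lin.
Qed.

End Lift.

End LinearQuotient.

(* The linear extension of f to the free module {malg C[K]} on K. *)
Definition free_ext (C : fieldType) (K : choiceType) (M : lmodType C)
    (f : K -> M) (a : {malg C[K]}) : M := \sum_(k <- msupp a) a@_k *: f k.

Section FreeExt.
Variables (C : fieldType) (K : choiceType) (M : lmodType C) (f : K -> M).

Lemma free_extEw (a : {malg C[K]}) (d : {fset K}) :
  (msupp a `<=` d)%fset -> free_ext f a = \sum_(k <- d) a@_k *: f k.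
Proof.
move=> sad; rewrite /free_ext (big_fset_incl _ sad) //= => k _ kNa.
by rewrite (mcoeff_outdom kNa) scale0r.
Qed.

Lemma free_ext_linear : linear (free_ext f).
Proof.
move=> c a b; pose d := (msupp a `|` msupp b)%fset.
have sad : (msupp a `<=` d)%fset by exact: fsubsetUl.
have sbd : (msupp b `<=` d)%fset by exact: fsubsetUr.
have scd : (msupp (c *: a + b) `<=` d)%fset.
  apply: (fsubset_trans (msuppD_le _ _)); apply: fsetSU; exact: msuppZ_le.
rewrite !(@free_extEw _ d) // scaler_sumr -big_split /=.
by apply: eq_bigr => k _; rewrite mcoeffD mcoeffZ scalerDl scalerA.
Qed.

Lemma free_extU k : free_ext f << k >> = f k.
Proof.
rewrite (@free_extEw _ [fset k]%fset) ?msuppU_le //.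
by rewrite big_seq_fset1 mcoeffUU scale1r.
Qed.

Lemma free_ind (P : {malg C[K]} -> Prop) :
  P 0 -> (forall a u v, P u -> P v -> P (a *: u + v)) ->
  (forall k, P << k >>) -> forall a, P a.
Proof.
move=> P0 Plin Pk a; rewrite [a]monalgE.
elim: (enum_fset _) => [|k r IHr]; first by rewrite big_nil.
rewrite big_cons (_ : << a@_k *g k >> = a@_k *: << k >>); first exact: Plin.
by apply/malgP => k'; rewrite mcoeffZ !mcoeffU mulr_natr.
Qed.

End FreeExt.

Section Tensor.
Variables (C : fieldType) (U W : lmodType C).

Inductive tensor_rel : {malg C[(U * W)%type]} -> Prop :=
| TensorRelL a u u' w :
    tensor_rel (<< (a *: u + u', w) >> - (a *: << (u, w) >> + << (u', w) >>))
| TensorRelR a u w w' :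
    tensor_rel (<< (u, a *: w + w') >> - (a *: << (u, w) >> + << (u, w') >>)).

Definition tensor : Type := lquot tensor_rel.

HB.instance Definition _ := GRing.Lmodule.on tensor.

Definition tens (u : U) (w : W) : tensor := lquot_pi tensor_rel << (u, w) >>.

Lemma tens_bilinear : is_bilinear tens.
Proof.
have pi_lin := @lquot_pi_linear _ _ tensor_rel.
split=> [w a u u'|u a w w']; apply/eqP; rewrite -subr_eq0 -pi_lin /=.
  by rewrite -(linB pi_lin) lquot_pi_eq0 //; exact: TensorRelL.
by rewrite -(linB pi_lin) lquot_pi_eq0 //; exact: TensorRelR.
Qed.

Lemma tens_ind (P : tensor -> Prop) :
  P 0 -> (forall a u v, P u -> P v -> P (a *: u + v)) ->
  (forall u w, P (tens u w)) -> forall z, P z.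
Proof.
move=> P0 Plin Pt z; rewrite -[z]lquot_reprK.
have pi_lin := @lquot_pi_linear _ _ tensor_rel.
elim/free_ind: (repr z) => [|a u v Pu Pv|[u w]]; last exact: Pt.
- by rewrite (lin0 pi_lin).
- by rewrite pi_lin; exact: Plin.
Qed.

Lemma tens_lin_ext (M : lmodType C) (F G : tensor -> M) :
  linear F -> linear G -> (forall u w, F (tens u w) = G (tens u w)) -> F =1 G.
Proof.
move=> Fl Gl e z; elim/tens_ind: z => // [|a u v Fu Fv].
  by rewrite (lin0 Fl) (lin0 Gl).
by rewrite Fl Gl Fu Fv.
Qed.

(* The linear map u (x) w |-> f u w induced by a bilinear map f. *)
Definition tens_lift (M : lmodType C) (f : U -> W -> M) : tensor -> M :=
  lquot_lift (free_ext (fun uw => f uw.1 uw.2)).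

Section Lift.
Variables (M : lmodType C) (f : U -> W -> M).
Hypothesis f_bilin : is_bilinear f.

Let fS s : tensor_rel s -> free_ext (fun uw => f uw.1 uw.2) s = 0.
Proof.
have f_lin := free_ext_linear (fun uw : U * W => f uw.1 uw.2).
case=> [a u u' w|a u w w']; rewrite (linB f_lin) f_lin !free_extU /=.
  by rewrite (proj1 f_bilin) subrr.
by rewrite (proj2 f_bilin) subrr.
Qed.

Lemma tens_liftE u w : tens_lift f (tens u w) = f u w.
Proof.
by rewrite /tens_lift lquot_liftE ?free_extU //; exact: free_ext_linear.
Qed.

Lemma tens_lift_linear : linear (tens_lift f).
Proof. by apply: lquot_lift_linear => //; exact: free_ext_linear. Qed.

End Lift.

End Tensor.

Definition is_lie_bracket (C : fieldType) (L : lmodType C)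
    (br : L -> L -> L) : Prop :=
  [/\ is_bilinear br,
      forall x, br x x = 0 &
      forall x y z, br x (br y z) + br y (br z x) + br z (br x y) = 0].

Definition is_lie_module (C : fieldType) (L V : lmodType C)
    (br : L -> L -> L) (rho : L -> V -> V) : Prop :=
  is_bilinear rho /\
  forall x y v, rho (br x y) v = rho x (rho y v) - rho y (rho x v).

Definition is_irreducible (C : fieldType) (L V : lmodType C)
    (rho : L -> V -> V) : Prop :=
  (exists v : V, v != 0) /\
  forall W : {pred V}, submod_closed W ->
    (forall x v, v \in W -> rho x v \in W) ->
    W =i pred1 0 \/ W =i predT.

Section FiniteDimensionalLie.
Variables (C : fieldType) (g : vectType C) (br : g -> g -> g).

Definition is_simple_lie : Prop :=
  [/\ is_lie_bracket br,
      exists x y, br x y != 0 &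
      forall I : {vspace g}, (forall x y, y \in I -> br x y \in I) ->
        I = 0%VS \/ I = fullv].

Definition lie_prodv (U W : {vspace g}) : {vspace g} :=
  <<[seq br u w | u <- vbasis U, w <- vbasis W]>>%VS.

(* Cartan subalgebra: nilpotent and self-normalizing. *)
Definition is_cartan (H : {vspace g}) : Prop :=
  [/\ (lie_prodv H H <= H)%VS,
      exists n, iter n (lie_prodv H) H = 0%VS &
      forall x, (forall h, h \in H -> br x h \in H) -> x \in H].

Definition root_space (H : {vspace g}) (alpha : 'Hom(subvs_of H, C^o))
    (x : g) : Prop :=
  forall h : subvs_of H, br (vsval h) x = (alpha h : C) *: x.

Definition is_root (H : {vspace g}) (alpha : 'Hom(subvs_of H, C^o)) : Prop :=
  alpha != 0 /\ exists2 x, root_space alpha x & x != 0.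

Definition is_invariant_form (kappa : g -> g -> C^o) : Prop :=
  [/\ is_bilinear kappa,
      forall x y, kappa x y = kappa y x,
      forall x y z, kappa (br x y) z = kappa x (br y z) &
      forall x, (forall y, kappa x y = 0) -> x = 0].

End FiniteDimensionalLie.

Notation degree nu := {ffun 'I_nu.+1 -> int}.

(* A = C[t_0^{+-1}, ..., t_nu^{+-1}] as a vector space, with basis the
   monomials t^m = << m >>.  The Lie brackets below only use
   t^m * t^n = t^(m + n), so the ring structure of A is not needed. *)
Notation laurent C nu := {malg C[degree nu]}.

(* D = Der A = \bigoplus_p A d_p: f stands for \sum_p (f p) d_p. *)
Notation der C nu := {ffun 'I_nu.+1 -> laurent C nu}.

Lemma sum_delta (C : fieldType) (nu : nat) (M : lmodType C) (m : degree nu) a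
    (c : C) (Y : 'I_nu.+1 -> M) (X : M) :
  \sum_p (m p)%:~R *: (c *: Y p + (a == p)%:R *: X) =
    c *: (\sum_p (m p)%:~R *: Y p) + (m a)%:~R *: X.
Proof.
rewrite scaler_sumr; under eq_bigr do rewrite scalerDr.
rewrite big_split /=; congr (_ + _).
  by apply: eq_bigr => p _; rewrite !scalerA mulrC.
rewrite (bigD1 a) //= eqxx scale1r big1 ?addr0 // => p pa.
by rewrite eq_sym (negPf pa) scale0r scaler0.
Qed.

Section ToroidalBracket.
Variables (C : fieldType) (nu : nat).
Local Notation degree := (degree nu).
Variables (g : lmodType C) (br : g -> g -> g) (kappa : g -> g -> C^o).

(* A vector space T spanned by tg x m = x (x) t^m, tk m p = t^m k_p and
   td m p = t^m d_p; ext fg fk fd is the linear map with the values fg, fk, fd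
   on these vectors. *)
Variables (T : lmodType C) (tg : g -> degree -> T).
Variables (tk td : degree -> 'I_nu.+1 -> T).
Variable ext : (g -> degree -> T) -> (degree -> 'I_nu.+1 -> T) ->
  (degree -> 'I_nu.+1 -> T) -> T -> T.

(* \sum_p m_p t^n k_p *)
Definition dk_sum (m n : degree) : T := \sum_p (m p)%:~R *: tk n p.

(* The 2-cocycle c1 phi_1 + c2 phi_2 evaluated at (t^m d_a, t^n d_b). *)
Definition toroidal_phi (c1 c2 : C) (m : degree) (a : 'I_nu.+1)
    (n : degree) (b : 'I_nu.+1) : T :=
  c1 *: (- (n a * m b)%:~R *: dk_sum m (m + n))
    + c2 *: ((m a * n b)%:~R *: dk_sum m (m + n)).

Definition toroidal_bracket (c1 c2 : C) (u v : T) : T :=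
  ext
    (fun x (m : degree) => ext
       (fun y (n : degree) =>
          tg (br x y) (m + n) + (kappa x y : C) *: dk_sum m (m + n))
       (fun _ _ => 0)
       (fun (n : degree) b => - ((m b)%:~R *: tg x (m + n))) v)
    (fun (m : degree) a => ext
       (fun _ _ => 0)
       (fun _ _ => 0)
       (fun (n : degree) b =>
          - ((m b)%:~R *: tk (m + n) a + (a == b)%:R *: dk_sum n (m + n))) v)
    (fun (m : degree) a => ext
       (fun y (n : degree) => (n a)%:~R *: tg y (m + n))
       (fun (n : degree) b =>
          (n a)%:~R *: tk (m + n) b + (a == b)%:R *: dk_sum m (m + n))
       (fun (n : degree) b =>
          (n a)%:~R *: td (m + n) b - (m b)%:~R *: td (m + n) a
            + toroidal_phi c1 c2 m a n b) v)
    u.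

Lemma dk_sumE m n : dk_sum m n = \sum_p (m p)%:~R *: tk n p.
Proof. by []. Qed.

Lemma dk_sumD m n r : dk_sum (m + n) r = dk_sum m r + dk_sum n r.
Proof.
rewrite /dk_sum -big_split /=; apply: eq_bigr => p _.
by rewrite ffunE rmorphD /= scalerDl.
Qed.

Variables c1 c2 : C.
Hypotheses (br_bil : is_bilinear br) (kappa_bil : is_bilinear kappa).
Hypotheses (tg_lin : forall m, linear (tg^~ m)).
Hypotheses (tkK : forall m, dk_sum m m = 0).
Hypothesis ext_spec : forall fg fk fd,
  (forall m, linear (fg^~ m)) ->
  (forall m : degree, \sum_p (m p)%:~R *: fk m p = 0) ->
  [/\ linear (ext fg fk fd),
      forall x m, ext fg fk fd (tg x m) = fg x m,
      forall m p, ext fg fk fd (tk m p) = fk m p &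
      forall m p, ext fg fk fd (td m p) = fd m p].
Hypothesis ext_uniq : forall F G : T -> T, linear F -> linear G ->
  (forall x m, F (tg x m) = G (tg x m)) ->
  (forall m p, F (tk m p) = G (tk m p)) ->
  (forall m p, F (td m p) = G (td m p)) -> F =1 G.

Let ext_linear fg fk fd (fgl : forall m, linear (fg^~ m))
  (fkK : forall m : degree, \sum_p (m p)%:~R *: fk m p = 0) :
  linear (ext fg fk fd).
Proof. by case: (ext_spec fd fgl fkK). Qed.
Let ext_g fg fk fd (fgl : forall m, linear (fg^~ m))
  (fkK : forall m : degree, \sum_p (m p)%:~R *: fk m p = 0) x m :
  ext fg fk fd (tg x m) = fg x m.
Proof. by case: (ext_spec fd fgl fkK). Qed.
Let ext_k fg fk fd (fgl : forall m, linear (fg^~ m))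
  (fkK : forall m : degree, \sum_p (m p)%:~R *: fk m p = 0) m p :
  ext fg fk fd (tk m p) = fk m p.
Proof. by case: (ext_spec fd fgl fkK). Qed.
Let ext_d fg fk fd (fgl : forall m, linear (fg^~ m))
  (fkK : forall m : degree, \sum_p (m p)%:~R *: fk m p = 0) m p :
  ext fg fk fd (td m p) = fd m p.
Proof. by case: (ext_spec fd fgl fkK). Qed.

Let gg x (m : degree) y (n : degree) : T :=
  tg (br x y) (m + n) + (kappa x y : C) *: dk_sum m (m + n).
Let gd x (m : degree) (n : degree) b : T := - ((m b)%:~R *: tg x (m + n)).
Let kd (m : degree) a (n : degree) b : T :=
  - ((m b)%:~R *: tk (m + n) a + (a == b)%:R *: dk_sum n (m + n)).
Let dg (m : degree) a y (n : degree) : T := (n a)%:~R *: tg y (m + n).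
Let dk (m : degree) a (n : degree) b : T :=
  (n a)%:~R *: tk (m + n) b + (a == b)%:R *: dk_sum m (m + n).
Let zg (_ : g) (_ : degree) : T := 0.
Let zk (_ : degree) (_ : 'I_nu.+1) : T := 0.

Let gg_lin x m n : linear (fun y => gg x m y n).
Proof.
move=> a y z; rewrite /gg (proj2 br_bil) (proj2 kappa_bil) tg_lin.
by rewrite scalerDl scalerDr scalerA addrACA.
Qed.

Let gg_linl y m n : linear (fun x => gg x m y n).
Proof.
move=> a x z; rewrite /gg (proj1 br_bil) (proj1 kappa_bil) tg_lin.
by rewrite scalerDl scalerDr scalerA addrACA.
Qed.

Let zg_lin (m : degree) : linear (zg^~ m).
Proof. by move=> a y z; rewrite scaler0 addr0. Qed.

Let zkK (m : degree) : \sum_p (m p)%:~R *: zk m p = 0.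
Proof. by rewrite big1 // => p _; rewrite scaler0. Qed.

Let dg_lin m a n : linear (fun y => dg m a y n).
Proof. by move=> c y z; rewrite /dg tg_lin scalerDr !scalerA mulrC. Qed.

Let dkK m a (n : degree) : \sum_p (n p)%:~R *: dk m a n p = 0.
Proof.
apply: etrans (sum_delta n a _ (tk (m + n)) _) _.
by rewrite -dk_sumE -scalerDr -dk_sumD addrC tkK scaler0.
Qed.

Let dd (m : degree) a (n : degree) b : T :=
  (n a)%:~R *: td (m + n) b - (m b)%:~R *: td (m + n) a
    + toroidal_phi c1 c2 m a n b.

Let row_g x (m : degree) := ext (gg x m) zk (gd x m).
Let row_k (m : degree) a := ext zg zk (kd m a).
Let row_d (m : degree) a := ext (dg m a) (dk m a) (dd m a).

Let row_g_lin x m : linear (row_g x m).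
Proof. exact: (ext_linear (gd x m) (gg_lin x m) zkK). Qed.
Let row_k_lin m a : linear (row_k m a).
Proof. exact: (ext_linear (kd m a) zg_lin zkK). Qed.
Let row_d_lin m a : linear (row_d m a).
Proof. exact: (ext_linear (dd m a) (dg_lin m a) (dkK m a)). Qed.

Let row_gg x m y n : row_g x m (tg y n) = gg x m y n.
Proof. exact: (ext_g _ (gg_lin x m) zkK). Qed.
Let row_gk x m n b : row_g x m (tk n b) = 0.
Proof. exact: (ext_k _ (gg_lin x m) zkK). Qed.
Let row_gd x m n b : row_g x m (td n b) = gd x m n b.
Proof. exact: (ext_d (gd x m) (gg_lin x m) zkK). Qed.
Let row_kg m a y n : row_k m a (tg y n) = 0.
Proof. exact: (ext_g _ zg_lin zkK). Qed.
Let row_kk m a n b : row_k m a (tk n b) = 0.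
Proof. exact: (ext_k _ zg_lin zkK). Qed.
Let row_kd m a n b : row_k m a (td n b) = kd m a n b.
Proof. exact: (ext_d (kd m a) zg_lin zkK). Qed.
Let row_dg m a y n : row_d m a (tg y n) = dg m a y n.
Proof. exact: (ext_g _ (dg_lin m a) (dkK m a)). Qed.
Let row_dk m a n b : row_d m a (tk n b) = dk m a n b.
Proof. exact: (ext_k _ (dg_lin m a) (dkK m a)). Qed.
Let row_dd m a n b : row_d m a (td n b) = dd m a n b.
Proof. exact: (ext_d (dd m a) (dg_lin m a) (dkK m a)). Qed.

Let row_g_linl m v : linear (fun x => row_g x m v).
Proof.
move=> a x y; move: v.
apply: (ext_uniq (row_g_lin _ m)
  (lin_comb a (row_g_lin x m) (row_g_lin y m))) => [z n|n p|n p].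
- by rewrite !row_gg gg_linl.
- by rewrite !row_gk scaler0 addr0.
- rewrite !row_gd /gd tg_lin scalerDr opprD.
  by rewrite scalerN !scalerA mulrC.
Qed.

Let row_kK v (m : degree) : \sum_p (m p)%:~R *: row_k m p v = 0.
Proof.
have lin_s : linear (fun v => \sum_p (m p)%:~R *: row_k m p v).
  move=> a u w; rewrite scaler_sumr -big_split /=; apply: eq_bigr => p _.
  by rewrite row_k_lin scalerDr !scalerA mulrC.
move: v; apply: (ext_uniq lin_s) => [a u v|x n|n p|n p].
- by rewrite scaler0 addr0.
- by rewrite big1 // => p _; rewrite row_kg scaler0.
- by rewrite big1 // => q _; rewrite row_kk scaler0.
have -> : \sum_q (m q)%:~R *: row_k m q (td n p) =
    - \sum_q (m q)%:~R *: ((m p)%:~R *: tk (m + n) q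
                              + (p == q)%:R *: dk_sum n (m + n)).
  rewrite -sumrN; apply: eq_bigr => q _.
  by rewrite row_kd scalerN eq_sym.
apply/eqP; rewrite oppr_eq0; apply/eqP.
apply: etrans (sum_delta m p _ (tk (m + n)) _) _.
by rewrite -dk_sumE -scalerDr -dk_sumD tkK scaler0.
Qed.

Let bracketE u v : toroidal_bracket c1 c2 u v =
  ext (fun x m => row_g x m v) (fun m a => row_k m a v)
    (fun m a => row_d m a v) u.
Proof. by []. Qed.

Let bracketg x m v : toroidal_bracket c1 c2 (tg x m) v = row_g x m v.
Proof.
exact: (ext_g (fun m a => row_d m a v) (row_g_linl^~ v) (row_kK v)).
Qed.
Let bracketk m a v : toroidal_bracket c1 c2 (tk m a) v = row_k m a v.
Proof.
exact: (ext_k (fun m a => row_d m a v) (row_g_linl^~ v) (row_kK v)).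
Qed.
Let bracketd m a v : toroidal_bracket c1 c2 (td m a) v = row_d m a v.
Proof.
exact: (ext_d (fun m a => row_d m a v) (row_g_linl^~ v) (row_kK v)).
Qed.

Lemma toroidal_bracket_bilinear : is_bilinear (toroidal_bracket c1 c2).
Proof.
have bl v : linear ((toroidal_bracket c1 c2)^~ v).
  exact: (ext_linear (fun m a => row_d m a v) (row_g_linl^~ v) (row_kK v)).
split=> [v|u a v w]; [exact: bl|move: u].
apply: (ext_uniq (bl _) (lin_comb a (bl v) (bl w))) => [x m|m p|m p].
- by rewrite !bracketg; exact: row_g_lin.
- by rewrite !bracketk; exact: row_k_lin.
- by rewrite !bracketd; exact: row_d_lin.
Qed.

Lemma toroidal_bracket_gg x m y n : toroidal_bracket c1 c2 (tg x m) (tg y n) =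
  tg (br x y) (m + n) + (kappa x y : C) *: dk_sum m (m + n).
Proof. by rewrite bracketg row_gg. Qed.

Lemma toroidal_bracket_gk x m n b :
  toroidal_bracket c1 c2 (tg x m) (tk n b) = 0.
Proof. by rewrite bracketg row_gk. Qed.

Lemma toroidal_bracket_kg m a y n :
  toroidal_bracket c1 c2 (tk m a) (tg y n) = 0.
Proof. by rewrite bracketk row_kg. Qed.

Lemma toroidal_bracket_kk m a n b :
  toroidal_bracket c1 c2 (tk m a) (tk n b) = 0.
Proof. by rewrite bracketk row_kk. Qed.

Lemma toroidal_bracket_dg m a y n : toroidal_bracket c1 c2 (td m a) (tg y n) =
  (n a)%:~R *: tg y (m + n).
Proof. by rewrite bracketd row_dg. Qed.

Lemma toroidal_bracket_dk m a n b : toroidal_bracket c1 c2 (td m a) (tk n b) =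
  (n a)%:~R *: tk (m + n) b + (a == b)%:R *: dk_sum m (m + n).
Proof. by rewrite bracketd row_dk. Qed.

Lemma toroidal_bracket_dd m a n b : toroidal_bracket c1 c2 (td m a) (td n b) =
  (n a)%:~R *: td (m + n) b - (m b)%:~R *: td (m + n) a
    + toroidal_phi c1 c2 m a n b.
Proof. by rewrite bracketd row_dd. Qed.

Lemma toroidal_bracket_gd x m n b : toroidal_bracket c1 c2 (tg x m) (td n b) =
  - toroidal_bracket c1 c2 (td n b) (tg x m).
Proof. by rewrite toroidal_bracket_dg bracketg row_gd addrC. Qed.

Lemma toroidal_bracket_kd m a n b : toroidal_bracket c1 c2 (tk m a) (td n b) =
  - toroidal_bracket c1 c2 (td n b) (tk m a).
Proof.
by rewrite toroidal_bracket_dk bracketk row_kd [n + m]addrC [b == a]eq_sym.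
Qed.

End ToroidalBracket.

Section Toroidal.
Variables (C : fieldType) (nu : nat).
Local Notation degree := (degree nu).
Local Notation laurent := (laurent C nu).
Local Notation der := (der C nu).

(* The p-th copy of t^m in A^(nu + 1); as an element of der it is t^m d_p. *)
Definition mono (m : degree) (p : 'I_nu.+1) : der :=
  [ffun q => if q == p then << m >> else 0 : laurent].

(* K: the free A-module on symbols k_0, ..., k_nu, as a vector space, modulo
   \sum_p m_p t^m k_p = 0 for all m. *)
Inductive kahler_rel : der -> Prop :=
| KahlerRel (m : degree) : kahler_rel (\sum_p (m p)%:~R *: mono m p).

Definition kahler : Type := lquot kahler_rel.

HB.instance Definition _ := GRing.Lmodule.on kahler.

(* The linear map t^m d_p |-> f m p. *)
Definition der_ext (M : lmodType C) (f : degree -> 'I_nu.+1 -> M)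
    (u : der) : M := \sum_p free_ext (f^~ p) (u p).

(* The linear map t^m k_p |-> f m p, for f compatible with the relations. *)
Definition kahler_ext (M : lmodType C) (f : degree -> 'I_nu.+1 -> M) :
  kahler -> M := lquot_lift (der_ext f).

Section DerExt.
Variables (M : lmodType C) (f : degree -> 'I_nu.+1 -> M).

Lemma der_ext_linear : linear (der_ext f).
Proof.
move=> a u v; rewrite /der_ext scaler_sumr -big_split /=.
by apply: eq_bigr => p _; rewrite !ffunE free_ext_linear.
Qed.

Lemma der_extE m p : der_ext f (mono m p) = f m p.
Proof.
rewrite /der_ext (bigD1 p) //= big1 => [|q qp]; rewrite ffunE.
  by rewrite eqxx free_extU addr0.
by rewrite (negPf qp) (lin0 (free_ext_linear _)).
Qed.

Hypothesis fK : forall m : degree, \sum_p (m p)%:~R *: f m p = 0.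

Let fS s : kahler_rel s -> der_ext f s = 0.
Proof.
have f_lin := der_ext_linear.
case=> m; rewrite (lin_sum f_lin) -[RHS](fK m).
by apply: eq_bigr => p _; rewrite (linZ f_lin) der_extE.
Qed.

Lemma kahler_ext_linear : linear (kahler_ext f).
Proof. by apply: lquot_lift_linear => //; exact: der_ext_linear. Qed.

Lemma kahler_extE m p : kahler_ext f (lquot_pi kahler_rel (mono m p)) = f m p.
Proof.
by rewrite /kahler_ext lquot_liftE ?der_extE //; exact: der_ext_linear.
Qed.

End DerExt.

Lemma der_ind (P : der -> Prop) :
  P 0 -> (forall a u v, P u -> P v -> P (a *: u + v)) ->
  (forall m p, P (mono m p)) -> forall u, P u.
Proof.
move=> P0 Plin Pm u.
pose one_comp (p : 'I_nu.+1) (a : laurent) : der :=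
  [ffun q => if q == p then a else 0].
have -> : u = \sum_p one_comp p (u p).
  apply/ffunP => q; rewrite sum_ffunE (bigD1 q) //= ffunE eqxx big1 ?addr0 //.
  by move=> p pq; rewrite ffunE eq_sym (negPf pq).
elim: (index_enum _) => [|p r IHr]; first by rewrite big_nil.
rewrite big_cons -[one_comp _ _]scale1r; apply: (Plin) => // {r IHr}.
elim/free_ind: (u p) => [|a v w Pv Pw|m]; last exact: Pm.
- rewrite (_ : one_comp p 0 = 0) //.
  by apply/ffunP => q; rewrite !ffunE; case: ifP.
- rewrite (_ : one_comp p _ = a *: one_comp p v + one_comp p w).
    exact: Plin.
  by apply/ffunP => q; rewrite !ffunE; case: ifP; rewrite // scaler0 addr0.
Qed.

Variable g : lmodType C.

(* (g (x) A) (+) K (+) D *)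
Definition tau : Type := (tensor g laurent * kahler * der)%type.

HB.instance Definition _ := GRing.Lmodule.on tau.

(* x (x) t^m, t^m k_p and t^m d_p *)
Definition tau_g (x : g) (m : degree) : tau :=
  (tens x (<< m >> : laurent), 0, 0).
Definition tau_k (m : degree) (p : 'I_nu.+1) : tau :=
  (0, lquot_pi kahler_rel (mono m p), 0).
Definition tau_d (m : degree) (p : 'I_nu.+1) : tau := (0, 0, mono m p).

(* The linear map with the prescribed values on the x (x) t^m, t^m k_p and
   t^m d_p. *)
Definition tau_ext (M : lmodType C) (fg : g -> degree -> M)
    (fk fd : degree -> 'I_nu.+1 -> M) (u : tau) : M :=
  tens_lift (fun x (a : laurent) => free_ext (fg x) a) u.1.1
    + kahler_ext fk u.1.2 + der_ext fd u.2.

Lemma tau_ind (P : tau -> Prop) :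
  P 0 -> (forall a u v, P u -> P v -> P (a *: u + v)) ->
  (forall x m, P (tau_g x m)) -> (forall m p, P (tau_k m p)) ->
  (forall m p, P (tau_d m p)) -> forall u, P u.
Proof.
move=> P0 Plin Pg Pk Pd [[u w] z].
have PE a (b c : tau) (d : tau) : d = a *: b + c -> P b -> P c -> P d.
  by move=> ->; exact: Plin.
have Pu : P (u, 0, 0).
  elim/tens_ind: u => // [a u v Pu Pv|x a].
    by apply: (PE a _ _ _ _ Pu Pv); congr (_, _, _); rewrite /= scaler0 addr0.
  have [tl tr] := @tens_bilinear C g laurent.
  elim/free_ind: a => [|a u v Pu Pv|m]; last exact: Pg.
    by rewrite (lin0 (tr x)).
  rewrite (tr x); apply: (PE a _ _ _ _ Pu Pv).
  by congr (_, _, _); rewrite /= scaler0 addr0.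
have Pw : P (0, w, 0).
  rewrite -[w]lquot_reprK; have pi_lin := @lquot_pi_linear _ _ kahler_rel.
  elim/der_ind: (repr w) => [|a u' v Pu' Pv|m p]; last exact: Pk.
    by rewrite (lin0 pi_lin).
  rewrite pi_lin; apply: (PE a _ _ _ _ Pu' Pv).
  by congr (_, _, _); rewrite /= scaler0 addr0.
have Pz : P (0, 0, z).
  elim/der_ind: z => // a u' v Pu' Pv.
  apply: (PE a _ _ _ _ Pu' Pv); by congr (_, _, _); rewrite /= scaler0 addr0.
apply: (PE 1 _ _ _ _ Pu (Plin 1 _ _ Pw Pz)).
by rewrite !scale1r; congr (_, _, _); rewrite /= ?addr0 ?add0r.
Qed.

Lemma tau_lin_ext (M : lmodType C) (F G : tau -> M) : linear F -> linear G ->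
  (forall x m, F (tau_g x m) = G (tau_g x m)) ->
  (forall m p, F (tau_k m p) = G (tau_k m p)) ->
  (forall m p, F (tau_d m p) = G (tau_d m p)) -> F =1 G.
Proof.
move=> Fl Gl eg ek ed u; elim/tau_ind: u => //.
- by rewrite (lin0 Fl) (lin0 Gl).
- by move=> a u v Fu Fv; rewrite Fl Gl Fu Fv.
Qed.

Section TauExt.
Variables (M : lmodType C) (fg : g -> degree -> M).
Variables (fk fd : degree -> 'I_nu.+1 -> M).
Hypothesis fg_lin : forall m, linear (fg^~ m).
Hypothesis fkK : forall m : degree, \sum_p (m p)%:~R *: fk m p = 0.

Let fg_bil : is_bilinear (fun x (a : laurent) => free_ext (fg x) a).
Proof.
split=> [a|x]; last exact: free_ext_linear.
move=> c x y; rewrite /free_ext scaler_sumr -big_split /=.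
by apply: eq_bigr => m _; rewrite fg_lin scalerDr !scalerA mulrC.
Qed.

Lemma tau_ext_linear : linear (tau_ext fg fk fd).
Proof.
move=> a u v; rewrite /tau_ext /= (tens_lift_linear fg_bil).
rewrite (kahler_ext_linear fkK) der_ext_linear !scalerDr.
by rewrite [X in X + _ = _]addrACA [LHS]addrACA.
Qed.

Lemma tau_ext_g x m : tau_ext fg fk fd (tau_g x m) = fg x m.
Proof.
rewrite /tau_ext /= (tens_liftE fg_bil) (lin0 (kahler_ext_linear fkK)).
by rewrite (lin0 (der_ext_linear _)) !addr0 free_extU.
Qed.

Lemma tau_ext_k m p : tau_ext fg fk fd (tau_k m p) = fk m p.
Proof.
rewrite /tau_ext /= (lin0 (tens_lift_linear fg_bil)) (kahler_extE fkK).
by rewrite (lin0 (der_ext_linear _)) addr0 add0r.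
Qed.

Lemma tau_ext_d m p : tau_ext fg fk fd (tau_d m p) = fd m p.
Proof.
rewrite /tau_ext /= (lin0 (tens_lift_linear fg_bil)) der_extE.
by rewrite (lin0 (kahler_ext_linear fkK)) !add0r.
Qed.

End TauExt.

Lemma tau_g_linear m : linear (tau_g^~ m).
Proof.
move=> a x y; rewrite /tau_g (proj1 (@tens_bilinear C g laurent) _ a x y).
by congr (_, _, _); rewrite /= scaler0 addr0.
Qed.

Lemma tau_k_linear (F := fun z : der => (0, lquot_pi kahler_rel z, 0) : tau) :
  linear F.
Proof.
move=> a u v; rewrite /F (lquot_pi_linear _ a u v).
by congr (_, _, _); rewrite /= scaler0 addr0.
Qed.

Lemma tau_k_rel (m : degree) : \sum_p (m p)%:~R *: tau_k m p = 0.
Proof.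
have -> : \sum_p (m p)%:~R *: tau_k m p =
    (0, lquot_pi kahler_rel (\sum_p (m p)%:~R *: mono m p), 0).
  rewrite (lin_sum tau_k_linear).
  by apply: eq_bigr => p _; rewrite (linZ tau_k_linear).
by rewrite lquot_pi_eq0 //; exact: KahlerRel.
Qed.

Definition tau_bracket (br : g -> g -> g) (kappa : g -> g -> C^o) (c1 c2 : C)
    (u v : tau) : tau :=
  toroidal_bracket br kappa tau_g tau_k tau_d (@tau_ext tau) c1 c2 u v.

Section Bracket.
Variables (br : g -> g -> g) (kappa : g -> g -> C^o) (c1 c2 : C).
Hypotheses (br_bil : is_bilinear br) (kappa_bil : is_bilinear kappa).

Lemma tau_ext_spec fg fk fd (fgl : forall m, linear (fg^~ m))
  (fkK : forall m : degree, \sum_p (m p)%:~R *: fk m p = 0) :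
  [/\ linear (@tau_ext tau fg fk fd),
      forall x m, tau_ext fg fk fd (tau_g x m) = fg x m,
      forall m p, tau_ext fg fk fd (tau_k m p) = fk m p &
      forall m p, tau_ext fg fk fd (tau_d m p) = fd m p].
Proof.
split.
- exact: (tau_ext_linear fd fgl fkK).
- exact: (tau_ext_g fd fgl fkK).
- exact: (tau_ext_k fd fgl fkK).
- exact: (tau_ext_d fd fgl fkK).
Qed.

Lemma tau_bracket_bilinear : is_bilinear (tau_bracket br kappa c1 c2).
Proof.
exact: (toroidal_bracket_bilinear c1 c2 br_bil kappa_bil tau_g_linear
  tau_k_rel tau_ext_spec (@tau_lin_ext tau)).
Qed.

Lemma tau_bracket_gg x m y n :
  tau_bracket br kappa c1 c2 (tau_g x m) (tau_g y n) =
    tau_g (br x y) (m + n) + (kappa x y : C) *: dk_sum tau_k m (m + n).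
Proof.
exact: (toroidal_bracket_gg c1 c2 br_bil kappa_bil tau_g_linear
  tau_k_rel tau_ext_spec (@tau_lin_ext tau)).
Qed.

Lemma tau_bracket_gk x m n b :
  tau_bracket br kappa c1 c2 (tau_g x m) (tau_k n b) = 0.
Proof.
exact: (toroidal_bracket_gk c1 c2 br_bil kappa_bil tau_g_linear
  tau_k_rel tau_ext_spec (@tau_lin_ext tau)).
Qed.

Lemma tau_bracket_kk m a n b :
  tau_bracket br kappa c1 c2 (tau_k m a) (tau_k n b) = 0.
Proof.
exact: (toroidal_bracket_kk c1 c2 br_bil kappa_bil tau_g_linear
  tau_k_rel tau_ext_spec (@tau_lin_ext tau)).
Qed.

Lemma tau_bracket_dg m a y n :
  tau_bracket br kappa c1 c2 (tau_d m a) (tau_g y n) =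
    (n a)%:~R *: tau_g y (m + n).
Proof.
exact: (toroidal_bracket_dg c1 c2 br_bil kappa_bil tau_g_linear
  tau_k_rel tau_ext_spec (@tau_lin_ext tau)).
Qed.

Lemma tau_bracket_dk m a n b :
  tau_bracket br kappa c1 c2 (tau_d m a) (tau_k n b) =
    (n a)%:~R *: tau_k (m + n) b + (a == b)%:R *: dk_sum tau_k m (m + n).
Proof.
exact: (toroidal_bracket_dk c1 c2 br_bil kappa_bil tau_g_linear
  tau_k_rel tau_ext_spec (@tau_lin_ext tau)).
Qed.

Lemma tau_bracket_dd m a n b :
  tau_bracket br kappa c1 c2 (tau_d m a) (tau_d n b) =
    (n a)%:~R *: tau_d (m + n) b - (m b)%:~R *: tau_d (m + n) a
      + toroidal_phi tau_k c1 c2 m a n b.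
Proof.
exact: (toroidal_bracket_dd c1 c2 br_bil kappa_bil tau_g_linear
  tau_k_rel tau_ext_spec (@tau_lin_ext tau)).
Qed.

Lemma tau_bracket_kg m a y n :
  tau_bracket br kappa c1 c2 (tau_k m a) (tau_g y n) = 0.
Proof.
exact: (toroidal_bracket_kg c1 c2 br_bil kappa_bil tau_g_linear
  tau_k_rel tau_ext_spec (@tau_lin_ext tau)).
Qed.

Lemma tau_bracket_gd x m n b :
  tau_bracket br kappa c1 c2 (tau_g x m) (tau_d n b) =
    - tau_bracket br kappa c1 c2 (tau_d n b) (tau_g x m).
Proof.
exact: (toroidal_bracket_gd c1 c2 br_bil kappa_bil tau_g_linear
  tau_k_rel tau_ext_spec (@tau_lin_ext tau)).
Qed.

Lemma tau_bracket_kd m a n b :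
  tau_bracket br kappa c1 c2 (tau_k m a) (tau_d n b) =
    - tau_bracket br kappa c1 c2 (tau_d n b) (tau_k m a).
Proof.
exact: (toroidal_bracket_kd c1 c2 br_bil kappa_bil tau_g_linear
  tau_k_rel tau_ext_spec (@tau_lin_ext tau)).
Qed.

End Bracket.

End Toroidal.

Section CurrentAlgebra.
Variables (C : fieldType) (L : lmodType C) (brL : L -> L -> L).
Variable (B : comAlgType C).

(* [x (x) b, y (x) b'] = [x, y] (x) bb' on L (x) B *)
Definition current_bracket (u v : tensor L B) : tensor L B :=
  tens_lift (fun x (b : B) =>
    tens_lift (fun y (b' : B) => tens (brL x y) (b * b')) v) u.

Hypothesis brL_bil : is_bilinear brL.

Let tl := @tens_bilinear C L B.

Let row_bil x (b : B) : is_bilinear (fun y (b' : B) => tens (brL x y) (b * b')).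
Proof.
split=> [b' a y z|y a b' b''].
  by rewrite (proj2 brL_bil) (proj1 tl).
by rewrite mulrDr -(@scalerAr _ B) (proj2 tl).
Qed.

Let row x b := tens_lift (fun y (b' : B) => tens (brL x y) (b * b')).

Let row_lin x b : linear (row x b).
Proof. exact: (tens_lift_linear (row_bil x b)). Qed.

Let rowE x b y b' : row x b (tens y b') = tens (brL x y) (b * b').
Proof. exact: (tens_liftE (row_bil x b)). Qed.

Let outer_bil v : is_bilinear (fun x (b : B) => row x b v).
Proof.
split=> [b a x z|x a b b']; move: v.
  apply: (tens_lin_ext (row_lin _ _)
    (lin_comb a (row_lin x b) (row_lin z b))) => y b'.
  by rewrite !rowE (proj1 brL_bil) (proj1 tl).
apply: (tens_lin_ext (row_lin _ _)
  (lin_comb a (row_lin x b) (row_lin x b'))) => y d.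
by rewrite !rowE mulrDl -(@scalerAl _ B) (proj2 tl).
Qed.

Lemma current_bracketE x (b : B) y (b' : B) :
  current_bracket (tens x b) (tens y b') = tens (brL x y) (b * b').
Proof.
exact: etrans (tens_liftE (outer_bil _) x b) (rowE x b y b').
Qed.

Lemma current_bracket_bilinear : is_bilinear current_bracket.
Proof.
have bl v : linear (current_bracket^~ v).
  exact: (tens_lift_linear (outer_bil v)).
split=> [//|u a v w]; move: u.
apply: (tens_lin_ext (bl _) (lin_comb a (bl v) (bl w))) => x b.
have e v' : current_bracket (tens x b) v' = row x b v'.
  exact: (tens_liftE (outer_bil v')).
by rewrite !e row_lin.
Qed.

End CurrentAlgebra.

Definition is_fin_gen_alg (C : fieldType) (B : comAlgType C) : Prop :=
  exists s : seq B, forall S : {pred B},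
    subalg_closed S -> {subset s <= S} -> S =i predT.

Definition is_direct_sum (C : fieldType) (V : lmodType C) (I : eqType)
    (W : I -> V -> Prop) : Prop :=
  (forall v, exists (s : seq I) (w : I -> V),
     (forall i, W i (w i)) /\ v = \sum_(i <- s) w i) /\
  (forall (s : seq I) (w : I -> V), uniq s -> (forall i, W i (w i)) ->
     \sum_(i <- s) w i = 0 -> forall i, i \in s -> w i = 0).

Definition is_fin_dim_subspace (C : fieldType) (V : lmodType C)
    (W : V -> Prop) : Prop :=
  exists (n : nat) (e : 'I_n -> V), (forall i, W (e i)) /\
    forall v, W v -> exists c : 'I_n -> C, v = \sum_i c i *: e i.

(* iota : h -> L is the embedding of the Cartan subalgebra. *)
Definition weight_space (C : fieldType) (h : vectType C) (L V : lmodType C)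
    (iota : h -> L) (rho : L -> V -> V) (lambda : 'Hom(h, C^o)) (v : V) :
    Prop :=
  forall x : h, rho (iota x) v = (lambda x : C) *: v.

Section Integrable.
Variables (C : fieldType) (nu : nat) (g : vectType C).
Variables (br : g -> g -> g) (H : {vspace g}).

(* The triple (x, c, e) stands for x + \sum_i c_i k_i + \sum_i e_i d_i. *)
Definition tau_cartan_type : Type :=
  (subvs_of H * 'rV[C]_nu.+1 * 'rV[C]_nu.+1)%type.

HB.instance Definition _ := Vector.on tau_cartan_type.

Definition tau_cartan (h : tau_cartan_type) : tau nu g :=
  tau_g (vsval h.1.1) 0 + \sum_i h.1.2 0 i *: tau_k g 0 i
    + \sum_i h.2 0 i *: tau_d g 0 i.

(* The x_alpha (x) t^m with alpha a root. *)
Inductive root_vector : tau nu g -> Prop :=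
| RootVector (alpha : 'Hom(subvs_of H, C^o)) x m :
    is_root br alpha -> root_space br alpha x -> root_vector (tau_g x m).

Definition is_integrable_tau (V : lmodType C) (rho : tau nu g -> V -> V) :=
  is_direct_sum (weight_space tau_cartan rho) /\
  forall z v, root_vector z -> exists n, iter n (rho z) v = 0.

Section Coefficients.
Variable (B : comAlgType C).

Definition tauB_cartan (h : tau_cartan_type) : tensor (tau nu g) B :=
  tens (tau_cartan h) 1.

Definition is_integrable_tauB (V : lmodType C)
    (rho : tensor (tau nu g) B -> V -> V) :=
  is_direct_sum (weight_space tauB_cartan rho) /\
  forall z b v, root_vector z -> exists n, iter n (rho (tens z b)) v = 0.

Definition in_C_fin (V : lmodType C)
    (rho : tensor (tau nu g) B -> V -> V) : Prop :=
  is_integrable_tauB rho /\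
  forall lambda, is_fin_dim_subspace (weight_space tauB_cartan rho lambda).

End Coefficients.

End Integrable.

Definition is_single_point_evaluation (C : fieldType) (L : lmodType C)
    (B : comAlgType C) (V : lmodType C) (rho : tensor L B -> V -> V) : Prop :=
  exists psi : {lrmorphism B -> C^o}, forall x b v,
    rho (tens x b) v = (psi b : C) *: rho (tens x 1) v.

(* Main.v *)
Require Import Defs.
From HB Require Import structures.
From mathcomp Require Import all_boot all_order all_algebra zify ring.
From mathcomp Require Import boolp reals complex.

Set Implicit Arguments.
Unset Strict Implicit.
Unset Printing Implicit Defensive.

Import Order.TTheory GRing.Theory Num.Theory.
Local Open Scope ring_scope.

(** Let M be the ideal of all b in B such that tau (x) bB acts by zero on V.  One
    has to show B = C + M.

    If the elements of weight zero in tau (x) aB are locally nilpotent, then all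
    traces of weight-zero words containing a factor from tau (x) aB vanish, and
    irreducibility, which provides a combination of such words fixing a nonzero
    vector when a is not in M, forces a into M.  By finiteness of the weight
    spaces this applies to some nonzero polynomial in each b, so that B/M is
    algebraic over C.  Hence if B <> C + M, there is either an e with e^2 - e
    in M and e, 1 - e not in M, or an a not in M with a^2 in M.

    For e, let P be the set of degrees g such that the degrees kg + s of tau (x) e
    do not kill all of V eventually, and let Q be its analogue for 1 - e.  Both
    meet each pair {g, -g}, while P and s - Q have finite intersection for all s,
    by comparing eigenvalues of d_i (x) e on fixed weight spaces.  This is
    impossible since Z^(nu+1) is one-ended.

    For a, the operators from tau (x) a commute with each other, and pair with
    those from tau (x) 1 as in a Heisenberg algebra.  The degrees g in which
    a suitable element of tau (x) a is locally nilpotent meet each pair {g, -g}.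
    If infinitely many such g had s - g of the same kind, then applying elements
    of tau (x) 1 of degrees -g and g - s to a vacuum vector would give too many
    independent vectors in one weight space.  Again Z^(nu+1) is one-ended.

    When tau(B) acts by zero one still needs a character of B; it is provided by
    the Nullstellensatz, proved through the uncountability of C. *)

(** * Matrices and weight spaces *)

(** The obstacle is that the dimensions of weight spaces need not be bounded along imaginary
    directions, where no sl2-theory makes strings finite, so nilpotence exponents depend on the
    weight. Boundedness is recovered from a dichotomy for a degree g that is not too small: unless
    high multiples of g kill every vector, finitely many operators of degree about g are jointly
    injective on each weight space, which bounds its dimension by those of a few others. As g and -g
    cannot both kill, there are arbitrarily large regions where one constant bounds all dimensions,
    and the combinatorics of words takes place there. One interface serves two situations. If g (x)
    A acts nontrivially, then g acts faithfully, and the diagonalizability of the Cartan subalgebra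
    as well as the finiteness of root strings are read off from the integrable module V itself. If
    it acts by zero, so do the central k_p; the weights of g are then collapsed to 0, and the
    derivations carry the argument. *)

Section NilpotentMatrices.
Variable C : numClosedFieldType.

Lemma eigen_iter n (A : 'M[C]_n) (v : 'rV_n) z k :
  v *m A = z *: v -> v *m A ^+ k = z ^+ k *: v.
Proof.
move=> vA; elim: k => [|k IHk]; first by rewrite !expr0 mulmx1 scale1r.
by rewrite exprSr [A ^+ k * A]/(_ *m _) mulmxA IHk -scalemxAl vA scalerA -exprSr.
Qed.

Lemma nilmx_char_poly n (A : 'M[C]_n) q : A ^+ q = 0 -> char_poly A = 'X^n.
Proof.
move=> Aq; have [r Er] := closed_field_poly_normal (char_poly A).
move: Er; rewrite (monicP (char_poly_monic A)) scale1r => Er.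
have r0 z : z \in r -> z = 0.
  move=> zr; have : root (char_poly A) z by rewrite Er root_prod_XsubC.
  rewrite -eigenvalue_root_char => /eigenvalueP [v vA v0].
  have /eqP := eigen_iter q vA; rewrite Aq mulmx0 eq_sym scaler_eq0 (negPf v0).
  by rewrite orbF expf_eq0 => /andP [_ /eqP].
have Er' : char_poly A = 'X^(size r).
  rewrite Er big_seq (eq_bigr (fun=> 'X)) => [|z /r0 ->]; last by rewrite subr0.
  by rewrite -big_seq big_const_seq count_predT iter_mulr_1.
by have := size_char_poly A; rewrite Er' size_polyXn => -[->].
Qed.

Lemma nilmx_exp n (A : 'M[C]_n) q : A ^+ q = 0 -> A ^+ n = 0.
Proof.
case: n A => [|n] A Aq; first by rewrite flatmx0 [RHS]flatmx0.
have := Cayley_Hamilton A; rewrite (nilmx_char_poly Aq).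
by rewrite rmorphXn /= horner_mx_X.
Qed.

Lemma nilmx_trace n (A : 'M[C]_n) q : A ^+ q = 0 -> \tr A = 0.
Proof.
case: n A => [|n] A Aq; first by rewrite /mxtrace big_ord0.
apply/eqP; rewrite -oppr_eq0 -char_poly_trace //.
by rewrite (nilmx_char_poly Aq) coefXn /= ltn_eqF.
Qed.

(* The spectral idempotent of the nonzero part of the spectrum of A is a
   polynomial in A without constant term, hence has trace 0, hence vanishes. *)
Lemma trace_exp_eq0 n (A : 'M[C]_n) (v : 'rV_n) :
  (forall k, \tr (A ^+ k.+1) = 0) -> v *m A = v -> v = 0.
Proof.
case: n A v => [|n] A v trA vA; first by rewrite [v]thinmx0.
have [k [q q0 Eq]] := multiplicity_XsubC (char_poly A) 0.
move: q0; rewrite (monic_neq0 (char_poly_monic A)) /= => q0.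
have cop : coprimep ('X ^+ k.+1) q.
  by rewrite coprimep_expl // -['X]subr0 coprimep_sym coprimep_XsubC.
have [[u w] /= Euw] := Bezout_eq1_coprimepP _ _ cop.
set p := u * 'X ^+ k.+1 in Euw; pose E : 'M[C]_n.+1 := horner_mx A p.
have pq0 : horner_mx A (p * q) = 0.
  have -> : p * q = u * 'X * (q * ('X - 0%:P) ^+ k).
    rewrite /p subr0 exprS -!mulrA; congr (_ * (_ * _)).
    by rewrite mulrC.
  by rewrite -Eq rmorphM /= Cayley_Hamilton mulr0.
have EE : E *m E = E.
  have : E * (1 - E) = 0.
    rewrite /E -(rmorph1 (horner_mx A)) -rmorphB -rmorphM -Euw addrAC subrr.
    by rewrite add0r mulrCA rmorphM /= pq0 mulr0.
  by rewrite mulrBr mulr1 => /eqP; rewrite subr_eq0 eq_sym => /eqP.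
have trE : \tr E = 0.
  rewrite /E /p -(coefK u) poly_def mulr_suml rmorph_sum /= raddf_sum /=.
  rewrite big1 // => i _; rewrite -scalerAl -exprD linearZ /= rmorphXn /=.
  by rewrite horner_mx_X mxtraceZ addnS trA mulr0.
(* In the rank factorization of E, idempotence forces [row_base E *m col_base E = 1], so trace and
   rank agree. *)
have rE : \tr E = (\rank E)%:R.
  have cE := mulmx_base E.
  have EI : row_base E *m col_base E = 1%:M.
    apply: (@row_free_inj _ _ _ _ _ (row_base_free E)).
    apply: (@row_full_inj _ _ _ _ _ (col_base_full E)).
    rewrite mul1mx; move: cE; move: (col_base E) (row_base E) => c r cr.
    by rewrite !mulmxA cr -mulmxA cr.
  by rewrite -{1}[E]mulmx_base mxtrace_mulC EI mxtrace1.
have E0 : E = 0.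
  by move: rE; rewrite trE => /esym/eqP; rewrite pnatr_eq0 mxrank_eq0 => /eqP.
have vAk j : v *m A ^+ j = v.
  by rewrite (@eigen_iter _ _ _ 1) ?expr1n ?scale1r.
have vh (s : {poly C}) : v *m horner_mx A s = s.[1] *: v.
  rewrite -{1}(coefK s) poly_def rmorph_sum /= mulmx_sumr horner_coef scaler_suml.
  apply: eq_bigr => i _; rewrite linearZ /= rmorphXn /= horner_mx_X.
  by rewrite -scalemxAr vAk expr1n mulr1.
have := congr1 (fun s => s.[1]) Euw; rewrite /= hornerD hornerC.
have vE : p.[1] *: v = 0 by rewrite -vh [horner_mx A p]E0 mulmx0.
move=> sum1; have := congr1 (fun c => c *: v) sum1.
rewrite /= scale1r scalerDl vE add0r => <-.
have vq : (q * ('X - 0%:P) ^+ k).[1] *: v = 0.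
  by rewrite -Eq -vh Cayley_Hamilton mulmx0.
move: vq; rewrite hornerM subr0 hornerXn expr1n mulr1 => vq.
by rewrite hornerM -scalerA vq scaler0.
Qed.

(** Were the rank preserved, [U] and [U *m N] would have the same row space, and iteration would put
    [U] inside [U *m N ^+ q = 0]. The truncated predecessor covers [U = 0]. *)
Lemma nil_comm_rank n m (N : 'M[C]_n) q (U : 'M[C]_(m, n)) :
  N ^+ q = 0 -> (U *m N <= U)%MS -> (\rank (U *m N) <= (\rank U).-1)%N.
Proof.
move=> Nq UN; have [-> //|ne] := eqVneq (\rank (U *m N)) 0%N.
have le : (\rank (U *m N) <= \rank U)%N by exact: mxrankS.
rewrite -ltnS prednK; last by apply: leq_trans le; rewrite lt0n.
rewrite ltn_neqAle le andbT; apply: contra ne => /eqP eqr.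
have /eqmxP/eqmx_sym UNU : (U *m N == U)%MS by rewrite -(geq_leqif (mxrank_leqif_eq UN)) eqr.
have : (U <= U *m N ^+ q)%MS.
  elim: (q) => [|k IHk]; first by rewrite expr0 mulmx1.
  rewrite exprS [N * _]/(_ *m _) mulmxA.
  by apply: (submx_trans IHk); apply: submxMr; rewrite UNU.
by rewrite Nq mulmx0 => /submx0null ->; rewrite mul0mx mxrank0.
Qed.

(** Each factor commutes with the product of those after it, hence preserves its row space and
    lowers its rank by at least one. *)
Lemma prod_comm_nilmx n (As : seq 'M[C]_n) :
  (n <= size As)%N ->
  (forall A, A \in As -> exists q, A ^+ q = 0) ->
  (forall A B, A \in As -> B \in As -> A *m B = B *m A) ->
  foldr (@mulmx _ n n n) 1%:M As = 0.
Proof.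
move=> nAs nil com; suff H : forall Bs, {subset Bs <= As} ->
    (\rank (foldr (@mulmx _ n n n) 1%:M Bs) <= n - size Bs)%N.
  by apply/eqP; rewrite -mxrank_eq0 -leqn0 (leq_trans (H As _)) // leqn0 subn_eq0.
elim=> [|A Bs IHB] sB /=; first by rewrite mxrank1 subn0.
have sB' : {subset Bs <= As} by move=> x xB; apply: sB; rewrite inE xB orbT.
have AAs : A \in As by apply: sB; rewrite inE eqxx.
have cA : A *m foldr (@mulmx _ n n n) 1%:M Bs = foldr (@mulmx _ n n n) 1%:M Bs *m A.
  elim: Bs sB' {IHB sB} => [|B Bs IHB] sB /=; first by rewrite mulmx1 mul1mx.
  rewrite mulmxA (com A B) ?(sB B) ?inE ?eqxx // -mulmxA IHB ?mulmxA // => x xB.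
  by apply: sB; rewrite inE xB orbT.
have [q Aq] := nil _ AAs; rewrite cA.
apply: (leq_trans (nil_comm_rank Aq _)); first by rewrite -cA submxMl.
by rewrite subnS -!subn1 leq_sub2r // IHB.
Qed.

End NilpotentMatrices.

(** Subspaces are propositional, since most of those below are existential statements (local
    nilpotence, eventual vanishing) to which irreducibility is applied. *)
Definition lin_closed (C : fieldType) (V : lmodType C) (W : V -> Prop) : Prop :=
  W 0 /\ forall a u v, W u -> W v -> W (a *: u + v).

Section LinClosed.
Variables (C : fieldType) (V : lmodType C) (W : V -> Prop).
Hypothesis Wl : lin_closed W.

Lemma lcD u v : W u -> W v -> W (u + v).
Proof. by move=> Wu Wv; rewrite -[u]scale1r; apply: (proj2 Wl). Qed.

Lemma lcZ a u : W u -> W (a *: u).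
Proof. by move=> Wu; rewrite -[_ *: _]addr0; apply: (proj2 Wl) => //; case: Wl. Qed.

Lemma lcN u : W u -> W (- u).
Proof. by move=> Wu; rewrite -scaleN1r; apply: lcZ. Qed.

Lemma lcB u v : W u -> W v -> W (u - v).
Proof. by move=> Wu Wv; apply: lcD => //; apply: lcN. Qed.

Lemma lc_sum (I : Type) (r : seq I) (P : pred I) (F : I -> V) :
  (forall i, P i -> W (F i)) -> W (\sum_(i <- r | P i) F i).
Proof. by move=> WF; apply: big_ind => //; [case: Wl|exact: lcD]. Qed.

Lemma lc_cancel a u : a != 0 -> W (a *: u) -> W u.
Proof. by move=> a0 /(lcZ a^-1); rewrite scalerA mulVf // scale1r. Qed.

End LinClosed.

Lemma iter_lin (C : fieldType) (V : lmodType C) (F : V -> V) q :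
  linear F -> linear (iter q F).
Proof. by move=> Fl; elim: q => // q IHq a u v /=; rewrite IHq Fl. Qed.

(** A spanning family of least size is free, because a nontrivial relation would make one member
    redundant. *)
Lemma fin_basis (C : fieldType) (V : lmodType C) (W : V -> Prop) :
  is_fin_dim_subspace W -> exists n (e : 'I_n -> V),
    [/\ forall i, W (e i),
        forall v, W v -> exists c : 'I_n -> C, v = \sum_i c i *: e i &
        forall c : 'I_n -> C, \sum_i c i *: e i = 0 -> forall i, c i = 0].
Proof.
pose sp n := `[< exists e : 'I_n -> V, (forall i, W (e i)) /\
  forall v, W v -> exists c : 'I_n -> C, v = \sum_i c i *: e i >].
move=> fW; have /ex_minnP [n /asboolP [e [We spe]] nmin] : exists n, sp n.
  by have [n fn] := fW; exists n; apply/asboolP.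
exists n, e; split=> // c ce i; apply/eqP/negP => /negP ci0.
case: n e We spe nmin c ce i ci0 => [|n] e We spe nmin c ce i ci0; first by case: i ci0.
suff /nmin : sp n by rewrite ltnn.
have ei : e i = \sum_(j < n) (- (c i)^-1 * c (lift i j)) *: e (lift i j).
  move: ce; rewrite (bigD1_ord i) //= => /eqP; rewrite addr_eq0 => /eqP ce.
  rewrite -[LHS]scale1r -(mulVf ci0) -scalerA ce scalerN -scaleNr scaler_sumr.
  by apply: eq_bigr => j _; rewrite scalerA.
apply/asboolP; exists (e \o lift i); split=> [j|v /spe [b ->]]; first exact: We.
exists (fun j => b i * (- (c i)^-1 * c (lift i j)) + b (lift i j)).
rewrite (bigD1_ord i) //= ei scaler_sumr -big_split /=.
by apply: eq_bigr => j _; rewrite scalerDl scalerA.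
Qed.

Section WeightSpaces.
Variables (C : numClosedFieldType) (V : lmodType C) (I : eqType).
Variable Vw : I -> V -> Prop.
Hypothesis Vw_lin : forall l, lin_closed (Vw l).
Hypothesis Vw_fin : forall l, is_fin_dim_subspace (Vw l).
Hypothesis Vw_sum : is_direct_sum Vw.

Definition wdim l : nat := sval (cid (fin_basis (Vw_fin l))).
Definition wbasis l := cid (svalP (cid (fin_basis (Vw_fin l)))).
Definition wb l : 'I_(wdim l) -> V := sval (wbasis l).

Lemma wb_in l i : Vw l (@wb l i).
Proof. by rewrite /wb; case: (wbasis l) => e []. Qed.

Lemma wb_span l v : Vw l v -> exists c : 'rV_(wdim l), v = \sum_i c 0 i *: @wb l i.
Proof.
rewrite /wb; case: (wbasis l) => e [_ sp _] /= /sp [c ->].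
by exists (\row_i c i); apply: eq_bigr => i _; rewrite mxE.
Qed.

Definition wfr l (x : 'rV[C]_(wdim l)) : V := \sum_i x 0 i *: @wb l i.
(** Coordinates in the chosen basis, and 0 off the weight space; the matrices below are therefore
    meaningful only under [wmaps]. *)
Definition wco l (v : V) : 'rV[C]_(wdim l) :=
  match pselect (Vw l v) with
  | left h => sval (cid (wb_span h)) | right _ => 0 end.

Lemma wfr_in l x : Vw l (@wfr l x).
Proof. by apply: lc_sum => // i _; apply: lcZ => //; apply: wb_in. Qed.

Lemma wfr_lin l : linear (@wfr l).
Proof.
move=> a x y; rewrite /wfr scaler_sumr -big_split /=.
by apply: eq_bigr => i _; rewrite !mxE scalerDl scalerA.
Qed.

Lemma wfr_inj l x : @wfr l x = 0 -> x = 0.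
Proof.
rewrite /wfr /wb; case: (wbasis l) => e [_ _ fr] /= /(fr (x 0)) x0.
by apply/rowP => i; rewrite x0 mxE.
Qed.

Lemma wcoK l v : Vw l v -> wfr (wco l v) = v.
Proof. by rewrite /wco; case: pselect => // h _; case: (cid _) => c /= ->. Qed.

Lemma wfrK l x : wco l (@wfr l x) = x.
Proof.
apply/eqP; rewrite -subr_eq0; apply/eqP/wfr_inj.
by rewrite (linB (@wfr_lin l)) wcoK ?subrr //; apply: wfr_in.
Qed.

Lemma wco_lin l a u v : Vw l u -> Vw l v -> wco l (a *: u + v) = a *: wco l u + wco l v.
Proof. by move=> /wcoK {1}<- /wcoK {1}<-; rewrite -wfr_lin wfrK. Qed.

Lemma wco0 l : wco l 0 = 0.
Proof. by rewrite -(lin0 (@wfr_lin l)) wfrK. Qed.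

Lemma wdim_gt0 l v : Vw l v -> v != 0 -> (0 < wdim l)%N.
Proof.
move=> /wcoK <-; rewrite lt0n; apply: contra => /eqP d0; rewrite /wfr.
by rewrite big1 // => i; have := leq_trans (ltn_ord i) (eq_leq d0); rewrite ltn0.
Qed.

Lemma wdim_eq0 l v : wdim l = 0%N -> Vw l v -> v = 0.
Proof. by move=> d0 vl; apply/eqP/negPn/negP => /(wdim_gt0 vl); rewrite d0. Qed.

Definition wmaps l m (F : V -> V) := forall v, Vw l v -> Vw m (F v).

(** Coordinates are row vectors, so a composite corresponds to the product of matrices in the order
    of application. *)
Definition wmx l m (F : V -> V) : 'M[C]_(wdim l, wdim m) :=
  \matrix_i wco m (F (wfr (delta_mx 0 i))).

Lemma wmxE l m F v : linear F -> wmaps l m F -> Vw l v ->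
  F v = wfr (wco l v *m wmx l m F).
Proof.
move=> Fl Fm lv; rewrite -{1}(wcoK lv); move: (wco l v) => x {v lv}.
rewrite mulmx_sum_row (lin_sum (@wfr_lin m)) {1}(row_sum_delta x).
rewrite (lin_sum (@wfr_lin l)) (lin_sum Fl); apply: eq_bigr => i _.
rewrite (linZ (@wfr_lin m)) (linZ (@wfr_lin l)) (linZ Fl); congr (_ *: _).
by rewrite rowK wcoK //; apply: Fm; apply: wfr_in.
Qed.

Lemma wco_wmx l m F v : linear F -> wmaps l m F -> Vw l v ->
  wco m (F v) = wco l v *m wmx l m F.
Proof. by move=> Fl Fm lv; rewrite (wmxE Fl Fm lv) wfrK. Qed.

Lemma wmx_comp l m k F G : linear F -> wmaps l m F -> linear G -> wmaps m k G ->
  wmx l k (fun v => G (F v)) = wmx l m F *m wmx m k G.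
Proof.
move=> Fl Fm Gl Gm; apply/row_matrixP => i; rewrite row_mul !rowK.
by rewrite -(wco_wmx Gl Gm) //; apply: Fm; apply: wfr_in.
Qed.

Lemma eq_wmx l m F G : (forall v, Vw l v -> F v = G v) -> wmx l m F = wmx l m G.
Proof. by move=> e; apply/row_matrixP => i; rewrite !rowK e //; apply: wfr_in. Qed.

Lemma wmx_lin l m a F G : wmaps l m F -> wmaps l m G ->
  wmx l m (fun v => a *: F v + G v) = a *: wmx l m F + wmx l m G.
Proof.
move=> Fm Gm; apply/row_matrixP => i; rewrite linearP /= !rowK.
by rewrite wco_lin //; [apply: Fm|apply: Gm]; apply: wfr_in.
Qed.

Lemma wmx_id l : wmx l l id = 1%:M.
Proof. by apply/row_matrixP => i; rewrite rowK row1 wfrK. Qed.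

Lemma wmaps_iter l F q : wmaps l l F -> wmaps l l (iter q F).
Proof. by move=> Fm v lv; elim: q => //= q; apply: Fm. Qed.

Lemma wmx_iter l F q : linear F -> wmaps l l F -> wmx l l (iter q F) = wmx l l F ^+ q.
Proof.
move=> Fl Fm; elim: q => [|q IHq]; first by rewrite expr0; apply: wmx_id.
rewrite exprSr -IHq -[RHS]wmx_comp //; first exact: iter_lin.
exact: wmaps_iter.
Qed.

Definition wtr l F : C := \tr (wmx l l F).

Lemma wtr_comm l m F G : linear F -> wmaps l m F -> linear G -> wmaps m l G ->
  wtr l (fun v => G (F v)) = wtr m (fun v => F (G v)).
Proof. by move=> *; rewrite /wtr (@wmx_comp l m l) // (@wmx_comp m l m) // mxtrace_mulC. Qed.

Lemma eq_wtr l F G : (forall v, Vw l v -> F v = G v) -> wtr l F = wtr l G.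
Proof. by move=> e; rewrite /wtr (eq_wmx _ e). Qed.

Lemma wtr_lin l a F G : wmaps l l F -> wmaps l l G ->
  wtr l (fun v => a *: F v + G v) = a * wtr l F + wtr l G.
Proof. by move=> *; rewrite /wtr wmx_lin // mxtraceD mxtraceZ. Qed.

Lemma wtr_eq0 l F : (forall v, Vw l v -> v = 0) -> wtr l F = 0.
Proof.
move=> z; rewrite /wtr /mxtrace big1 // => i _.
have /wfr_inj /rowP /(_ i) : @wfr l (delta_mx 0 i) = 0 by apply: z; apply: wfr_in.
by rewrite !mxE !eqxx => /eqP; rewrite oner_eq0.
Qed.

Definition lnil l (F : V -> V) := forall v, Vw l v -> exists q, iter q F v = 0.

Lemma iter0_mono (F : V -> V) q r v : linear F -> (q <= r)%N -> iter q F v = 0 -> iter r F v = 0.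
Proof.
move=> Fl /subnK <-; rewrite iterD => ->; elim: (r - q)%N => //= k ->.
exact: lin0.
Qed.

Lemma lnil_mx l F : linear F -> wmaps l l F -> lnil l F -> exists q, wmx l l F ^+ q = 0.
Proof.
move=> Fl Fm nF; have /choice [q qP] : forall i : 'I_(wdim l), exists q,
    iter q F (wfr (delta_mx 0 i)) = 0 by move=> i; apply: nF; apply: wfr_in.
exists (\max_i q i); rewrite -wmx_iter //; apply/row_matrixP => i.
rewrite rowK row0 (iter0_mono Fl _ (qP i)) ?wco0 //.
exact: leq_bigmax.
Qed.

(** Local nilpotence becomes uniform on a weight space, with an exponent depending on its dimension
    only; all bounds on word lengths rest on this. *)
Lemma lnil_iter l F v : linear F -> wmaps l l F -> lnil l F -> Vw l v ->
  iter (wdim l) F v = 0.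
Proof.
move=> Fl Fm nF lv; have [q /nilmx_exp e] := lnil_mx Fl Fm nF.
rewrite (wmxE (iter_lin _ Fl) (wmaps_iter _ Fm) lv) wmx_iter // e mulmx0.
exact: lin0 (@wfr_lin l).
Qed.

Lemma wtr_nil l F : linear F -> wmaps l l F -> lnil l F -> wtr l F = 0.
Proof. by move=> Fl Fm nF; have [q /nilmx_trace] := lnil_mx Fl Fm nF. Qed.

Lemma wtr_scal l F c : linear F -> wmaps l l F ->
  lnil l (fun v => F v - c *: v) -> wtr l F = c * (wdim l)%:R.
Proof.
move=> Fl Fm nF; have F'l : linear (fun v => F v - c *: v).
  move=> a u v; rewrite Fl scalerDr !scalerA [c * a]mulrC -scalerA opprD scalerBr.
  by rewrite -!addrA; congr (_ + _); rewrite addrCA.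
have F'm : wmaps l l (fun v => F v - c *: v).
  by move=> v lv; apply: lcB => //; [apply: Fm|apply: lcZ].
have -> : wtr l F = wtr l (fun v => c *: id v + (F v - c *: v)).
  by apply: eq_wtr => v _; rewrite /= addrCA subrr addr0.
by rewrite wtr_lin // (wtr_nil F'l F'm nF) addr0 /wtr wmx_id mxtrace1.
Qed.

Lemma weigen l F v : linear F -> wmaps l l F -> Vw l v -> v != 0 ->
  exists c, exists2 w, Vw l w & w != 0 /\ F w = c *: w.
Proof.
move=> Fl Fm lv v0; have [c /eigenvalueP [x xc x0]] :=
  eigenvalue_closed (wmx l l F) (wdim_gt0 lv v0).
exists c, (wfr x); first exact: wfr_in.
split; first by apply: contra x0 => /eqP /wfr_inj ->.
rewrite (wmxE Fl Fm (wfr_in x)) wfrK xc; exact: linZ (@wfr_lin l) _ _.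
Qed.

Lemma weigen_finite l F : linear F -> wmaps l l F ->
  exists s : seq C, forall c v, Vw l v -> v != 0 -> F v = c *: v -> c \in s.
Proof.
move=> Fl Fm; have [s Es] := closed_field_poly_normal (char_poly (wmx l l F)).
exists s => c v lv v0 Fv; rewrite -root_prod_XsubC.
move: Es; rewrite (monicP (char_poly_monic _)) scale1r => <-.
rewrite -eigenvalue_root_char; apply/eigenvalueP; exists (wco l v).
  rewrite -wco_wmx // Fv -[c *: v]addr0 wco_lin //; last by case: (Vw_lin l).
  by rewrite wco0 addr0.
by apply: contra v0 => /eqP v0; rewrite -(wcoK lv) v0 (lin0 (@wfr_lin l)).
Qed.

Lemma prod_lnil l (Fs : seq (V -> V)) v : (wdim l <= size Fs)%N ->
  (forall j, (j < size Fs)%N -> [/\ linear (nth id Fs j), wmaps l l (nth id Fs j) &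
     lnil l (nth id Fs j)]) ->
  (forall i j u, (i < size Fs)%N -> (j < size Fs)%N -> Vw l u ->
     nth id Fs i (nth id Fs j u) = nth id Fs j (nth id Fs i u)) ->
  Vw l v -> foldr (fun F u => F u) v Fs = 0.
Proof.
move=> szF P com lv.
(* Reversed because row vectors are multiplied on the right: the operator applied first comes first
   in the product. *)
pose As := rev (map (wmx l l) Fs).
have H : forall s, (forall j, (j < size s)%N -> linear (nth id s j) /\ wmaps l l (nth id s j)) ->
    Vw l (foldr (fun F u => F u) v s) /\
    wco l (foldr (fun F u => F u) v s) = wco l v *m foldr (@mulmx _ _ _ _) 1%:M (rev (map (wmx l l) s)).
  elim=> [|F s IHs] sP; first by rewrite mulmx1.
  have [Fl Fm] := sP 0%N isT; have [|lw ew] := IHs; first by move=> j; apply: (sP j.+1).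
  split; first exact: Fm.
  rewrite /= (wco_wmx Fl Fm lw) ew rev_cons -mulmxA; congr (_ *m _).
  elim: (rev _) => [|A r IHr] /=; first by rewrite mul1mx mulmx1.
  by rewrite -mulmxA IHr.
have [|lw ew] := H Fs; first by move=> j /P [].
rewrite -(wcoK lw) ew (@prod_comm_nilmx _ _ As) ?mulmx0 ?(lin0 (@wfr_lin l)) //.
- by rewrite size_rev size_map.
- move=> A; rewrite mem_rev => /(nthP 0) [j]; rewrite size_map => jF <-.
  by rewrite (nth_map id) //; have [? ? ?] := P j jF; apply: lnil_mx.
move=> A A'; rewrite !mem_rev => /(nthP 0) [] i; rewrite size_map => iF <-.
move=> /(nthP 0) [j]; rewrite size_map => jF <-; rewrite !(nth_map id) //.
have [? ? _] := P i iF; have [? ? _] := P j jF.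
rewrite -!wmx_comp //; apply: eq_wmx => u lu; exact: com.
Qed.

(** By commutation and nilpotency a product of members of the family that does not kill [v] has
    fewer than [wdim l] factors; a longest one carries [v] to a common null vector. The family may
    be infinite. *)
Lemma common_kernel l (Fam : (V -> V) -> Prop) v :
  (forall F, Fam F -> [/\ linear F, wmaps l l F & lnil l F]) ->
  (forall F G u, Fam F -> Fam G -> Vw l u -> F (G u) = G (F u)) ->
  Vw l v -> v != 0 -> exists2 w, Vw l w & w != 0 /\ forall F, Fam F -> F w = 0.
Proof.
move=> P com lv v0.
pose ok q := `[< exists Fs : seq (V -> V), [/\ size Fs = q,
  forall j, (j < size Fs)%N -> Fam (nth id Fs j) &
  foldr (fun F u => F u) v Fs != 0] >].
have ok0 : ok 0%N by apply/asboolP; exists [::].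
have okb q : ok q -> (q <= wdim l)%N.
  move=> /asboolP [Fs [sz FamF nz]]; rewrite leqNgt; apply: contra nz => lt.
  apply/eqP; apply: (@prod_lnil l) => //; first by rewrite sz ltnW.
  - by move=> j /FamF /P.
  - by move=> i j u /FamF Fi /FamF Fj; apply: com.
have [q /asboolP [Fs [sz FamF nz]] qmax] := ex_maxnP (ex_intro _ 0%N ok0) okb.
exists (foldr (fun F u => F u) v Fs).
  elim: (Fs) FamF => //= F s IHs FamF; have [_ + _] := P F (FamF 0%N isT).
  by apply; apply: IHs => j; apply: (FamF j.+1).
split=> // F FF; apply/eqP/negPn/negP => nzF.
have /qmax : ok q.+1; last by rewrite ltnn.
apply/asboolP; exists (F :: Fs); split=> //=; first by rewrite sz.
by case=> [|j] //=; rewrite ltnS => /FamF.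
Qed.

Lemma wdep l k (us : 'I_k -> V) : (forall i, Vw l (us i)) -> (wdim l < k)%N ->
  exists2 c : 'rV[C]_k, c != 0 & \sum_i c 0 i *: us i = 0.
Proof.
move=> lus dk; pose M := \matrix_i wco l (us i).
have /rowV0Pn [c /sub_kermxP cM c0] : kermx M != 0.
  rewrite -mxrank_eq0 mxrank_ker subn_eq0 -ltnNge.
  exact: leq_ltn_trans (rank_leq_col M) dk.
exists c => //; have -> : \sum_i c 0 i *: us i = wfr (c *m M).
  rewrite mulmx_sum_row (lin_sum (@wfr_lin l)); apply: eq_bigr => i _.
  by rewrite (linZ (@wfr_lin l)) rowK wcoK.
by rewrite cM (lin0 (@wfr_lin l)).
Qed.

(** Intersecting with the kernel of [F j] costs at most [wdim (m j)] dimensions. *)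
Lemma wdim_joint_inj l (J : Type) (js : seq J) (m : J -> I) (F : J -> V -> V) :
  (forall j, linear (F j)) -> (forall j, wmaps l (m j) (F j)) ->
  (forall v, Vw l v -> foldr (fun j P => F j v = 0 /\ P) True js -> v = 0) ->
  (wdim l <= \sum_(j <- js) wdim (m j))%N.
Proof.
move=> Fl Fm inj.
have [K rK KP] : exists2 K : 'M[C]_(wdim l),
    (wdim l - \sum_(j <- js) wdim (m j) <= \rank K)%N &
    forall x : 'rV_(wdim l), (x <= K)%MS -> foldr (fun j P => F j (wfr x) = 0 /\ P) True js.
  elim: js {inj} => [|j js [K rK KP]].
    by exists 1%:M => //; rewrite mxrank1 big_nil subn0.
  exists (K :&: kermx (wmx l (m j) (F j)))%MS.
    have := mxrank_mul_ker K (wmx l (m j) (F j)) => e.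
    rewrite big_cons addnC subnDA leq_subLR (leq_trans rK) // -e leq_add2r.
    exact: rank_leq_col.
  move=> x; rewrite sub_capmx => /andP [xK /sub_kermxP xF] /=; split; last exact: KP.
  by rewrite (wmxE (Fl j) (@Fm j) (wfr_in x)) wfrK xF (lin0 (@wfr_lin _)).
rewrite leqNgt -subn_gt0; apply/negP => /leq_trans /(_ rK); rewrite lt0n mxrank_eq0.
move=> /rowV0Pn [x xK /eqP []]; apply: wfr_inj; apply: inj; first exact: wfr_in.
exact: KP.
Qed.

Lemma wsum_split (K : Type) (r : seq K) (f : K -> I) (x : K -> V) l :
  (forall k, Vw (f k) (x k)) -> \sum_(k <- r) x k = 0 -> \sum_(k <- r | f k == l) x k = 0.
Proof.
move=> fx s0; have [lr|lr] := boolP (l \in undup (map f r)); last first.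
  rewrite big_hasC //; apply: contra lr; rewrite mem_undup.
  by elim: r {s0} => //= k r IHr /orP [/eqP <-|/IHr lr]; rewrite inE ?eqxx // lr orbT.
have w_in m : Vw m (\sum_(k <- r | f k == m) x k).
  by apply: lc_sum => // k /eqP <-.
apply: (proj2 Vw_sum _ (fun m => \sum_(k <- r | f k == m) x k) (undup_uniq (map f r))) => //.
rewrite (exchange_big_dep xpredT) //= -[RHS]s0.
have sub : {subset map f r <= undup (map f r)} by move=> z; rewrite mem_undup.
have : uniq (undup (map f r)) by exact: undup_uniq.
move: (undup _) sub => U sub Uu.
elim: r {s0 lr w_in} sub => [|k r IHr] sub; first by rewrite !big_nil.
rewrite !big_cons IHr; last by move=> z zr; apply: sub; rewrite inE zr orbT.
congr (_ + _); have kU : f k \in U by apply: sub; rewrite inE eqxx.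
rewrite big_mkcond /= (bigD1_seq (f k)) //= eqxx big1 ?addr0 // => z zk.
by rewrite eq_sym (negPf zk).
Qed.

Lemma wsum_proj (K : Type) (r : seq K) (f : K -> I) (x : K -> V) l v :
  (forall k, Vw (f k) (x k)) -> Vw l v -> v = \sum_(k <- r) x k ->
  v = \sum_(k <- r | f k == l) x k.
Proof.
(* [None] indexes an extra term [- v], which turns the equation into a vanishing sum. *)
move=> fx lv ev; pose g o := if o is Some k then f k else l.
pose y o := if o is Some k then x k else - v.
have gy o : Vw (g o) (y o) by case: o => [k|] /=; [exact: fx|apply: lcN].
have := @wsum_split _ (None :: map Some r) g y l gy.
rewrite !big_cons !big_map /= eqxx {1}ev addNr => /(_ erefl) /eqP.
by rewrite addrC subr_eq0 => /eqP.
Qed.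

Lemma wspan v : exists (s : seq I) (w : I -> V), (forall i, Vw i (w i)) /\ v = \sum_(i <- s) w i.
Proof. exact: (proj1 Vw_sum). Qed.

Lemma wind (P : V -> Prop) : lin_closed P -> (forall l v, Vw l v -> P v) -> forall v, P v.
Proof.
move=> Pl Pw v; have [s [w [ws ->]]] := wspan v; apply: lc_sum => // i _; exact: Pw.
Qed.

End WeightSpaces.

(** * One-endedness of the lattice of degrees *)

Section Degrees.
Variable nu : nat.
Implicit Types m s t : degree nu.

Definition nrm m : nat := \sum_i `|m i|%N.

Arguments nrm m%_R.

Lemma nrm0 : nrm 0 = 0%N.
Proof. by rewrite /nrm big1 // => i _; rewrite ffunE. Qed.

Lemma nrmN m : nrm (- m) = nrm m.
Proof. by apply: eq_bigr => i _; rewrite ffunE abszN. Qed.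

Lemma nrmD m s : (nrm (m + s) <= nrm m + nrm s)%N.
Proof. by rewrite -big_split leq_sum //= => i _; rewrite ffunE; move: (m i) (s i) => x y; lia. Qed.

Lemma nrmMn m k : nrm (m *+ k) = (k * nrm m)%N.
Proof.
rewrite /nrm big_distrr /=; apply: eq_bigr => i _.
by rewrite ffunMnE -mulr_natr abszM natz mulnC.
Qed.

Lemma nrm_le m i : (`|m i| <= nrm m)%N.
Proof. by rewrite /nrm (bigD1 i) //= leq_addr. Qed.

Lemma nrm_eq0 m : (nrm m == 0%N) = (m == 0).
Proof.
apply/eqP/eqP => [m0|->]; last exact: nrm0.
apply/ffunP => i; rewrite ffunE; apply/eqP; rewrite -absz_eq0 -leqn0 -m0.
exact: nrm_le.
Qed.

Lemma nrm_bound m K : (forall i, `|m i| <= K)%N -> (nrm m <= nu.+1 * K)%N.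
Proof.
move=> mK; rewrite -[X in (X * _)%N]card_ord -sum_nat_const.
by apply: leq_sum => i _; apply: mK.
Qed.

Definition unitd (i : 'I_nu.+1) : degree nu := [ffun j => ((j == i) : nat)%:Z].

Lemma nrm_unitd i : nrm (unitd i) = 1%N.
Proof.
rewrite /nrm (bigD1 i) //= big1 => [|j ji]; rewrite ffunE ?eqxx //.
by rewrite (negPf ji).
Qed.

Definition steps : seq (degree nu) :=
  0 :: map unitd (enum 'I_nu.+1) ++ map (fun i => - unitd i) (enum 'I_nu.+1).

Lemma nrm_steps s : s \in steps -> (nrm s <= 1)%N.
Proof.
rewrite inE mem_cat => /orP [/eqP ->|]; first by rewrite nrm0.
by case/orP => /mapP [i _ ->]; rewrite ?nrmN nrm_unitd.
Qed.

Lemma step_down s : s != 0 -> exists2 u, u \in steps & nrm s = (nrm (s - u)).+1.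
Proof.
move=> s0; have [i si] : exists i, s i != 0.
  apply/existsP; apply: contraNT s0; rewrite negb_exists => /forallP s0.
  by apply/eqP/ffunP => i; rewrite ffunE; apply/eqP; have := s0 i; rewrite negbK.
have H (u : degree nu) : (forall j, j != i -> u j = 0) -> `|s i|%N = `|(s i - u i)%R|.+1 ->
    nrm s = (nrm (s - u)).+1.
  move=> u0 ui; rewrite /nrm (bigD1 i) //= [in RHS](bigD1 i) //= !ffunE ui addSn.
  by congr (_ + _).+1; apply: eq_bigr => j ji; rewrite !ffunE u0 // subr0.
have [sp|sn] : s i > 0 \/ s i < 0 by lia.
  exists (unitd i); first by rewrite inE mem_cat map_f ?orbT // mem_enum.
  by apply: H => [j ji|]; rewrite ffunE ?(negPf ji) ?eqxx //; lia.
exists (- unitd i).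
  by rewrite inE mem_cat (map_f (fun i => - unitd i)) ?orbT // mem_enum.
by apply: H => [j ji|]; rewrite !ffunE ?(negPf ji) ?eqxx //; lia.
Qed.

Lemma step_split s r : (nrm s <= r.+1)%N -> exists2 u, u \in steps & (nrm (s - u) <= r)%N.
Proof.
move=> sr; have [->|/step_down [u us e]] := eqVneq s 0.
  by exists 0; rewrite ?inE ?eqxx // subr0 nrm0.
by exists u => //; rewrite -ltnS -e.
Qed.

Fixpoint ball r : seq (degree nu) :=
  if r is r'.+1 then allpairs (fun s u => s + u) (ball r') steps else [:: 0].

Lemma mem_ball r s : (nrm s <= r)%N -> s \in ball r.
Proof.
elim: r s => [|r IHr] s; first by rewrite leqn0 nrm_eq0 inE.
move=> /step_split [u us /IHr su]; apply/allpairsP; exists (s - u, u).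
by split=> //=; rewrite subrK.
Qed.

Section OneEnded.
Hypothesis nu1 : (1 <= nu)%N.

Let i0 : 'I_nu.+1 := ord0.
Let i1 : 'I_nu.+1 := ord_max.
Let i10 : (i1 == i0) = false.
Proof. by apply/negP => /eqP /(congr1 val) /= e; move: nu1; rewrite e. Qed.

Let pt (x y : int) : degree nu := [ffun j => if j == i0 then x else if j == i1 then y else 0].

Let ptD x y x' y' : pt x y + pt x' y' = pt (x + x') (y + y').
Proof. by apply/ffunP => j; rewrite !ffunE; do 2?case: ifP => _. Qed.

Let ptN x y : - pt x y = pt (- x) (- y).
Proof. by apply/ffunP => j; rewrite !ffunE; do 2?case: ifP => _; rewrite ?oppr0. Qed.

Let nrm_pt x y : nrm (pt x y) = (`|x| + `|y|)%N.
Proof.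
rewrite /nrm (bigD1 i0) //= (bigD1 i1) ?i10 //= !ffunE eqxx i10 eqxx.
by rewrite big1 ?addn0 // => j /andP [/negPf j0 /negPf j1]; rewrite ffunE j0 j1.
Qed.

(* Up to finite sets P and Q agree and are stable under all translations, while
   the complement of a ball in a lattice of rank at least 2 is connected. *)
Lemma one_ended (P Q : degree nu -> Prop) :
  (forall m, m != 0 -> P m \/ P (- m)) ->
  (forall m, m != 0 -> Q m \/ Q (- m)) ->
  (forall s, exists K, forall m, P m -> Q (s - m) -> (nrm m <= K)%N) -> False.
Proof.
move=> covP covQ fin.
(* The zero translation yields that P is contained in Q far out. If [P m] holds but not [Q (m + t)],
   then [Q (- (m + t))] holds by covering, and finiteness for [s = - t] bounds m. *)
pose T := [:: pt 0 0; pt 1 0; pt (-1) 0; pt 0 1; pt 0 (-1)].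
have [R RP] : exists R, forall t m, t \in T -> (R < nrm m)%N -> (P m -> Q (m + t)) /\ (Q m -> P (m + t)).
  elim: T => [|t T [R RP]]; first by exists 0%N.
  have [K KP] := fin (- t); exists (maxn R K + nrm t).+1 => u m.
  rewrite inE => /orP [/eqP ->|uT] mR; last by apply: RP => //; lia.
  have mt : m + t != 0.
    apply/eqP => mt; have : m = - t by apply/eqP; rewrite -addr_eq0 mt.
    by move=> e; move: mR; rewrite e nrmN; lia.
  have e : - t - m = - (m + t) by rewrite opprD addrC.
  split=> [Pm|Qm].
    have [//|Qn] := covQ _ mt; have := KP m Pm; rewrite e => /(_ Qn); lia.
  have [//|Pn] := covP _ mt; have := KP _ Pn; rewrite opprK addrCA addNr addr0.
  move=> /(_ Qm); rewrite nrmN; have := nrmD (m + t) (- t).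
  rewrite nrmN addrK; lia.
have PQ m : (R < nrm m)%N -> P m -> Q m.
  move=> mR; have [+ _] := RP (pt 0 0) m (mem_head _ _) mR.
  by rewrite (_ : pt 0 0 = 0) ?addr0 //; apply/ffunP => j; rewrite !ffunE; do 2?case: ifP.
have step t m : t \in T -> (R < nrm m)%N -> P m -> P (m + t).
  by move=> tT mR Pm; apply: (RP t m tT mR).2; apply: PQ.
have nT : [/\ pt 1 0 \in T, pt (-1) 0 \in T, pt 0 1 \in T & pt 0 (-1) \in T].
  by rewrite !inE !eqxx ?orbT.
have [T1 T2 T3 T4] := nT.
have hor x y x' : (R < `|y|)%N -> P (pt x y) -> P (pt x' y).
  move=> yR Pxy.
  have rr (n : nat) : P (pt (x + n%:Z) y) /\ P (pt (x - n%:Z) y).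
    elim: n => [|n [IH1 IH2]]; first by rewrite !addr0.
    split.
      have := step _ _ T1 _ IH1; rewrite ptD nrm_pt addr0 -addrA => H.
      rewrite (_ : n.+1%:Z = n%:Z + 1); last by lia.
      by apply: H; lia.
    have := step _ _ T2 _ IH2; rewrite ptD nrm_pt addr0 => H.
    rewrite (_ : x - n.+1%:Z = x - n%:Z + -1); last by lia.
    by apply: H; lia.
  have [e|e] : x' = x + `|(x' - x)%R|%N%:Z \/ x' = x - `|(x' - x)%R|%N%:Z by lia.
    by rewrite e; case: (rr `|(x' - x)%R|%N).
  by rewrite e; case: (rr `|(x' - x)%R|%N).
have ver x y y' : (R < `|x|)%N -> P (pt x y) -> P (pt x y').
  move=> xR Pxy.
  have rr (n : nat) : P (pt x (y + n%:Z)) /\ P (pt x (y - n%:Z)).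
    elim: n => [|n [IH1 IH2]]; first by rewrite !addr0.
    split.
      have := step _ _ T3 _ IH1; rewrite ptD nrm_pt addr0 -addrA => H.
      rewrite (_ : n.+1%:Z = n%:Z + 1); last by lia.
      by apply: H; lia.
    have := step _ _ T4 _ IH2; rewrite ptD nrm_pt addr0 => H.
    rewrite (_ : y - n.+1%:Z = y - n%:Z + -1); last by lia.
    by apply: H; lia.
  have [e|e] : y' = y + `|(y' - y)%R|%N%:Z \/ y' = y - `|(y' - y)%R|%N%:Z by lia.
    by rewrite e; case: (rr `|(y' - y)%R|%N).
  by rewrite e; case: (rr `|(y' - y)%R|%N).
have [K KP] := fin 0; pose X := (maxn R K).+1%:Z.
have XR : (R < `|X|)%N by rewrite /X; lia.
have nX : (R < `|- X|)%N by lia.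
(* From one end of the axis to the other along three sides of a rectangle that avoids the ball. *)
have around x x' : (R < `|x|)%N -> P (pt x 0) -> (R < `|x'|)%N -> P (pt x' 0).
  by move=> xR Px x'R; apply: (ver x' X 0 x'R); apply: (hor x X x' XR); apply: (ver x 0 X xR).
have X0 : pt X 0 != 0 by rewrite -nrm_eq0 nrm_pt /X; lia.
have [P1 P2] : P (pt X 0) /\ P (pt (- X) 0).
  have [Px|] := covP _ X0; first by split=> //; apply: (around X _ XR Px nX).
  by rewrite ptN oppr0 => Px; split=> //; apply: (around _ X nX Px XR).
have : Q (0 - pt X 0).
  by rewrite sub0r ptN oppr0; apply: PQ => //; rewrite nrm_pt addn0.
by move=> /(KP _ P1); rewrite nrm_pt /X; lia.
Qed.

End OneEnded.

End Degrees.
Arguments nrm {nu} m%_R.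

(** * Modules graded by degrees and weights *)

(* What the argument uses of V: [T] stands for tau, [gm_hl a m z] says that z is
   homogeneous of degree m and of weight a for the Cartan subalgebra of g, the
   finitely many families [gm_u i m] span T, and [gm_d i] is the derivation d_i.
   The last field is the finiteness of root strings, also in imaginary
   directions. *)
Record graded_module (C : numClosedFieldType) (nu : nat) (T V : lmodType C)
    (B : comAlgType C) (Wt : zmodType) := GradedModule {
  gm_br : T -> T -> T;
  gm_act : T -> B -> V -> V;
  gm_V : Wt -> V -> Prop;
  gm_ev : 'I_nu.+1 -> Wt -> C;
  gm_dl : degree nu -> Wt;
  gm_hl : Wt -> degree nu -> T -> Prop;
  gm_rk : nat;
  gm_u : 'I_gm_rk -> degree nu -> T;
  gm_al : 'I_gm_rk -> Wt;
  gm_d : 'I_nu.+1 -> T;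
  gm_actT : forall b v, linear (fun z => gm_act z b v);
  gm_actB : forall z v, linear (fun b => gm_act z b v);
  gm_actV : forall z b, linear (gm_act z b);
  gm_act_br : forall x y b c v, gm_act (gm_br x y) (b * c) v =
    gm_act x b (gm_act y c v) - gm_act y c (gm_act x b v);
  gm_irr : forall W : V -> Prop, lin_closed W ->
    (forall z b v, W v -> W (gm_act z b v)) -> (exists2 v, W v & v != 0) ->
    forall v, W v;
  gm_V_lin : forall l, lin_closed (gm_V l);
  gm_V_fin : forall l, is_fin_dim_subspace (gm_V l);
  gm_V_sum : is_direct_sum gm_V;
  gm_evD : forall i l l', gm_ev i (l + l') = gm_ev i l + gm_ev i l';
  gm_dlD : forall m n, gm_dl (m + n) = gm_dl m + gm_dl n;
  gm_ev_dl : forall i m, gm_ev i (gm_dl m) = (m i)%:~R;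
  gm_hl_lin : forall a m, lin_closed (gm_hl a m);
  gm_hl_br : forall a m x a' m' y, gm_hl a m x -> gm_hl a' m' y ->
    gm_hl (a + a') (m + m') (gm_br x y);
  gm_hl_V : forall a m z b l v, gm_hl a m z -> gm_V l v ->
    gm_V (l + (a + gm_dl m)) (gm_act z b v);
  gm_hl_deg : forall a m z, gm_hl a m z ->
    exists c : 'I_gm_rk -> C, z = \sum_k c k *: gm_u k m;
  gm_hl_u : forall i m, gm_hl (gm_al i) m (gm_u i m);
  gm_al0 : exists i, gm_al i = 0;
  gm_u_span : forall S : T -> Prop, lin_closed S ->
    (forall i m, S (gm_u i m)) -> forall z, S z;
  gm_br_span : forall (S : T -> Prop) m n, lin_closed S -> m != n -> n != 0 ->
    (forall i j, S (gm_br (gm_u i m) (gm_u j n))) -> forall k, S (gm_u k (m + n));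
  gm_hl_d : forall i, gm_hl 0 0 (gm_d i);
  gm_d_V : forall i l v, gm_V l v -> gm_act (gm_d i) 1 v = gm_ev i l *: v;
  gm_d_br : forall i a m z b v, gm_hl a m z ->
    gm_act (gm_br (gm_d i) z) b v = (m i)%:~R *: gm_act z b v;
  gm_hl0_comm : forall x y b c v, gm_hl 0 0 x -> gm_hl 0 0 y ->
    gm_act x b (gm_act y c v) = gm_act y c (gm_act x b v);
  gm_string : forall a m z, gm_hl a m z -> a != 0 ->
    (forall b v, gm_act z b v = 0) \/
    (forall l, exists k0, forall k v, (k0 <= k)%N ->
       gm_V (l + (a + gm_dl m) *+ k) v -> v = 0)
}.

Lemma eventually_all (K : eqType) (s : seq K) (P : K -> nat -> Prop) :
  (forall x, x \in s -> exists k0, forall k, (k0 <= k)%N -> P x k) ->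
  exists k0, forall k, (k0 <= k)%N -> forall x, x \in s -> P x k.
Proof.
elim: s => [|x s IHs] sP; first by exists 0%N.
have [k1 k1P] := sP x (mem_head _ _).
have [|k2 k2P] := IHs; first by move=> y ys; apply: sP; rewrite inE ys orbT.
exists (maxn k1 k2) => k; rewrite geq_max => /andP [kk1 kk2] y.
by rewrite inE => /orP [/eqP ->|ys]; [apply: k1P|apply: k2P].
Qed.

Section GradedModule.
Variables (C : numClosedFieldType) (nu : nat) (T V : lmodType C).
Variables (B : comAlgType C) (Wt : zmodType).
Variable S : graded_module nu T V B Wt.

Local Notation br := (gm_br S).
Local Notation act := (gm_act S).
Local Notation Vw := (gm_V S).
Local Notation dl := (gm_dl S).
Local Notation hl := (gm_hl S).
Local Notation u := (@gm_u _ _ _ _ _ _ S).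
Local Notation al := (@gm_al _ _ _ _ _ _ S).
Local Notation d := (gm_d S).
Local Notation rk := (gm_rk S).
Local Notation wdim := (wdim (gm_V_fin S)).

Lemma act0b b v : act 0 b v = 0. Proof. exact: lin0 (gm_actT S b v). Qed.
Lemma actz0 z v : act z 0 v = 0. Proof. exact: lin0 (gm_actB S z v). Qed.
Lemma act_v0 z b : act z b 0 = 0. Proof. exact: lin0 (gm_actV S z b). Qed.

Lemma act_swap x y b c v :
  act x b (act y c v) = act y c (act x b v) + act (br x y) (b * c) v.
Proof. by rewrite gm_act_br addrC subrK. Qed.

Lemma act_d_swap i a m z b c v : hl a m z ->
  act (d i) b (act z c v) = act z c (act (d i) b v) + (m i)%:~R *: act z (b * c) v.
Proof. by move=> hz; rewrite act_swap (gm_d_br i _ _ hz). Qed.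

Lemma dl0 : dl 0 = 0.
Proof. by apply: (addrI (dl 0)); rewrite -gm_dlD !addr0. Qed.

Lemma dlN m : dl (- m) = - dl m.
Proof. by apply/eqP; rewrite -addr_eq0 -gm_dlD addNr dl0. Qed.

Lemma T_ind (P : T -> Prop) : lin_closed P -> (forall i m, P (u i m)) -> forall z, P z.
Proof. exact: gm_u_span. Qed.

Lemma hl_span (P : T -> Prop) a m z : lin_closed P -> hl a m z ->
  (forall k, P (u k m)) -> P z.
Proof. by move=> Pl /gm_hl_deg [c ->] Pu; apply: lc_sum => // k _; apply: lcZ. Qed.

Lemma act_lc b v : lin_closed (fun z => act z b v = 0).
Proof. by split=> [|a x y ex ey]; rewrite ?act0b // gm_actT ex ey scaler0 addr0. Qed.

(** The set M of the overview; the factor c makes closure under multiplication immediate. *)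
Definition ann (b : B) : Prop := forall z c v, act z (b * c) v = 0.

Lemma ann_act b z v : ann b -> act z b v = 0.
Proof. by move=> /(_ z 1 v); rewrite mulr1. Qed.

Lemma ann_mul b c : ann b -> ann (b * c).
Proof. by move=> Mb z c' v; rewrite -mulrA. Qed.

Lemma ann_lin : lin_closed ann.
Proof.
split=> [z c v|a b b' Mb Mb' z c v]; first by rewrite mul0r actz0.
by rewrite mulrDl -scalerAl gm_actB Mb Mb' scaler0 addr0.
Qed.

Lemma ann_hom (b : B) : (forall i m c v, act (u i m) (b * c) v = 0) -> ann b.
Proof.
move=> bu z c v; apply: (T_ind (P := fun z => act z (b * c) v = 0)) => //.
exact: act_lc.
Qed.

Definition kill v m b := forall i, act (u i m) b v = 0.

Lemma kill_deg v m b a z : kill v m b -> hl a m z -> act z b v = 0.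
Proof. by move=> vk hz; apply: (hl_span (act_lc b v) hz). Qed.

Lemma kill_add v m n b c : m != n -> n != 0 -> kill v m b -> kill v n c ->
  kill v (m + n) (b * c).
Proof.
move=> mn n0 km kn; apply: (gm_br_span (act_lc (b * c) v)) => // i j.
by rewrite gm_act_br kn km !act_v0 subr0.
Qed.

Lemma kill_modulo v m b c : ann (b - c) -> kill v m b -> kill v m c.
Proof.
move=> Mbc kb i; have := ann_act (u i m) v Mbc.
by rewrite (linB (gm_actB S _ _)) kb sub0r => /eqP; rewrite oppr_eq0 => /eqP.
Qed.

Lemma kill_lin v m : lin_closed (kill v m).
Proof.
split=> [i|a b c kb kc i]; first exact: actz0.
by rewrite gm_actB kb kc scaler0 addr0.
Qed.

Definition idem e := ann (e * e - e).

Lemma kill_idem v m e b : idem e -> kill v m (e * (e * b)) -> kill v m (e * b).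
Proof. by move=> /(ann_mul b) h; apply: kill_modulo; rewrite mulrA -mulrBl. Qed.

(** Degrees far out in the direction g kill any given vector, as positive degrees do in a highest
    weight module. The sets P and Q of the overview are the negations for e and 1 - e. *)
Definition pos e g := forall v s b, exists k0, forall k, (k0 <= k)%N ->
  kill v (g *+ k + s) (e * b).

(** The vectors with this vanishing form a submodule: commuting past an element of degree t only
    replaces s by s + t and b by a multiple. *)
Lemma pos_irr e g v : v != 0 ->
  (forall s b, exists k0, forall k, (k0 <= k)%N -> kill v (g *+ k + s) (e * b)) ->
  pos e g.
Proof.
move=> v0 vP; apply: (@gm_irr _ _ _ _ _ _ S (fun v => forall s b, exists k0, forall k,
  (k0 <= k)%N -> kill v (g *+ k + s) (e * b))); last by exists v.
  split=> [s b|a x y Px Py s b]; first by exists 0%N => k _ i; apply: act_v0.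
  have [k1 P1] := Px s b; have [k2 P2] := Py s b; exists (maxn k1 k2) => k.
  rewrite geq_max => /andP [kk1 kk2] i.
  by rewrite gm_actV P1 // P2 // scaler0 addr0.
move=> z c x Px; move: z; apply: T_ind.
  split=> [s b|a y y' Py Py' s b]; first by exists 0%N => k _ i; rewrite act0b act_v0.
  have [k1 P1] := Py s b; have [k2 P2] := Py' s b; exists (maxn k1 k2) => k.
  rewrite geq_max => /andP [kk1 kk2] i.
  by rewrite gm_actT gm_actV P1 // P2 // scaler0 addr0.
move=> j t s b; have [k1 P1] := Px s b; have [k2 P2] := Px (s + t) (b * c).
exists (maxn k1 k2) => k; rewrite geq_max => /andP [kk1 kk2] i.
rewrite act_swap P1 // act_v0 add0r -mulrA.
apply: (kill_deg _ (gm_hl_br (gm_hl_u i (g *+ k + s)) (gm_hl_u j t))).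
by rewrite -addrA; apply: P2.
Qed.

Section Generators.
Variable gs : seq B.
Hypothesis gsP : forall P : {pred B}, subalg_closed P -> {subset gs <= P} -> P =i predT.

Let e0 : degree nu := unitd ord0.

(** A finite test set for [pos]: degrees next to g with coefficient 1 generate by brackets all
    degrees around the multiples of g, and degree g with the generators of B gives access to every
    coefficient. *)
Definition box : seq (degree nu * B) :=
  [seq (s, 1) | s <- steps nu] ++ [seq (s + e0, 1) | s <- steps nu] ++ [seq (0, b) | b <- gs].

Let nrm1_steps (s : degree nu) : (nrm s <= 1)%N -> s \in steps nu.
Proof.
move=> s1; have [->|/step_down [w ws e]] := eqVneq s 0; first by rewrite inE eqxx.
have : nrm (s - w) == 0%N by rewrite -leqn0 -ltnS -e.
by rewrite nrm_eq0 subr_eq0 => /eqP ->.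
Qed.

Let nrm_neq (m n : degree nu) : (nrm n < nrm m)%N -> m != n.
Proof. by apply: contraTN => /eqP ->; rewrite ltnn. Qed.

Let Nunit_steps : - e0 \in steps nu.
Proof. by apply: nrm1_steps; rewrite nrmN nrm_unitd. Qed.

(** Brackets of the tested elements kill [v] in the degrees [g *+ k + s] with s in a ball growing
    with k ([k_e]). Using this, the coefficients that are eventually killed form a subalgebra
    containing the generators. The bound on [nrm g] keeps the two degrees of each bracket distinct
    and nonzero. *)
Lemma box_pos e g v : idem e -> (3 <= nrm g)%N -> v != 0 ->
  (forall p, p \in box -> kill v (g + p.1) (e * p.2)) -> pos e g.
Proof.
move=> ide g3 v0 vbox; apply: (pos_irr v0).
have g0 : g != 0 by rewrite -nrm_eq0; lia.
have k_step s : s \in steps nu -> kill v (g + s) e.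
  move=> ss; rewrite -[e]mulr1; apply: (vbox (s, 1)).
  by rewrite mem_cat (map_f (fun s => (s, 1))).
have k_step' s : s \in steps nu -> kill v (g + (s + e0)) e.
  move=> ss; rewrite -[e]mulr1; apply: (vbox (s + e0, 1)).
  by rewrite !mem_cat (map_f (fun s => (s + e0, 1))) ?orbT.
have k_gs b : b \in gs -> kill v g (e * b).
  move=> bg; rewrite -[g]addr0; apply: (vbox (0, b)).
  by rewrite !mem_cat (map_f (fun b => (0, b))) ?orbT.
have k_e j s : (nrm s < j.+2)%N -> kill v (g *+ j.+2 + s) e.
  elim: j s => [|j IHj] s sj.
    have ss : s \in steps nu by apply: nrm1_steps.
    (* For s = 0 the naive splitting has two equal degrees, whose brackets need not span; shifting
       one by [e0] and the other by [- e0] separates them. *)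
    have -> : g *+ 2 + s = (g + (s + e0)) + (g - e0).
      by rewrite addrACA -mulr2n addrK.
    rewrite -[e]mulr1; apply: kill_idem => //; rewrite mulr1; apply: kill_add.
    - rewrite (inj_eq (addrI g)) -subr_eq0 opprK -addrA -mulr2n.
      apply/eqP => /eqP; rewrite addr_eq0 => /eqP es.
      by move: sj; rewrite es nrmN nrmMn nrm_unitd.
    - rewrite subr_eq0; apply: nrm_neq; rewrite nrm_unitd; lia.
    - exact: k_step'.
    - exact: k_step.
  have [w ws sw] := step_split sj.
  have -> : g *+ j.+3 + s = (g *+ j.+2 + (s - w)) + (g + w).
    by rewrite addrACA -mulrSr subrK.
  have w1 := nrm_steps ws.
  rewrite -[e]mulr1; apply: kill_idem => //; rewrite mulr1; apply: kill_add.
  - rewrite -subr_eq0 opprD addrACA [g *+ j.+2]mulrSr addrK.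
    apply/eqP => /eqP; rewrite addr_eq0 => /eqP eg.
    have := congr1 (@nrm nu) eg; rewrite nrmMn nrmN.
    have := nrmD (s - w) (- w); rewrite nrmN => h1 h2.
    have h3 : (j.+1 * 3 <= j.+1 * nrm g)%N by rewrite leq_mul2l g3 orbT.
    by have := leq_trans (leq_trans h3 (eq_leq h2)) (leq_trans h1 (leq_add sw w1)); lia.
  - apply: contraTneq g3 => /eqP; rewrite addr_eq0 => /eqP ->.
    by rewrite nrmN -leqNgt; lia.
  - by apply: IHj.
  - exact: k_step.
pose A b := forall s, exists k0, forall k, (k0 <= k)%N -> kill v (g *+ k + s) (e * b).
suff HA : forall b, A b by move=> s b; apply: HA.
have cA : subalg_closed (fun b => `[< A b >]).
  split.
  - by apply/asboolP => s; exists (nrm s).+2 => -[|[|k]] // ks; rewrite mulr1; apply: k_e; lia.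
  - move=> a x y /asboolP Ax /asboolP Ay; apply/asboolP => s.
    have [k1 P1] := Ax s; have [k2 P2] := Ay s; exists (maxn k1 k2) => k.
    rewrite geq_max => /andP [kk1 kk2].
    by rewrite mulrDr -scalerAr; apply: (proj2 (kill_lin _ _)); [apply: P1|apply: P2].
  - move=> x y /asboolP Ax /asboolP Ay; apply/asboolP => s.
    have [k1 P1] := Ax s; have [k2 P2] := Ay 0; pose n := k2.+1.
    exists (k1 + n + n + (nrm s).+1)%N => k kk.
    have -> : g *+ k + s = (g *+ (k - n) + s) + (g *+ n + 0).
      by rewrite addrACA -mulrnDr subnK ?addr0 //; lia.
    apply: kill_idem => //; rewrite (_ : e * (e * (x * y)) = (e * x) * (e * y)); last first.
      by rewrite mulrACA mulrA.
    apply: kill_add; [| |apply: P1; lia|apply: P2; rewrite /n; lia].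
      rewrite addr0 -subr_eq0 addrAC -mulrnBr; last lia.
      apply/eqP => /eqP; rewrite addr_eq0 => /eqP eg.
      have := congr1 (@nrm nu) eg; rewrite nrmMn nrmN => h2.
      have : ((k - n - n) * 1 <= (k - n - n) * nrm g)%N by rewrite leq_mul2l; lia.
      by rewrite h2; lia.
    by rewrite addr0 -nrm_eq0 nrmMn; lia.
move=> b; have /asboolP // : b \in (fun b => `[< A b >] : bool).
rewrite (gsP cA) // => {}b bg; apply/asboolP => s; exists (nrm s + 4)%N => k kk.
have -> : g *+ k + s = (g *+ (k.-2).+1 + s) + g.
  by rewrite addrAC -mulrSr; congr (g *+ _ + _); lia.
apply: kill_idem => //; apply: kill_add => //; last exact: k_gs.
  rewrite -subr_eq0 mulrSr addrAC addrK.
  apply/eqP => /eqP; rewrite addr_eq0 => /eqP eg.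
  have := congr1 (@nrm nu) eg; rewrite nrmMn nrmN => h2.
  have : (k.-2 * 1 <= k.-2 * nrm g)%N by rewrite leq_mul2l; lia.
  by rewrite h2; lia.
by have := k_e k.-2.-1 s; rewrite (_ : k.-2.-1.+2 = k.-2.+1); [apply; lia|lia].
Qed.

Lemma not_pos_box e g v : idem e -> (3 <= nrm g)%N -> v != 0 -> ~ pos e g ->
  exists2 p, p \in box & exists i, act (u i (g + p.1)) (e * p.2) v != 0.
Proof.
move=> ide g3 v0 np; apply: contrapT => H; apply: np; apply: (box_pos ide g3 v0).
move=> p pb i; apply/eqP/negPn/negP => nz; apply: H; exists p => //; by exists i.
Qed.

(** For large k the degrees [g *+ k + s] and [(- g) *+ k] kill v, hence so does their sum s, for
    every s and v; this would put e in M. *)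
Lemma pos_anti e g : idem e -> ~ ann e -> g != 0 -> pos e g -> ~ pos e (- g).
Proof.
move=> ide Me g0 pg pNg; apply: Me; apply: ann_hom => i s c v.
rewrite -[e]mulr1 -mulrA mul1r.
have [k1 P1] := pg v s c; have [k2 P2] := pNg v 0 1.
have n1 : (0 < nrm g)%N by rewrite lt0n nrm_eq0.
pose k := (k1 + k2 + (nrm s).+1)%N.
suff : kill v ((g *+ k + s) + ((- g) *+ k + 0)) ((e * c) * (e * 1)).
  rewrite addr0 addrAC mulNrn subrr add0r mulr1 mulrAC -mulrA => h.
  by rewrite -[s]add0r in h *; apply: (kill_idem ide).
apply: kill_add; [| |apply: P1; lia|apply: P2; lia].
  rewrite addr0 -subr_eq0 mulNrn opprK addrAC -mulrnDr.
  apply/eqP => /eqP; rewrite addr_eq0 => /eqP eg.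
  have := congr1 (@nrm nu) eg; rewrite nrmMn nrmN => h2.
  have : ((k + k) * 1 <= (k + k) * nrm g)%N by rewrite leq_mul2l; lia.
  by rewrite h2; lia.
by rewrite addr0 mulNrn oppr_eq0 -nrm_eq0 nrmMn; lia.
Qed.

Definition box_dim (l : Wt) : nat := (\sum_(q <- allpairs pair box (enum 'I_rk))
  wdim (l + dl q.1.1 + al q.2)%R)%N.

(* Outside [pos 1] the letters of the box, shifted by g, have no common kernel in
   [V_l], which bounds its dimension by those of weight spaces far away. *)
Lemma wdim_not_pos g l : (3 <= nrm g)%N -> ~ pos 1 g -> (wdim l <= box_dim (l + dl g)%R)%N.
Proof.
move=> g3 np.
have id1 : idem 1 by rewrite /idem mulr1 subrr; case: ann_lin.
pose F (q : degree nu * B * 'I_rk) := act (u q.2 (g + q.1.1)) (1 * q.1.2).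
have Fm q : wmaps Vw l (l + dl g + dl q.1.1 + al q.2) (F q).
  move=> v lv; have := gm_hl_V (1 * q.1.2) (gm_hl_u q.2 (g + q.1.1)) lv.
  by rewrite gm_dlD [al _ + _]addrC !addrA.
apply: (wdim_joint_inj (gm_V_lin S) _ (fun q => gm_actV S _ _) Fm) => v lv H.
apply/eqP/negPn/negP => v0; have [p pb [] i] := not_pos_box id1 g3 v0 np.
have : (p, i) \in allpairs pair box (enum 'I_rk).
  by apply/allpairsP; exists (p, i); rewrite mem_enum.
elim: (allpairs _ _ _) H => //= q qs IHq [Fq Hq]; rewrite inE => /orP [/eqP epi|]; last exact: IHq.
by move: Fq; rewrite /F -epi /= => ->; rewrite eqxx.
Qed.

(** By [box_pos] positivity is a finite condition on one vector, and the finitely many tests for all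
    [g *+ k + t] with t in a ball hold once k is large. *)
Lemma pos_open g R : pos 1 g -> (exists v : V, v != 0) -> g != 0 ->
  exists k0, forall k, (k0 <= k)%N -> forall t, (nrm t <= R)%N ->
    pos 1 (g *+ k + t) /\ (3 <= nrm (g *+ k + t))%N.
Proof.
move=> pg [v v0] g0.
have id1 : idem 1 by rewrite /idem mulr1 subrr; case: ann_lin.
have prem q : q \in allpairs pair (ball nu R) box -> exists k0, forall k, (k0 <= k)%N ->
    kill v (g *+ k + q.1 + q.2.1) (1 * q.2.2).
  move=> _; have [k1 k1P] := pg v (q.1 + q.2.1) q.2.2.
  by exists k1 => k kk; rewrite -addrA; apply: k1P.
have [k0 k0P] := eventually_all prem.
exists (k0 + R + 3)%N => k kk t tR.
have g3 : (3 <= nrm (g *+ k + t))%N.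
  have := nrmD (g *+ k + t) (- t); rewrite addrK nrmMn nrmN.
  have : (k * 1 <= k * nrm g)%N by rewrite leq_mul2l lt0n nrm_eq0 g0 orbT.
  lia.
split=> //; apply: (box_pos id1 g3 v0) => p pb.
apply: (k0P k _ (t, p)); first lia.
by apply/allpairsP; exists (t, p); split=> //; apply: mem_ball.
Qed.

(** If G contains a positive g, all degrees near a large multiple of g are positive, so their
    opposites are not, and [wdim_not_pos] in the opposite direction compares the weight spaces there
    with fixed ones at l. If G contains none, the same comparison applies to all degrees of G
    outside a ball. *)
Lemma bounded_region (G : degree nu -> Prop) l : ~ ann 1 -> (exists v : V, v != 0) ->
  G 0 -> (forall m n, G m -> G n -> G (m + n)) -> (forall m, G m -> G (- m)) ->
  exists D, forall R, exists2 g, G g &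
    forall t, G t -> (nrm t <= R)%N -> forall i, (wdim (l + dl (g + t) + al i)%R <= D)%N.
Proof.
move=> nM1 Vn0 G0 GD GN.
have id1 : idem 1 by rewrite /idem mulr1 subrr; case: ann_lin.
have bnd t i : (3 <= nrm t)%N -> ~ pos 1 (- t) -> (wdim (l + dl t + al i)%R <= box_dim (l + al i)%R)%N.
  have := @wdim_not_pos (- t) (l + dl t + al i).
  have -> : l + dl t + al i + dl (- t) = l + al i.
    by rewrite dlN addrAC addrK.
  by rewrite nrmN; apply.
have bsum i : (box_dim (l + al i)%R <= \sum_j box_dim (l + al j)%R)%N.
  by rewrite [X in (_ <= X)%N](bigD1 i) //= leq_addr.
have [[g [Gg pg]]|np] := pselect (exists g, G g /\ pos 1 g).
  have g0 : g != 0.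
    apply/eqP => g0; apply: nM1; apply: ann_hom => i s c v.
    by have [k /(_ k (leqnn k) i)] := pg v s c; rewrite g0 mul0rn add0r.
  exists (\sum_j box_dim (l + al j)%R)%N => R.
  have [k /(_ k (leqnn k)) kP] := pos_open R pg Vn0 g0.
  exists (g *+ k); first by elim: k {kP} => [|k IHk] //; rewrite mulrS; apply: GD.
  move=> t Gt tR i; have [pt t3] := kP t tR.
  apply: leq_trans (bsum i); apply: bnd => //; apply: pos_anti => //.
  by rewrite -nrm_eq0 -lt0n (leq_trans _ t3).
exists (\sum_j box_dim (l + al j)%R + \sum_(t <- ball nu 2) \sum_j wdim (l + dl t + al j)%R)%N => R.
exists 0 => // t Gt _ i; rewrite add0r.
have [t3|t2] := leqP 3 (nrm t).
  apply: leq_trans (leq_addr _ _); apply: leq_trans (bsum i); apply: bnd => // pt.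
  by apply: np; exists (- t); split=> //; apply: GN.
have tb : t \in ball nu 2 by apply: mem_ball.
apply: leq_trans (leq_addl _ _); rewrite (big_rem t) //=.
by apply: leq_trans (leq_addr _ _); rewrite (bigD1 i) //= leq_addr.
Qed.

End Generators.

End GradedModule.

(** * Traces of weight-zero words *)

Definition ad (C : fieldType) (V : lmodType C) (Z : V -> V) (F : V -> V) (v : V) : V :=
  Z (F v) - F (Z v).

(** * Iterated commutators that raise exponents *)

Section Raising.
Variables (C : numClosedFieldType) (V : lmodType C) (Z : V -> V).
Hypothesis Z_lin : linear Z.

Lemma ad_lin F : linear F -> linear (ad Z F).
Proof.
move=> Fl a v w; rewrite /ad Fl !Z_lin Fl scalerBr opprD.
by rewrite addrACA.
Qed.

(** The n-th commutator is a signed sum of terms [Z^i F Z^j] with [i + j = n]. *)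
Lemma ad_iter_eq0 n F v : linear F ->
  (forall i j, (i + j)%N = n -> iter i Z (F (iter j Z v)) = 0) -> iter n (ad Z) F v = 0.
Proof.
elim: n F => [|n IHn] F Fl H; first exact: (H 0%N 0%N).
rewrite iterSr; apply: IHn => [|i j ij]; first exact: ad_lin.
rewrite /ad (linB (iter_lin i Z_lin)) -iterSr -iterS !H ?subrr //; lia.
Qed.

Lemma ad_iter_ext n F G v : F =1 G -> iter n (ad Z) F v = iter n (ad Z) G v.
Proof.
elim: n F G v => [|n IHn] F G v FG; first exact: FG.
by rewrite !iterSr; apply: IHn => w; rewrite /ad !FG.
Qed.

Lemma ad_iter_sum n (I : Type) (r : seq I) (c : I -> C) (F : I -> V -> V) v :
  iter n (ad Z) (fun v => \sum_(i <- r) c i *: F i v) v =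
    \sum_(i <- r) c i *: iter n (ad Z) (F i) v.
Proof.
elim: n v => [//|n IHn] v; rewrite iterS /ad !IHn (lin_sum Z_lin) -sumrB.
by apply: eq_bigr => i _; rewrite (linZ Z_lin) scalerBr.
Qed.

Variables (X : Type) (mm : X -> C) (F : X -> nat -> V -> V).
Hypothesis F_lin : forall x r, linear (F x r).
Hypothesis F_ad : forall x r v, Z (F x r v) - F x r (Z v) = mm x *: F x r.+1 v.

(** A letter [(x, r)] stands for x raised r times; by the Leibniz rule Z raises one letter of the
    word at a time, with coefficient [mm x]. *)
Fixpoint opr (ps : seq (X * nat)) (v : V) : V :=
  if ps is p :: ps' then F p.1 p.2 (opr ps' v) else v.

Lemma opr_lin ps : linear (opr ps).
Proof. by elim: ps => //= p ps IHps a v w; rewrite IHps F_lin. Qed.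

Fixpoint raises (ps : seq (X * nat)) : seq (C * seq (X * nat)) :=
  if ps is p :: ps' then
    (mm p.1, (p.1, p.2.+1) :: ps') :: [seq (q.1, p :: q.2) | q <- raises ps']
  else [::].

Lemma ad_opr ps v : ad Z (opr ps) v = \sum_(q <- raises ps) q.1 *: opr q.2 v.
Proof.
elim: ps v => [|p ps IHps] v; first by rewrite /ad big_nil subrr.
rewrite /= big_cons big_map /= -F_ad.
have -> : \sum_(j <- raises ps) j.1 *: F p.1 p.2 (opr j.2 v) =
    F p.1 p.2 (Z (opr ps v) - opr ps (Z v)).
  rewrite -[Z _ - _]/(ad Z (opr ps) v) IHps (lin_sum (@F_lin _ _)).
  by apply: eq_bigr => q _; rewrite (linZ (@F_lin _ _)).
by rewrite (linB (@F_lin _ _)) addrA subrK.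
Qed.

(** Bookkeeping towards the word with every letter raised: [n0] letters are still unraised, [fill]
    raises each of them once, and [mm0] is the coefficient this costs; [tot] counts the raises
    spent. *)
Definition n0 (ps : seq (X * nat)) : nat := count (fun p => p.2 == 0%N) ps.
Definition tot (ps : seq (X * nat)) : nat := sumn (map snd ps).
Definition fill (ps : seq (X * nat)) := [seq (p.1, maxn 1 p.2) | p <- ps].
Definition mm0 (ps : seq (X * nat)) : C := \prod_(p <- ps | p.2 == 0%N) mm p.1.


Lemma raises_P ps q : List.In q (raises ps) ->
  [/\ map fst q.2 = map fst ps, tot q.2 = (tot ps).+1 &
      n0 q.2 = n0 ps \/ [/\ (n0 q.2).+1 = n0 ps, fill q.2 = fill ps & q.1 * mm0 q.2 = mm0 ps]].
Proof.
elim: ps q => [|[x r] ps IHps] q //= [e|].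
  rewrite -{q}e /=; split=> //; rewrite /n0 /fill /mm0 /= !big_cons /=.
  by case: r => [|r] /=; [right; split|left].
move=> /List.in_map_iff [q' [<- /IHps [e1 e2 e3]]] /=; split; first by rewrite e1.
  by rewrite /tot /= -[sumn _]/(tot q'.2) e2 addnS.
rewrite /n0 /fill /mm0 /= !big_cons /=; case: e3 => [e3|[e3 e4 e5]].
  by left; congr (_ + _)%N.
right; split; first by rewrite -addnS; congr (_ + _)%N.
  by congr (_ :: _).
by case: ifP => _ //; rewrite mulrCA; congr (_ * _).
Qed.

Lemma size_raises0 ps : count (fun q => n0 q.2 < n0 ps)%N (raises ps) = n0 ps.
Proof.
elim: ps => [//|[x r] ps IHps].
have e r' q : n0 ((x, r') :: q) = ((r' == 0%N) + n0 q)%N by [].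
have -> : raises ((x, r) :: ps) =
  (mm x, (x, r.+1) :: ps) :: [seq (q.1, (x, r) :: q.2) | q <- raises ps] by [].
have count_cons (P : pred (C * seq (X * nat))) y s : count P (y :: s) = (P y + count P s)%N by [].
rewrite count_cons count_map [RHS]e; congr (_ + _)%N.
  by rewrite !e ltn_add2r; case: r {e}.
by rewrite -[RHS]IHps; apply: eq_count => q; apply: (ltn_add2l (r == 0%N)).
Qed.

Lemma eq_big_In (I : Type) (r : seq I) (f g : I -> V) :
  (forall i, List.In i r -> f i = g i) -> \sum_(i <- r) f i = \sum_(i <- r) g i.
Proof.
elim: r => [|i r IHr] H; first by rewrite !big_nil.
by rewrite !big_cons H /=; [rewrite IHr // => j jr; apply: H; right|left].
Qed.

Lemma fill_id ps : n0 ps = 0%N -> fill ps = ps.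
Proof.
rewrite /n0; elim: ps => //= [[x r] ps] IHps /= /eqP; rewrite addn_eq0 => /andP [r0 /eqP /IHps ->].
by move: r0; case: r => //= r _; rewrite (maxn_idPr _).
Qed.

(** Each of the k remaining raises has to hit an unraised letter, since otherwise one survives and
    the term vanishes. The k! orders of doing so all give the filled word. *)
Lemma raise_iter (pre : V -> V) v t xs : linear pre ->
  (forall ps, map fst ps = xs -> tot ps = t -> (0 < n0 ps)%N -> pre (opr ps v) = 0) ->
  forall k ps, map fst ps = xs -> (tot ps + k)%N = t ->
    ((k < n0 ps)%N -> pre (iter k (ad Z) (opr ps) v) = 0) /\
    (n0 ps = k -> pre (iter k (ad Z) (opr ps) v) = (k`!%:R * mm0 ps) *: pre (opr (fill ps) v)).
Proof.
move=> prel H; elim=> [|k IHk] ps eps tps.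
  rewrite addn0 in tps; split=> [n0p|n0p]; first exact: H.
  rewrite /mm0 fact0 mul1r big_hasC; last by rewrite has_count -leqNgt leqn0 -/(n0 ps) n0p.
  by rewrite scale1r fill_id.
have e : pre (iter k.+1 (ad Z) (opr ps) v) =
    \sum_(q <- raises ps) q.1 *: pre (iter k (ad Z) (opr q.2) v).
  rewrite iterSr (@ad_iter_ext _ _ (fun v => \sum_(q <- raises ps) q.1 *: opr q.2 v)).
    rewrite ad_iter_sum (lin_sum prel); apply: eq_bigr => q _; exact: linZ.
  by move=> w; apply: ad_opr.
have IH q : List.In q (raises ps) ->
    ((k < n0 q.2)%N -> pre (iter k (ad Z) (opr q.2) v) = 0) /\
    (n0 q.2 = k -> pre (iter k (ad Z) (opr q.2) v) = (k`!%:R * mm0 q.2) *: pre (opr (fill q.2) v)).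
  by move=> /raises_P [e1 e2 _]; apply: IHk; rewrite ?e1 // e2 -tps addnS.
split=> n0p; rewrite e.
  rewrite (@eq_big_In _ _ _ (fun=> 0)) ?big1 // => q qr.
  have kq : (k < n0 q.2)%N by have [_ _ [->|[e3 _ _]]] := raises_P qr; lia.
  by have [/(_ kq) -> _] := IH q qr; rewrite scaler0.
rewrite (@eq_big_In _ _ _ (fun q => if (n0 q.2 < n0 ps)%N then
   (k`!%:R * mm0 ps) *: pre (opr (fill ps) v) else 0)) => [|q qr].
  rewrite -big_mkcond big_const_seq size_raises0 iter_addr_0 n0p -scaler_nat scalerA.
  by rewrite factS natrM mulrA.
have [_ _ [e3|[e3 e4 e5]]] := raises_P qr.
  have kq : (k < n0 q.2)%N by rewrite e3 n0p ltnSn.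
  by rewrite e3 ltnn; have [/(_ kq) -> _] := IH q qr; rewrite scaler0.
have kq : n0 q.2 = k by apply/eqP; rewrite -eqSS e3 n0p.
rewrite -e3 ltnSn; have [_ /(_ kq) ->] := IH q qr.
by rewrite e4 scalerA mulrCA e5.
Qed.

(* If the k-th iterated commutator of Z with x_1 ... x_k vanishes and so do the
   words in which some x_i has not been raised, so does the word in which each
   x_i has been raised once. *)
Lemma raise_all (pre : V -> V) v (xs : seq X) : linear pre ->
  (forall ps, map fst ps = xs -> tot ps = size xs -> (0 < n0 ps)%N -> pre (opr ps v) = 0) ->
  \prod_(x <- xs) mm x != 0 ->
  iter (size xs) (ad Z) (opr [seq (x, 0%N) | x <- xs]) v = 0 ->
  pre (opr [seq (x, 1%N) | x <- xs] v) = 0.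
Proof.
move=> prel H mx0 it0.
have e1 : map fst [seq (x, 0%N) | x <- xs] = xs by rewrite -map_comp map_id.
have e2 : tot [seq (x, 0%N) | x <- xs] = 0%N.
  by rewrite /tot -map_comp; elim: (xs) => //= x s ->.
have [_] := raise_iter prel H e1 (etrans (congr1 (addn^~ _) e2) (add0n (size xs))).
have -> : n0 [seq (x, 0%N) | x <- xs] = size xs.
  by rewrite /n0; elim: (xs) => //= x s ->.
move=> /(_ erefl); rewrite it0 (lin0 prel) => /esym/eqP; rewrite scaler_eq0.
rewrite /mm0 big_map /= mulf_eq0 (negPf mx0) orbF pnatr_eq0 -leqn0 leqNgt fact_gt0 /=.
by rewrite /fill -map_comp => /eqP.
Qed.

End Raising.

(** * Sorting the letters of a word *)

Section Partition.
Variables (L : Type) (M : Type) (phi : seq L -> M) (Good : seq L -> Prop).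
Hypothesis swap : forall w1 l l' w2, Good (w1 ++ l :: l' :: w2) ->
  phi (w1 ++ l :: l' :: w2) = phi (w1 ++ l' :: l :: w2) /\ Good (w1 ++ l' :: l :: w2).

Lemma move_right w1 l w2 w3 : Good (w1 ++ l :: w2 ++ w3) ->
  phi (w1 ++ l :: w2 ++ w3) = phi (w1 ++ w2 ++ l :: w3) /\ Good (w1 ++ w2 ++ l :: w3).
Proof.
elim: w2 w1 => [|l' w2 IHw2] w1 G //=; have [-> G'] := swap G.
by move: G'; rewrite -cat_rcons => /IHw2; rewrite !cat_rcons.
Qed.

Lemma move_front w1 l w2 : Good (w1 ++ l :: w2) ->
  phi (w1 ++ l :: w2) = phi (l :: w1 ++ w2) /\ Good (l :: w1 ++ w2).
Proof.
elim/last_ind: w1 w2 => [|w1 l' IHw1] w2 //; rewrite cat_rcons => /swap [-> G].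
by have := IHw1 _ G; rewrite cat_rcons.
Qed.

(** [Good] carries the side conditions under which exchanging neighbours leaves [phi] unchanged. The
    letters of P end up on the right, where they act first. *)
Lemma partition_word (P : pred L) x w : Good (x ++ w) ->
  phi (x ++ w) = phi (x ++ filter (predC P) w ++ filter P w) /\
  Good (x ++ filter (predC P) w ++ filter P w).
Proof.
elim: w x => [|l w IHw] x G //=; have := G; rewrite -cat_rcons => /IHw [].
rewrite !cat_rcons => -> G'; case: (P l) => //=; exact: move_right.
Qed.

End Partition.

Section GenericForm.
Variables (C : numClosedFieldType) (nu : nat).

Definition lform (xi : 'I_nu.+1 -> C) (m : degree nu) : C := \sum_i xi i * (m i)%:~R.

Lemma nonroot (p : {poly C}) : p != 0 -> exists t, p.[t] != 0.
Proof.
move=> p0; apply: contrapT => H; pose rs : seq C := [seq i%:R | i <- iota 0 (size p)].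
have : (size rs < size p)%N.
  apply: max_poly_roots => //; last first.
    by rewrite map_inj_uniq ?iota_uniq // => i j /eqP; rewrite eqr_nat => /eqP.
  by apply/allP => t _; apply/negPn/negP => pt; apply: H; exists t.
by rewrite size_map size_iota ltnn.
Qed.

(** On the curve [xi_i = t^i] each form becomes a nonzero polynomial in t, and a product of finitely
    many of them has a nonroot. *)
Lemma generic_form (s : seq (degree nu)) : (forall m, m \in s -> m != 0) ->
  exists xi, forall m, m \in s -> lform xi m != 0.
Proof.
move=> s0; pose p (m : degree nu) : {poly C} := \poly_(i < nu.+1) (m (inord i))%:~R.
have p0 m : m != 0 -> p m != 0.
  apply: contra => /eqP pm; apply/eqP/ffunP => i; rewrite ffunE; apply/eqP.
  have := congr1 (fun q : {poly C} => q`_i) pm.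
  by rewrite /= coef_poly ltn_ord coef0 inord_val => /eqP; rewrite intr_eq0.
have [|t pt] := @nonroot (\prod_(m <- s) p m).
  by rewrite prodf_seq_neq0; apply/allP => m /s0 /p0.
exists (fun i => t ^+ i) => m ms; move: pt.
rewrite horner_prod prodf_seq_neq0 => /allP /(_ m ms) /=.
rewrite horner_poly /lform (eq_bigr (fun i : 'I_nu.+1 => t ^+ i * (m i)%:~R)) // => i _.
by rewrite inord_val mulrC.
Qed.

End GenericForm.

(** * Vanishing of words with many factors a *)

Section Words.
Variables (C : numClosedFieldType) (nu : nat) (T V : lmodType C).
Variables (B : comAlgType C) (Wt : zmodType).
Variable S : graded_module nu T V B Wt.

Local Notation act := (gm_act S).
Local Notation Vw := (gm_V S).
Local Notation dl := (gm_dl S).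
Local Notation hl := (gm_hl S).
Local Notation al := (@gm_al _ _ _ _ _ _ S).
Local Notation d := (gm_d S).
Local Notation rk := (gm_rk S).
Local Notation wdim := (wdim (gm_V_fin S)).

Variable a : B.

(** A letter acts by [lz] with coefficient [a ^+ lj * lc]; the exponent is kept apart because all
    estimates count factors a. Homogeneity is stored so that commutators are letters again. *)
Record letter := Letter {
  lz : T; la : Wt; lm : degree nu; lc : B; lj : nat; lP : hl la lm lz }.

Implicit Types (l : letter) (w : seq letter) (v : V).

Definition op1 l v := act (lz l) (a ^+ lj l * lc l) v.
Fixpoint opw w v := if w is l :: w' then op1 l (opw w' v) else v.

Definition lbr l l' : letter :=
  Letter (lc l * lc l') (lj l + lj l') (gm_hl_br (lP l) (lP l')).
Definition setj k l : letter := Letter (lc l) k (lP l).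
Definition l00 : letter := Letter 1 0 (gm_hl_d S ord0).

Definition lw l : Wt := la l + dl (lm l).
Definition ww w : Wt := \sum_(l <- w) lw l.
Definition dw w : degree nu := \sum_(l <- w) lm l.
Definition jw w : nat := \sum_(l <- w) lj l.
Definition nw w : nat := \sum_(l <- w) nrm (lm l).
Definition npos w : nat := \sum_(l <- w) (0 < lj l)%N.

Fixpoint allw (P : letter -> Prop) w : Prop :=
  if w is l :: w' then P l /\ allw P w' else True.

Lemma allw_cat P w w' : allw P (w ++ w') <-> allw P w /\ allw P w'.
Proof. by elim: w => [|l w IHw] /=; [split=> // [[]]|rewrite IHw and_assoc]. Qed.

Lemma allw_filter P (p : pred letter) w : allw P w -> allw (fun l => P l /\ p l) (filter p w).
Proof. by elim: w => //= l w IHw [Pl /IHw]; case: ifP => //=. Qed.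

Lemma allw_nth P w j : allw P w -> (j < size w)%N -> P (nth l00 w j).
Proof. by elim: w j => //= l w IHw [|j] [Pl Pw] //= jw'; apply: IHw. Qed.

Lemma allw_sub P Q w : (forall l, P l -> Q l) -> allw P w -> allw Q w.
Proof. by move=> PQ; elim: w => //= l w IHw [/PQ ? /IHw]. Qed.

Lemma has_split (P : pred letter) w : has P w -> exists w1 l w2, w = w1 ++ l :: w2 /\ P l.
Proof.
elim: w => //= l w IHw; case Pl: (P l) => /=; first by exists [::], l, w.
by move=> /IHw [w1 [l' [w2 [-> Pl']]]]; exists (l :: w1), l', w2.
Qed.

Lemma op1_lin l : linear (op1 l). Proof. exact: gm_actV. Qed.

Lemma opw_lin w : linear (opw w).
Proof. by elim: w => //= l w IHw c v v'; rewrite IHw op1_lin. Qed.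

Lemma opw_cat w w' v : opw (w ++ w') v = opw w (opw w' v).
Proof. by elim: w => //= l w ->. Qed.

Lemma op1_swap l l' v : op1 l (op1 l' v) = op1 l' (op1 l v) + op1 (lbr l l') v.
Proof. by rewrite /op1 act_swap /= exprD mulrACA. Qed.

Lemma opw_swap w1 l l' w2 v : opw (w1 ++ l :: l' :: w2) v =
  opw (w1 ++ l' :: l :: w2) v + opw (w1 ++ lbr l l' :: w2) v.
Proof. by rewrite !opw_cat /= op1_swap (linD (opw_lin w1)). Qed.

Lemma ww_swap w1 l l' w2 : ww (w1 ++ l :: l' :: w2) = ww (w1 ++ l' :: l :: w2).
Proof. by rewrite /ww !big_cat !big_cons /= [X in _ + X]addrCA. Qed.

Lemma ww_merge w1 l l' w2 : ww (w1 ++ lbr l l' :: w2) = ww (w1 ++ l :: l' :: w2).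
Proof.
by rewrite /ww !big_cat !big_cons /= /lw /= gm_dlD addrACA -!addrA.
Qed.

Lemma hl0_V z b mu v : hl 0 0 z -> Vw mu v -> Vw mu (act z b v).
Proof. by move=> hz /(gm_hl_V b hz); rewrite dl0 !addr0. Qed.

Lemma op1_V l mu v : Vw mu v -> Vw (mu + lw l) (op1 l v).
Proof. exact: gm_hl_V (lP l). Qed.

Lemma opw_V w mu v : Vw mu v -> Vw (mu + ww w) (opw w v).
Proof.
move=> mv; elim: w => [|l w IHw]; first by rewrite /ww big_nil addr0.
by rewrite /ww big_cons [lw l + _]addrC addrA; apply: op1_V.
Qed.

Lemma opw_maps w mu : ww w = 0 -> wmaps Vw mu mu (opw w).
Proof. by move=> w0 v /(opw_V w); rewrite w0 addr0. Qed.

Hypothesis a_nil : forall z c v, hl 0 0 z -> exists q, iter q (act z (a * c)) v = 0.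

Lemma hl0_iter z c mu k v : hl 0 0 z -> (wdim mu <= k)%N -> Vw mu v ->
  iter k (act z (a * c)) v = 0.
Proof.
move=> hz dk mv; apply: (iter0_mono (gm_actV S _ _) dk).
apply: (lnil_iter (gm_V_lin S)) => //; first exact: gm_actV.
  by move=> x; apply: hl0_V.
by move=> x _; apply: a_nil.
Qed.

Lemma ad_act_d i k al0 m z c v : hl al0 m z ->
  iter k (ad (act (d i) a)) (act z c) v = (m i)%:~R ^+ k *: act z (a ^+ k * c) v.
Proof.
move=> hz; elim: k v => [|k IHk] v; first by rewrite expr0 scale1r mul1r.
rewrite iterS /ad !IHk (linZ (gm_actV S _ _)) -scalerBr (act_d_swap _ _ _ _ hz).
by rewrite addrAC subrr add0r scalerA -exprSr mulrA -exprS.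
Qed.

(** Since [d_i (x) a] is nilpotent of order D on source and target, its 2D-th commutator with
    [z (x) c] vanishes; that commutator is [m_i^(2D)] times [z (x) a^(2D) c]. *)
Lemma act_high D al0 m z mu c v : hl al0 m z -> m != 0 -> (wdim mu <= D)%N ->
  (wdim (mu + (al0 + dl m))%R <= D)%N -> Vw mu v -> act z (a ^+ (D + D) * c) v = 0.
Proof.
move=> hz m0 D1 D2 mv; have [i mi] : exists i, m i != 0.
  apply/existsP; apply: contraNT m0; rewrite negb_exists => /forallP m0.
  by apply/eqP/ffunP => i; rewrite ffunE; apply/eqP; have := m0 i; rewrite negbK.
have := @ad_act_d i (D + D) _ _ _ c v hz; rewrite (@ad_iter_eq0 _ _ _ (gm_actV S _ _)).
- move=> /esym/eqP; rewrite scaler_eq0 expf_eq0 intr_eq0 (negPf mi) andbF.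
  by move=> /eqP.
- exact: gm_actV.
move=> j k jk; have hd := gm_hl_d S i; rewrite -[a]mulr1.
have [Dk|kD] := leqP D k.
  rewrite (hl0_iter 1 hd _ mv) ?(leq_trans D1) // act_v0.
  exact: lin0 (iter_lin j (gm_actV S _ _)).
have Dj : (D <= j)%N by lia.
apply: (hl0_iter 1 hd (leq_trans D2 Dj)); apply: gm_hl_V hz _.
by elim: (k) => //= k' IHk; apply: hl0_V.
Qed.

Section Region.
Variables (D R : nat) (G : degree nu -> Prop) (mu : Wt) (m0 : degree nu).
Hypothesis G0 : G 0.
Hypothesis GD : forall m n, G m -> G n -> G (m + n).
Hypothesis GN : forall m, G m -> G (- m).
Hypothesis Gm0 : G m0.
Hypothesis m00 : m0 != 0.
Hypothesis reg : forall t, G t -> (nrm t <= R)%N -> forall i, (wdim (mu + dl t + al i)%R <= D)%N.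

(** Twice the exponent of [act_high]: a letter of degree 0 is written through brackets of degrees
    [m0] and [- m0], and each of the two needs its own. *)
Let N := (D + D + (D + D))%N.

Definition okl l := la l = 0 /\ G (lm l).

Lemma reg0 t : G t -> (nrm t <= R)%N -> (wdim (mu + dl t)%R <= D)%N.
Proof. by have [i ei] := gm_al0 S => Gt tR; have := reg Gt tR i; rewrite ei addr0. Qed.

Lemma dw_G w : allw okl w -> G (dw w).
Proof.
elim: w => [|l w IHw] /= ; first by rewrite /dw big_nil.
by move=> [[_ Gl] /IHw Gw]; rewrite /dw big_cons; apply: GD.
Qed.

Lemma ww_dw w : allw okl w -> ww w = dl (dw w).
Proof.
elim: w => [|l w IHw] /=; first by rewrite /dw /ww !big_nil dl0.
by move=> [[l0 _] /IHw ew]; rewrite /dw /ww !big_cons gm_dlD -ew /lw l0 add0r.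
Qed.

Lemma nrm_dw w : (nrm (dw w) <= nw w)%N.
Proof.
elim: w => [|l w IHw]; first by rewrite /dw /nw !big_nil nrm0.
by rewrite /dw /nw !big_cons (leq_trans (nrmD _ _)) // leq_add2l.
Qed.

Lemma opw_region w t v : allw okl w -> Vw (mu + dl t) v ->
  Vw (mu + dl (t + dw w)) (opw w v).
Proof. by move=> aw tv; rewrite gm_dlD addrA -ww_dw //; apply: opw_V. Qed.

Lemma letter_high l t v : okl l -> (N <= lj l)%N -> G t ->
  (nrm t + nrm (lm l) + nrm m0 <= R)%N -> Vw (mu + dl t) v -> op1 l v = 0.
Proof.
case: l => z al0 m c j hz [/= e0 Gm] Nj Gt tR tv; rewrite /op1 /=; subst al0.
have tR0 : (nrm t <= R)%N by lia.
have e : a ^+ j * c = a ^+ (D + D) * (a ^+ (D + D) * (a ^+ (j - N) * c)).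
  by rewrite !mulrA -!exprD; congr (_ ^+ _ * _); rewrite /N; lia.
have [z0|mn0] := eqVneq m 0; last first.
  rewrite e; apply: (act_high _ hz mn0 _ _ tv); first exact: reg0.
  rewrite add0r -addrA -gm_dlD; apply: reg0; first exact: GD.
  by apply: leq_trans (nrmD _ _) _; lia.
subst m; rewrite e; apply: (hl_span (act_lc S _ v) hz) => k.
rewrite -[0](addrN m0).
apply: (gm_br_span (act_lc S _ v)).
- rewrite -subr_eq0 opprK -mulr2n; apply/eqP => /eqP.
  by rewrite -nrm_eq0 nrmMn muln_eq0 nrm_eq0 (negPf m00).
- by rewrite oppr_eq0.
move=> i i'; rewrite gm_act_br.
have shift m i1 : G (t + m) -> (nrm (t + m) <= R)%N ->
    (wdim (mu + dl t + (al i1 + dl m))%R <= D)%N.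
  by move=> Gtm /(reg Gtm) /(_ i1); rewrite gm_dlD [al i1 + _]addrC !addrA.
have t1 : (nrm (t + m0) <= R)%N by apply: leq_trans (nrmD _ _) _; lia.
have t2 : (nrm (t - m0) <= R)%N by apply: leq_trans (nrmD _ _) _; rewrite nrmN; lia.
have s1 := shift m0 i (GD Gt Gm0) t1.
have s2 := shift (- m0) i' (GD Gt (GN Gm0)) t2.
have nm00 : - m0 != 0 by rewrite oppr_eq0.
rewrite (act_high (a ^+ (j - N) * c) (gm_hl_u i' (- m0)) nm00 (reg0 Gt tR0) s2 tv).
rewrite act_v0 -[a ^+ (D + D)]mulr1.
by rewrite (act_high 1 (gm_hl_u i m0) m00 (reg0 Gt tR0) s1 tv) act_v0 subr0.
Qed.

(** A total exponent below this bound is forced if no exponent reaches N, fewer than D letters of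
    positive exponent have degree 0, and each exponent below N occurs on fewer than 2D letters of
    nonzero degree. *)
Definition Kbound := ((D + (D + D) * N) * N).+1.

Definition vanish w := forall t v, G t -> allw okl w ->
  (nrm t + nw w + nrm m0 <= R)%N -> Vw (mu + dl t) v -> opw w v = 0.

Lemma npos_cat w w' : npos (w ++ w') = (npos w + npos w')%N.
Proof. by rewrite /npos big_cat. Qed.
Lemma jw_cat w w' : jw (w ++ w') = (jw w + jw w')%N.
Proof. by rewrite /jw big_cat. Qed.
Lemma nw_cat w w' : nw (w ++ w') = (nw w + nw w')%N.
Proof. by rewrite /nw big_cat. Qed.
Lemma npos_cons l w : npos (l :: w) = ((0 < lj l) + npos w)%N.
Proof. by rewrite /npos big_cons. Qed.
Lemma jw_cons l w : jw (l :: w) = (lj l + jw w)%N.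
Proof. by rewrite /jw big_cons. Qed.
Lemma nw_cons l w : nw (l :: w) = (nrm (lm l) + nw w)%N.
Proof. by rewrite /nw big_cons. Qed.

Definition wE := (npos_cat, jw_cat, nw_cat, npos_cons, jw_cons, nw_cons).

Lemma jw_npos0 w : npos w = 0%N -> jw w = 0%N.
Proof.
elim: w => [|l w IHw]; first by rewrite /jw big_nil.
by rewrite !wE; case: (lj l) => // /IHw ->.
Qed.

Lemma jw_le M w : ~~ has (fun l => M <= lj l)%N w -> (jw w <= npos w * M)%N.
Proof.
elim: w => [|l w IHw]; first by rewrite /jw /npos !big_nil.
by rewrite /= negb_or -ltnNge !wE => /andP [lM /IHw]; case: (lj l) lM; lia.
Qed.

Lemma pigeon (Q : pred letter) M M' w : ~~ has (fun l => M <= lj l)%N w ->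
  (forall j, (j < M)%N -> (count (fun l => Q l && (lj l == j)) w <= M')%N) ->
  (count Q w <= M * M')%N.
Proof.
move=> nM cM; apply: (@leq_trans (\sum_(j < M) count (fun l => Q l && (lj l == j)) w)).
  elim: w nM {cM} => //= l w IHw; rewrite negb_or -ltnNge => /andP [lM /IHw {}IHw].
  rewrite big_split leq_add //= (bigD1 (Ordinal lM)) //= eqxx andbT; exact: leq_addr.
rewrite -[X in (X * _)%N]card_ord -sum_nat_const; apply: leq_sum => j _; exact: cM.
Qed.

Lemma hl0_letter l : la l = 0 -> lm l = 0 -> hl 0 0 (lz l).
Proof. by move=> <- <-; apply: lP. Qed.

Lemma op1_nil l v : la l = 0 -> lm l = 0 -> (0 < lj l)%N -> exists q, iter q (op1 l) v = 0.
Proof.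
move=> l0 m0' jl; have [q e] := a_nil (a ^+ (lj l).-1 * lc l) v (hl0_letter l0 m0').
by exists q; rewrite -e /op1 mulrA -exprS prednK.
Qed.

Lemma opw_foldr w v : opw w v = foldr (fun F x => F x) v (map op1 w).
Proof. by elim: w => //= l w ->. Qed.

Lemma opw_zero_letters w t v : G t -> (nrm t <= R)%N -> Vw (mu + dl t) v ->
  allw (fun l => okl l /\ (0 < lj l)%N && (lm l == 0)) w -> (D <= size w)%N -> opw w v = 0.
Proof.
move=> Gt tR tv aw Dw; rewrite opw_foldr.
have wP j : (j < size w)%N -> let l := nth l00 w j in [/\ la l = 0, lm l = 0 & (0 < lj l)%N].
  by move=> /(allw_nth aw) [[? _] /andP [? /eqP ?]].
apply: (prod_lnil (gm_V_lin S) (Vw_fin := gm_V_fin S) _ _ _ tv).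
- by rewrite size_map; apply: leq_trans (reg0 Gt tR) Dw.
- move=> j; rewrite size_map => jlt; rewrite (nth_map l00) //; have [l0 m0' jl] := wP j jlt.
  split; first exact: op1_lin.
    by move=> x; apply: hl0_V; apply: hl0_letter.
  by move=> x _; apply: op1_nil.
move=> i j x; rewrite size_map => il jlt _; rewrite !(nth_map l00) //.
have [? ? _] := wP j jlt; have [? ? _] := wP i il.
by apply: gm_hl0_comm; apply: hl0_letter.
Qed.

Definition dxi (xi : 'I_nu.+1 -> C) : T := \sum_i xi i *: d i.

Lemma hl_dxi xi : hl 0 0 (dxi xi).
Proof.
by apply: lc_sum => [|i _]; [exact: gm_hl_lin|apply: lcZ; [exact: gm_hl_lin|exact: gm_hl_d]].
Qed.

Lemma act_dxi xi b v : act (dxi xi) b v = \sum_i xi i *: act (d i) b v.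
Proof.
rewrite /dxi (lin_sum (gm_actT S b v)).
by apply: eq_bigr => i _; rewrite (linZ (gm_actT S b v)).
Qed.

Lemma act_dxi_swap xi al0 m z b c v : hl al0 m z ->
  act (dxi xi) b (act z c v) = act z c (act (dxi xi) b v) + lform xi m *: act z (b * c) v.
Proof.
move=> hz; rewrite !act_dxi (lin_sum (gm_actV S z c)) /lform scaler_suml -big_split /=.
apply: eq_bigr => i _; rewrite (act_d_swap _ _ _ _ hz) scalerDr scalerA.
by rewrite (linZ (gm_actV S z c)).
Qed.

(** Each of the 2D equal exponents j is produced by one commutator with [Z = dxi (x) a^j] from a
    letter of exponent 0. Any other distribution of the 2D raises leaves such a letter: the total
    exponent is unchanged but fewer letters have positive exponent, so [IH] applies. The 2D-th
    commutator vanishes because Z is nilpotent of order D on both sides. *)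
Lemma exact_letters j w1 w2 t v p : G t -> Vw (mu + dl t) v -> (0 < j)%N ->
  allw okl (w1 ++ w2) -> (nrm t + nw (w1 ++ w2) + nrm m0 <= R)%N ->
  allw (fun l => lj l = j /\ lm l != 0) w2 -> size w2 = (D + D)%N ->
  (Kbound <= jw (w1 ++ w2))%N -> (npos (w1 ++ w2) <= p.+1)%N ->
  (forall w, (npos w <= p)%N -> (Kbound <= jw w)%N -> vanish w) ->
  opw (w1 ++ w2) v = 0.
Proof.
move=> Gt tv j0 aw nR aj sz Kw npw IH; rewrite opw_cat.
have /allw_cat [aw1 aw2] := aw.
pose F l r := op1 (setj (j * r) l).
pose toW (ps : seq (letter * nat)) := [seq setj (j * p.2) p.1 | p <- ps].
have oprE ps x : opr F ps x = opw (toW ps) x by elim: ps => //= q ps ->.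
have [xi xiP] : exists xi : 'I_nu.+1 -> C, \prod_(l <- w2) lform xi (lm l) != 0.
  have [|xi xiP] := @generic_form C nu (map lm w2).
    by elim: (w2) aj => //= l w IHw [[_ lm0] /IHw {}IHw] m; rewrite inE => /orP [/eqP ->|/IHw].
  exists xi; elim: (w2) xiP => [|l w IHw] xiP; first by rewrite big_nil oner_eq0.
  rewrite big_cons mulf_neq0 ?IHw //; first by apply: xiP; rewrite inE eqxx.
  by move=> m mw; apply: xiP; rewrite inE mw orbT.
have e1 x : opw w2 x = opr F [seq (l, 1%N) | l <- w2] x.
  elim: (w2) aj => //= l w IHw [[lj1 _] /IHw ->]; rewrite /F /op1 /=.
  by rewrite muln1 lj1.
rewrite e1; pose Z := act (dxi xi) (a ^+ j).
have Zl : linear Z by exact: gm_actV.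
have F_ad l r x : Z (F l r x) - F l r (Z x) = lform xi (lm l) *: F l r.+1 x.
  rewrite /Z /F /op1 /= (act_dxi_swap _ _ _ _ (lP l)) addrAC subrr add0r.
  by rewrite mulrA -exprD mulnS.
have Fl l r : linear (F l r) by exact: op1_lin.
apply: (raise_all Zl Fl F_ad (opw_lin w1) _ xiP) => [ps eps tps n0ps|].
  rewrite oprE -opw_cat.
  have awps : allw okl (toW ps).
    by elim: (ps) w2 eps aw2 {aw nR aj sz Kw npw xiP e1 tps n0ps} => [|q s IHs] [|l w] //= [-> es] [? aww]; split=> //; apply: IHs es aww.
  have nwps : nw (toW ps) = nw w2.
    by rewrite -eps /nw !big_map.
  have jwps : jw (toW ps) = jw w2.
    have -> : jw (toW ps) = (j * tot ps)%N.
      rewrite /tot /jw big_map; elim: (ps) => [|q s IHs]; rewrite ?big_nil ?muln0 //.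
      by rewrite big_cons IHs /= mulnDr.
    rewrite tps; elim: (w2) aj => [|l w IHw]; rewrite ?wE ?muln0; first by rewrite /jw big_nil.
    by move=> /= [[-> _] /IHw <-]; rewrite mulnS.
  have npps : (npos (toW ps) < npos w2)%N.
    have -> : npos w2 = size w2.
      elim: (w2) aj => [|l w IHw] /=; first by rewrite /npos big_nil.
      by move=> [[lj1 _] /IHw ew]; rewrite wE ew lj1 j0.
    rewrite -eps size_map; move: n0ps; rewrite /n0 /toW.
    elim: (ps) => [|[l r] s IHs] //=; rewrite wE /= muln_gt0 j0 /=.
    case: r => [|r] /=; last by rewrite add0n => /IHs; lia.
    move=> _; rewrite add0n ltnS; elim: (s) => [|q s' IHs'] /=; first by rewrite /npos big_nil.
    by rewrite wE; case: (0 < _)%N; lia.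
  apply: (IH _ _ _ t) => //; rewrite ?wE ?nwps ?jwps.
  - by move: npw; rewrite wE; lia.
  - by move: Kw; rewrite wE.
  - by apply/allw_cat.
  - by move: nR; rewrite wE.
rewrite sz; apply: ad_iter_eq0 => //; first exact: opr_lin.
move=> i k ik; rewrite -/Z.
have ej : a ^+ j = a * a ^+ j.-1 by rewrite -exprS prednK.
have tR : (nrm t <= R)%N by lia.
have [Dk|kD] := leqP D k.
  rewrite /Z ej (hl0_iter _ (hl_dxi xi) (leq_trans (reg0 Gt tR) Dk) tv).
  rewrite (lin0 (opr_lin Fl _)); exact: lin0 (iter_lin i (gm_actV S _ _)).
have Di : (D <= i)%N by lia.
set ps := [seq _ | _ <- _]; have awps : allw okl (toW ps).
  by rewrite /ps; elim: (w2) aw2 => //= l w IHw [? /IHw].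
have dwps : dw (toW ps) = dw w2 by rewrite /ps /dw /toW -map_comp big_map.
have tv' : Vw (mu + dl (t + dw w2)) (opw (toW ps) (iter k Z v)).
  rewrite -dwps; apply: opw_region => //; elim: (k) => //= k' IHk.
  by apply: hl0_V => //; apply: hl_dxi.
rewrite oprE; set y := opw _ _ in tv' *; rewrite /Z ej.
rewrite (hl0_iter _ (hl_dxi xi) (leq_trans (reg0 _ _) Di) tv') //.
  by apply: GD => //; apply: dw_G.
by apply: leq_trans (nrmD _ _) _; have := nrm_dw w2; move: nR; rewrite wE; lia.
Qed.

(** Induction on the number of letters of positive exponent, then on length: exchanging neighbours
    costs a word with a merged letter, which is shorter, has the same total exponent and no more
    positive letters. So letters may be sorted, and by pigeonhole there is a large exponent, or D
    commuting nilpotent letters of degree 0, or 2D letters of equal exponent and nonzero degree. *)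
Lemma words_vanish p w : (npos w <= p)%N -> (Kbound <= jw w)%N -> vanish w.
Proof.
elim: p w => [|p IHp] w; first by rewrite leqn0 => /eqP /jw_npos0 ->.
have [n] := ubnP (size w); elim: n w => // n IHn w; rewrite ltnS => sz npw Kw t v Gt aw nR tv.
case: (boolP (has (fun l => N <= lj l)%N w)) => [/has_split [w1 [l [w2 [ew Nl]]]]|nN].
  move: aw nR; rewrite ew opw_cat !wE => /allw_cat [aw1 [ol aw2]] nR.
  have nw2 := nrm_dw w2; have nt := nrmD t (dw w2).
  rewrite /= (letter_high ol Nl _ _ (opw_region aw2 tv)) ?(lin0 (opw_lin w1)) //.
    by apply: GD => //; apply: dw_G.
  by lia.
pose Good x := [/\ allw okl x, (nrm t + nw x + nrm m0 <= R)%N, (Kbound <= jw x)%N,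
  (npos x <= p.+1)%N & (size x <= n)%N].
have Gw : Good w by split.
have swap w1 l l' w2 : Good (w1 ++ l :: l' :: w2) ->
    opw (w1 ++ l :: l' :: w2) v = opw (w1 ++ l' :: l :: w2) v /\ Good (w1 ++ l' :: l :: w2).
  move=> [/allw_cat [a1 [al1 [al2 a2]]]]; rewrite !wE size_cat /= => g1 g2 g3 g4.
  split; last first.
    by split; rewrite ?wE ?size_cat /=; try lia; apply/allw_cat.
  have nl := nrmD (lm l) (lm l').
  rewrite opw_swap (IHn (w1 ++ lbr l l' :: w2) _ _ _ t) ?addr0 // ?wE ?size_cat /=; try lia.
  apply/allw_cat; split=> //=; split=> //; case: al1 al2 => e1 G1 [e2 G2].
  by split=> /=; [rewrite e1 e2 addr0|apply: GD].
pose P0 l := (0 < lj l)%N && (lm l == 0).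
have tR : (nrm t <= R)%N by lia.
have [DP0|P0D] := leqP D (count P0 w).
  have [/= -> _] := partition_word (phi := opw^~ v) swap P0 (x := [::]) Gw; rewrite opw_cat.
  rewrite (opw_zero_letters Gt tR tv (allw_filter P0 aw)) ?size_filter //.
  exact: lin0 (opw_lin _).
pose Q l := (0 < lj l)%N && (lm l != 0).
have enp : npos w = (count P0 w + count Q w)%N.
  rewrite /npos /P0 /Q; elim: (w) => [|l s IHs]; rewrite ?big_nil //.
  by rewrite big_cons IHs /=; case: (0 < lj l)%N => //=; case: (lm l == 0) => /=; lia.
have [j [jN cj]] : exists j, (j < N)%N /\ (D + D <= count (fun l => Q l && (lj l == j)) w)%N.
  apply: contrapT => H; have := jw_le nN.
  have cQ : (count Q w <= N * (D + D))%N.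
    apply: (pigeon nN) => j jN; rewrite leqNgt; apply/negP => lt; apply: H.
    by exists j; split=> //; apply: ltnW.
  rewrite enp => jle; move: (leq_trans Kw jle); rewrite /Kbound ltnNge leq_mul2r.
  by rewrite [((D + D) * N)%N]mulnC leq_add ?orbT // ltnW.
pose Pj l := Q l && (lj l == j).
have [/= -> G'] := partition_word (phi := opw^~ v) swap Pj (x := [::]) Gw.
set w2 := filter Pj w in G' *; set k := (size w2 - (D + D))%N.
move: G' => /=; rewrite -(cat_take_drop k w2) catA => -[g1 g2 g3 g4 g5].
have a2 : allw (fun l => lj l = j /\ lm l != 0) w2.
  apply: (allw_sub _ (allw_filter Pj aw)) => l [_].
  by rewrite /Pj /Q => /andP [/andP [_ ->] /eqP].
have s2 : (D + D <= size w2)%N by rewrite /w2 size_filter.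
(* For D = 0 the count says nothing about j, but then the weight space itself is zero. *)
have j0 : (0 < j)%N \/ (D = 0)%N.
  have [->|D0] := eqVneq D 0%N; [by right|left].
  have : has Pj w by rewrite has_count; apply: leq_trans cj; rewrite addn_gt0 lt0n D0.
  by move=> /has_split [? [l [? [_]]]]; rewrite /Pj /Q => /andP [/andP [+ _] /eqP <-].
case: j0 => [j0|D0]; last first.
  have := reg0 Gt tR; rewrite [X in (_ <= X)%N]D0 leqn0 => /eqP /wdim_eq0 /(_ tv) ->.
  exact: lin0 (opw_lin _).
apply: (exact_letters Gt tv j0 g1 g2 _ _ g3 g4 IHp).
  by move: a2; rewrite -{1}(cat_take_drop k w2) => /allw_cat [].
by rewrite size_drop /k subKn.
Qed.

End Region.

End Words.

Lemma iter_comp_comm (X : Type) (F G : X -> X) q x : (forall y, G (F y) = F (G y)) ->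
  iter q (fun y => F (G y)) x = iter q F (iter q G x).
Proof.
move=> FG; elim: q => //= q ->; congr (F _).
by elim: q (iter q G x) => //= q IHq y; rewrite FG IHq.
Qed.

(** * The nilpotency criterion for membership in M *)

Section Traces.
Variables (C : numClosedFieldType) (nu : nat) (T V : lmodType C).
Variables (B : comAlgType C) (Wt : zmodType).
Variable S : graded_module nu T V B Wt.

Local Notation act := (gm_act S).
Local Notation Vw := (gm_V S).
Local Notation ev := (gm_ev S).
Local Notation dl := (gm_dl S).
Local Notation hl := (gm_hl S).
Local Notation u := (@gm_u _ _ _ _ _ _ S).
Local Notation al := (@gm_al _ _ _ _ _ _ S).
Local Notation d := (gm_d S).
Local Notation rk := (gm_rk S).
Local Notation wdim := (wdim (gm_V_fin S)).
Local Notation wtr := (wtr (gm_V_fin S)).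
Local Notation letter := (letter S).

Variable gs : seq B.
Hypothesis gsP : forall P : {pred B}, subalg_closed P -> {subset gs <= P} -> P =i predT.
Hypothesis Vn0 : exists v : V, v != 0.
Hypothesis nM1 : ~ ann S 1.

Variable a : B.
Hypothesis a_nil : forall z c v, hl 0 0 z -> exists q, iter q (act z (a * c)) v = 0.

Local Notation opw := (opw a).
Local Notation op1 := (op1 a).
Implicit Types (l : letter) (w : seq letter) (v : V).

Lemma op1E l v : op1 l v = act (lz l) (a ^+ lj l * lc l) v. Proof. by []. Qed.

Lemma wtr_opw_swap w1 l l' w2 mu : ww (w1 ++ l :: l' :: w2) = 0 ->
  wtr mu (opw (w1 ++ l :: l' :: w2)) =
    wtr mu (opw (w1 ++ l' :: l :: w2)) + wtr mu (opw (w1 ++ lbr l l' :: w2)).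
Proof.
move=> w0; have sw : ww (w1 ++ l' :: l :: w2) = 0 by rewrite -ww_swap.
have mw : ww (w1 ++ lbr l l' :: w2) = 0 by rewrite ww_merge.
rewrite -[X in X + _]mul1r -(wtr_lin (gm_V_lin S) _ 1 (opw_maps a (mu := mu) sw) (opw_maps a (mu := mu) mw)).
by apply: (eq_wtr (gm_V_lin S)) => v _; rewrite opw_swap scale1r.
Qed.

Lemma wtr_opw_nil w mu : ww w = 0 ->
  (forall v, Vw mu v -> exists q, iter q (opw w) v = 0) -> wtr mu (opw w) = 0.
Proof.
move=> w0 H; apply: (wtr_nil (gm_V_lin S)) => //; [exact: opw_lin|exact: opw_maps].
Qed.

Lemma iter_opw w q v : iter q (opw w) v = opw (flatten (nseq q w)) v.
Proof. by elim: q => //= q ->; rewrite opw_cat. Qed.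

Lemma allw_split (P : letter -> Prop) w :
  (forall w1 l w2, w = w1 ++ l :: w2 -> P l) -> allw P w.
Proof.
elim: w => //= l w IHw H; split; first exact: (H [::] l w).
by apply: IHw => w1 l' w2 ew; apply: (H (l :: w1) l' w2); rewrite ew.
Qed.

(* Traces of products are invariant under cyclic rotation: they do not change when
   the weight is shifted by a letter, which by finiteness of strings kills them
   unless all letters have g-weight zero; in that case the weight is moved to a
   region of bounded dimensions, where powers of the word vanish. *)
Lemma words_trace w mu : ww w = 0 -> (0 < jw w)%N -> wtr mu (opw w) = 0.
Proof.
have [n] := ubnP (size w); elim: n w mu => // n IHn w mu; rewrite ltnS => sz w0 jw0.
pose Good (x : seq letter) := [/\ ww x = 0, (0 < jw x)%N & (size x <= n)%N].
have Gw : Good w by split.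
have swap m w1 l l' w2 : Good (w1 ++ l :: l' :: w2) ->
    wtr m (opw (w1 ++ l :: l' :: w2)) = wtr m (opw (w1 ++ l' :: l :: w2)) /\
    Good (w1 ++ l' :: l :: w2).
  move=> [g1 g2 g3]; split; last first.
    split; first by rewrite -ww_swap.
      by move: g2; rewrite !wE; lia.
    by move: g3; rewrite !size_cat.
  rewrite wtr_opw_swap // [X in _ + X]IHn ?addr0 ?ww_merge //.
    by move: g3; rewrite !size_cat /=; lia.
  by move: g2; rewrite !wE /=; lia.
have shift w1 l w2 m : w = w1 ++ l :: w2 -> wtr m (opw w) = wtr (m - lw l) (opw w).
  move=> ew; have G1 := Gw; rewrite ew in G1.
  have [e1 G2] := move_front (phi := fun x => wtr m (opw x)) (swap m) G1.
  have [e2 _] := move_front (phi := fun x => wtr (m - lw l) (opw x)) (swap (m - lw l)) G1.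
  have [e3 _] := move_right (phi := fun x => wtr (m - lw l) (opw x)) (w1 := [::]) (w3 := [::])
    (swap (m - lw l)) (eq_ind _ Good G2 _ (congr1 (cons l) (esym (cats0 (w1 ++ w2))))).
  rewrite ew e1 e2 -[w1 ++ w2]cats0 [RHS]e3 /= cats0.
  have ws : ww (w1 ++ w2) = - lw l.
    by case: G2 => /eqP + _ _; rewrite /ww big_cons addrC addr_eq0 => /eqP.
  have F1 : wmaps Vw m (m - lw l) (opw (w1 ++ w2)) by move=> v /(opw_V a (w1 ++ w2)); rewrite ws.
  have F2 : wmaps Vw (m - lw l) m (op1 l) by move=> v /(op1_V a l); rewrite subrK.
  have -> := wtr_comm (gm_V_lin S) (gm_V_fin S) (opw_lin a (w1 ++ w2)) F1 (op1_lin a l) F2.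
  by apply: (eq_wtr (gm_V_lin S)) => v _; rewrite !opw_cat.
have shift_k w1 l w2 m k : w = w1 ++ l :: w2 -> wtr m (opw w) = wtr (m + lw l *+ k) (opw w).
  move=> ew; elim: k => [|k ->]; first by rewrite addr0.
  by rewrite [RHS](shift _ _ _ _ ew) mulrSr addrA addrK.
have [hla|nla] := boolP (has (fun l => la l != 0) w).
  have [w1 [l [w2 [ew l0]]]] := has_split hla.
  have [z0|/(_ mu) [k0 k0P]] := gm_string (lP l) l0.
    apply: wtr_opw_nil => // v _; exists 1%N; rewrite /= ew opw_cat /= op1E z0.
    exact: lin0 (opw_lin a w1).
  rewrite (shift_k _ _ _ mu k0 ew); apply: (wtr_eq0 (gm_V_lin S)) => v; exact: k0P.
have la0 w1 l w2 : w = w1 ++ l :: w2 -> la l = 0.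
  by move=> ew; move: nla; rewrite ew has_cat /= !negb_or negbK => /and3P [_ /eqP].
(* If all letters have weight and degree 0, the operators commute, and one nilpotent letter of
   positive exponent makes the product nilpotent. *)
have [hlm|nlm] := boolP (has (fun l => lm l != 0) w); last first.
  have /has_split [w1 [l [w2 [ew lj0]]]] : has (fun l => 0 < lj l)%N w.
    rewrite has_count; move: jw0; apply: contraTT; rewrite -!leqNgt !leqn0 => /eqP cw.
    apply/eqP/jw_npos0; rewrite -cw /npos; elim: (w) => [|x s IHs]; rewrite ?big_nil //.
    by rewrite big_cons IHs.
  have lm0 w1' l' w2' : w = w1' ++ l' :: w2' -> lm l' = 0.
    by move=> ew'; move: nlm; rewrite ew' has_cat /= !negb_or negbK => /and3P [_ /eqP].
  have G1 := Gw; rewrite ew in G1.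
  have [e1 [G2 _ _]] := move_front (phi := fun x => wtr mu (opw x)) (swap mu) G1.
  rewrite ew e1; apply: wtr_opw_nil => // v _.
  have [q eq] := op1_nil a_nil v (la0 _ _ _ ew) (lm0 _ _ _ ew) lj0; exists q.
  have com x : opw (w1 ++ w2) (op1 l x) = op1 l (opw (w1 ++ w2) x).
    have : allw (fun l' => hl 0 0 (lz l')) (w1 ++ w2).
      have : allw (fun l' => hl 0 0 (lz l')) w.
        by apply: allw_split => w1' l' w2' ew'; apply: hl0_letter; [exact: la0 ew'|exact: lm0 ew'].
      by rewrite ew => /allw_cat [aw1 [_ aw2]]; apply/allw_cat.
    elim: (w1 ++ w2) => //= l' w' IHw' [hl' /IHw' ->]; apply: gm_hl0_comm => //.
    by apply: hl0_letter; [exact: la0 ew|exact: lm0 ew].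
  have -> : iter q (opw (l :: w1 ++ w2)) v = iter q (fun x => opw (w1 ++ w2) (op1 l x)) v.
    by apply: eq_iter => x /=; rewrite com.
  by rewrite iter_comp_comm ?eq ?(lin0 (iter_lin q (opw_lin a _))) // => y; rewrite com.
(* The group of degrees along which the trace is invariant; it contains the degree of every
   letter. *)
pose G g := forall m, wtr m (opw w) = wtr (m + dl g) (opw w).
have G0 : G 0 by move=> m; rewrite dl0 addr0.
have GD g h : G g -> G h -> G (g + h) by move=> Gg Gh m; rewrite (Gg m) (Gh (m + dl g)) gm_dlD addrA.
have GN g : G g -> G (- g) by move=> Gg m; rewrite [RHS]Gg dlN subrK.
have Gl w1 l w2 : w = w1 ++ l :: w2 -> G (lm l).
  move=> ew m; rewrite (shift_k _ _ _ _ 1%N ew) mulr1n.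
  by rewrite /lw (la0 _ _ _ ew) add0r.
have [w1 [l [w2 [ew l0]]]] := has_split hlm.
have [D bD] := bounded_region gsP mu nM1 Vn0 G0 GD GN.
(* The K-th power of the word has total exponent at least K; the radius leaves room for its degrees
   and for the auxiliary degree [m0] of [letter_high]. *)
pose K := Kbound D; have [g Gg gP] := bD (K * nw w + nrm (lm l))%N.
rewrite (Gg mu); apply: wtr_opw_nil => // v mv; exists K; rewrite iter_opw.
have reg t : G t -> (nrm t <= K * nw w + nrm (lm l))%N ->
    forall i, (wdim (mu + dl g + dl t + al i)%R <= D)%N.
  by move=> Gt tR i; rewrite -[mu + _ + _]addrA -gm_dlD; apply: gP.
have jwK q : jw (flatten (nseq q w)) = (q * jw w)%N.
  by elim: q => [|q IHq] /=; rewrite ?mul0n ?wE ?IHq ?mulSn // /jw big_nil.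
have nwK q : nw (flatten (nseq q w)) = (q * nw w)%N.
  by elim: q => [|q IHq] /=; rewrite ?mul0n ?wE ?IHq ?mulSn // /nw big_nil.
apply: (words_vanish a_nil G0 GD GN (Gl _ _ _ ew) l0 reg (leqnn _) _ (t := 0)) => //.
- by rewrite jwK -/K leq_pmulr.
- elim: K {gP mv reg} => //= K IHK; apply/allw_cat; split=> //.
  by apply: allw_split => w1' l' w2' ew'; split; [exact: la0 ew'|exact: Gl ew'].
- by rewrite nrm0 add0n nwK.
by rewrite dl0 addr0.
Qed.
(** A nonunital matrix algebra: closure under products turns the vanishing of traces of words into
    that of the traces of all powers. *)
Inductive word_mx mu : 'M[C]_(wdim mu) -> Prop :=
| WordMx0 : word_mx 0
| WordMxLin c M N : word_mx M -> word_mx N -> word_mx (c *: M + N)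
| WordMxOp w : ww w = 0 -> (0 < jw w)%N -> word_mx (wmx (gm_V_fin S) mu mu (opw w)).

Lemma word_mx_mul mu (M N : 'M[C]_(wdim mu)) : word_mx M -> word_mx N -> word_mx (M *m N).
Proof.
elim=> [|c M1 M2 _ IH1 _ IH2|w w0 jw0 hN].
- by rewrite mul0mx => _; exact: WordMx0.
- move=> hN; rewrite mulmxDl -scalemxAl; apply: WordMxLin; [exact: IH1|exact: IH2].
elim: hN => [|c N1 N2 _ IH1 _ IH2|w' w0' jw0'].
- by rewrite mulmx0; exact: WordMx0.
- by rewrite mulmxDr -scalemxAr; apply: WordMxLin.
rewrite -(wmx_comp (gm_V_lin S) _ (opw_lin a w) (opw_maps a (mu := mu) w0) (opw_lin a w') (opw_maps a w0')).
rewrite (eq_wmx (gm_V_lin S) _ mu (G := opw (w' ++ w))) => [|v _]; last by rewrite opw_cat.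
apply: WordMxOp; first by move: w0 w0'; rewrite /ww big_cat /= => -> ->; rewrite addr0.
by rewrite jw_cat addn_gt0 jw0'.
Qed.

Lemma word_mx_trace mu (M : 'M[C]_(wdim mu)) : word_mx M -> \tr M = 0.
Proof.
elim=> [|c M1 M2 _ IH1 _ IH2|w w0 jw0]; first exact: mxtrace0.
  by rewrite mxtraceD mxtraceZ IH1 IH2 mulr0 addr0.
exact: words_trace.
Qed.

Lemma word_mx_exp mu (M : 'M[C]_(wdim mu)) k : word_mx M -> word_mx (M ^+ k.+1).
Proof.
move=> hM; elim: k => [|k IHk]; first by rewrite expr1.
by rewrite exprS; apply: word_mx_mul.
Qed.

(** If all [d_i (x) ac] acted by zero, commutators with them would kill [tau (x) aB] in nonzero
    degrees, and brackets of opposite degrees would then kill degree 0. *)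
Lemma d_act_neq0 : ~ ann S a ->
  exists i c mu v, Vw mu v /\ act (d i) (a * c) v != 0.
Proof.
move=> nMa; apply: contrapT => H; apply: nMa.
have d0 i c v : act (d i) (a * c) v = 0.
  apply: (wind (gm_V_sum S) (P := fun v => act (d i) (a * c) v = 0)) => [|mu x mx].
    by split=> [|k x y ex ey]; rewrite ?act_v0 // gm_actV ex ey scaler0 addr0.
  by apply/eqP/negPn/negP => nz; apply: H; exists i, c, mu, x.
have nz k m c v : m != 0 -> act (u k m) (a * c) v = 0.
  move=> m0; have [i mi] : exists i, m i != 0.
    apply/existsP; apply: contraNT m0; rewrite negb_exists => /forallP m0.
    by apply/eqP/ffunP => i; rewrite ffunE; apply/eqP; have := m0 i; rewrite negbK.
  have := act_d_swap i (a * c) 1 v (gm_hl_u k m); rewrite !d0 act_v0 add0r mulr1.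
  by move=> /esym/eqP; rewrite scaler_eq0 intr_eq0 (negPf mi) => /eqP.
apply: ann_hom => k m c v; have [->|] := eqVneq m 0; last exact: nz.
have e00 : unitd (ord0 : 'I_nu.+1) != 0 :> degree nu by rewrite -nrm_eq0 nrm_unitd.
rewrite -[0](addrN (unitd ord0)); apply: (gm_br_span (act_lc S (a * c) v)).
- by rewrite -subr_eq0 opprK -mulr2n -nrm_eq0 nrmMn nrm_unitd.
- by rewrite oppr_eq0.
move=> i j; rewrite -[a * c]mulr1 gm_act_br (nz _ _ c (act _ _ _)) // (nz _ _ c v) //.
by rewrite act_v0 subr0.
Qed.

Definition reach x y := exists s : seq (C * seq letter), y = \sum_(p <- s) p.1 *: opw p.2 x.

Lemma reach_sum x (s : seq (C * seq letter)) : reach x (\sum_(p <- s) p.1 *: opw p.2 x).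
Proof. by exists s. Qed.

Lemma reach_all x v : x != 0 -> reach x v.
Proof.
move=> x0; have rl : lin_closed (reach x).
  split; first by have := reach_sum x [::]; rewrite big_nil.
  move=> c _ _ [s ->] [s' ->].
  have -> : c *: \sum_(p <- s) p.1 *: opw p.2 x + \sum_(p <- s') p.1 *: opw p.2 x =
      \sum_(p <- [seq (c * p.1, p.2) | p <- s] ++ s') p.1 *: opw p.2 x.
    rewrite big_cat big_map scaler_sumr; congr (_ + _).
    by apply: eq_bigr => p _; rewrite scalerA.
  exact: reach_sum.
apply: (gm_irr (g := S) rl) => [z b y ry|]; last first.
  exists x => //; have := reach_sum x [:: (1, [::])].
  by rewrite big_seq1 scale1r.
move: z; apply: (T_ind (S := S)).
  split=> [|c z z' rz rz']; first by rewrite act0b; case: rl.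
  by rewrite gm_actT; apply: (proj2 rl).
move=> k m; have [s es] := ry; rewrite es (lin_sum (gm_actV S _ _)).
apply: lc_sum => // -[c w] _; rewrite (linZ (gm_actV S _ _)); apply: lcZ => //=.
have := reach_sum x [:: (1, Letter b 0 (gm_hl_u k m) :: w)].
by rewrite big_seq1 scale1r /= op1E /= expr0 mul1r.
Qed.

Theorem nil_ann : ann S a.
Proof.
apply: contrapT => /d_act_neq0 [i [c [mu [v [mv]]]]]; set x := act _ _ _ => x0.
have mx : Vw mu x by apply: hl0_V => //; apply: gm_hl_d.
(* Words carrying x back to v may contain no a; appending [Z], which produces x from v, supplies the
   factor and gives a combination fixing v. *)
pose Z := Letter c 1 (gm_hl_d S i).
have wZ w : ww (w ++ [:: Z]) = ww w.
  by rewrite /ww big_cat big_seq1 /= /lw /= dl0 !addr0.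
have xZ w : opw (w ++ [:: Z]) v = opw w x by rewrite opw_cat /= op1E /= expr1.
have [s es] := reach_all v x0.
have {es} := wsum_proj (gm_V_lin S) (gm_V_sum S) (f := fun p => mu + ww p.2) _ mv es.
move=> /(_ (fun p => lcZ (gm_V_lin S _) p.1 (opw_V a p.2 mx))) ev.
have v0 : v = 0; last by move: x0; rewrite /x v0 act_v0 eqxx.
pose A := \sum_(p <- s | ww p.2 == 0) p.1 *: wmx (gm_V_fin S) mu mu (opw (p.2 ++ [:: Z])).
have wA : word_mx A.
  rewrite /A; elim/big_rec: _ => [|p M /eqP p0 wM]; first exact: WordMx0.
  apply: WordMxLin => //; apply: WordMxOp; rewrite ?wZ // jw_cat addn_gt0.
  by rewrite orbC /jw big_seq1.
suff : wco (gm_V_fin S) mu v = 0.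
  by move=> e; rewrite -(wcoK (gm_V_fin S) mv) e; rewrite /wfr big1 // => j _; rewrite mxE scale0r.
apply: (trace_exp_eq0 (A := A)) => [k|]; first exact: word_mx_trace (word_mx_exp k wA).
have {}ev : v = \sum_(p <- s | ww p.2 == 0) p.1 *: opw p.2 x.
  rewrite {1}ev; apply: eq_bigl => p.
  by rewrite -[X in _ == X](addr0 mu) (inj_eq (addrI mu)).
rewrite [in RHS]ev /A; elim: (s) => [|p r IHr].
  by rewrite !big_nil mulmx0 (wco0 (gm_V_lin S)).
rewrite !big_cons; case: eqP => // p0.
have rx : Vw mu (\sum_(p <- r | ww p.2 == 0) p.1 *: opw p.2 x).
  apply: lc_sum => [|q /eqP e]; first exact: gm_V_lin.
  apply: lcZ; first exact: gm_V_lin.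
  by rewrite -[mu]addr0 -e; apply: opw_V.
rewrite mulmxDr IHr (wco_lin (gm_V_lin S)) //; last by rewrite -[mu]addr0 -p0; apply: opw_V.
congr (_ + _); rewrite -scalemxAr; congr (_ *: _).
by rewrite -(wco_wmx (gm_V_lin S) _ (opw_lin a _) (opw_maps a _) mv) ?wZ // xZ.
Qed.

End Traces.

(** * The annihilator of V in B *)

Section PolynomialRelation.
Variables (C : numClosedFieldType) (nu : nat) (T V : lmodType C).
Variables (B : comAlgType C) (Wt : zmodType).
Variable S : graded_module nu T V B Wt.

Local Notation br := (gm_br S).
Local Notation act := (gm_act S).
Local Notation Vw := (gm_V S).
Local Notation hl := (gm_hl S).
Local Notation u := (@gm_u _ _ _ _ _ _ S).
Local Notation al := (@gm_al _ _ _ _ _ _ S).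
Local Notation d := (gm_d S).
Local Notation rk := (gm_rk S).
Local Notation wdim := (wdim (gm_V_fin S)).
Local Notation wmx := (wmx (gm_V_fin S)).

(** The operators [z (x) b^j] between two fixed weight spaces lie in a space of dimension D, so the
    first D + 1 of them are dependent. *)
Lemma poly_kill z l l' b : (forall c, wmaps Vw l l' (act z c)) ->
  exists2 q : {poly C}, q != 0 & forall x, Vw l x -> act z (horner_alg b q) x = 0.
Proof.
move=> zm; pose D := (wdim l * wdim l')%N.
pose W j := wmx l l' (act z (b ^+ j)).
pose M : 'M[C]_(D.+1, D) := \matrix_(j < D.+1) mxvec (W j).
have /rowV0Pn [x /sub_kermxP xM x0] : kermx M != 0.
  by rewrite -mxrank_eq0 mxrank_ker -lt0n subn_gt0 ltnS rank_leq_col.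
exists (\poly_(j < D.+1) x 0 (inord j)) => [|v lv].
  apply: contra x0 => /eqP q0; apply/eqP/rowP => j; rewrite mxE.
  by have := congr1 (fun q : {poly C} => q`_j) q0; rewrite coef_poly coef0 ltn_ord inord_val.
have W0 : \sum_(j < D.+1) x 0 j *: W j = 0.
  apply: (can_inj mxvecK); rewrite [RHS]linear0 -xM mulmx_sum_row linear_sum.
  by apply: eq_bigr => j _; rewrite linearZ rowK.
rewrite poly_def linear_sum (lin_sum (gm_actB S z v)).
transitivity (wfr (wco (gm_V_fin S) l v *m \sum_(j < D.+1) x 0 j *: W j)); last first.
  by rewrite W0 mulmx0 /wfr big1 // => j _; rewrite mxE scale0r.
rewrite mulmx_sumr (lin_sum (@wfr_lin _ _ _ _ (gm_V_fin S) l')); apply: eq_bigr => j _.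
rewrite inord_val linearZ /= mulr_algl (linZ (gm_actB S z v)) rmorphXn /= horner_algX.
rewrite -scalemxAr (linZ (@wfr_lin _ _ _ _ (gm_V_fin S) l')); congr (_ *: _).
by apply: (wmxE (gm_V_lin S)) => //; apply: gm_actV.
Qed.

(** In nonzero degree the commutator with a suitable [d_i (x) c] multiplies the coefficient by c,
    and [d_i (x) c] preserves the weight space; so one polynomial serves all c. *)
Lemma poly_kill_deg l b m : m != 0 ->
  exists2 q : {poly C}, q != 0 & forall x c, Vw l x -> kill S x m (horner_alg b q * c).
Proof.
move=> m0; have [i mi] : exists i, m i != 0.
  apply/existsP; apply: contraNT m0; rewrite negb_exists => /forallP m0.
  by apply/eqP/ffunP => i; rewrite ffunE; apply/eqP; have := m0 i; rewrite negbK.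
have H k : exists q : {poly C}, q != 0 /\ forall x c, Vw l x -> act (u k m) (horner_alg b q * c) x = 0.
  have [q q0 qk] := @poly_kill (u k m) l _ b (fun c x => gm_hl_V c (gm_hl_u k m) (v := x)).
  exists q; split=> // x c lx.
  have := act_d_swap i c (horner_alg b q) x (gm_hl_u k m).
  rewrite (qk x) // (qk (act (d i) c x)) ?act_v0; last exact: hl0_V (gm_hl_d S i) lx.
  move=> /esym/eqP; rewrite add0r scaler_eq0 intr_eq0 (negPf mi) mulrC.
  by move=> /eqP.
have [f fP] := choice H.
exists (\prod_k f k); first by apply/prodf_neq0 => k _; have [] := fP k.
move=> x c lx k; rewrite (bigD1 k) //= rmorphM -mulrA.
by have [_] := fP k; apply.
Qed.

Lemma poly_kill_ball l b : exists2 q : {poly C}, q != 0 &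
  forall x m c, Vw l x -> m != 0 -> (nrm m <= 2)%N -> kill S x m (horner_alg b q * c).
Proof.
have H (m : degree nu) : exists q : {poly C}, q != 0 /\
    forall x c, m != 0 -> Vw l x -> kill S x m (horner_alg b q * c).
  have [->|m0] := eqVneq m 0; first by exists 1; rewrite oner_neq0; split=> // x c /eqP.
  by have [q q0 qP] := poly_kill_deg l b m0; exists q; split=> // x c _; apply: qP.
have [f fP] := choice H; exists (\prod_(m <- ball nu 2) f m).
  by rewrite prodf_seq_neq0; apply/allP => m _; have [] := fP m.
move=> x m c lx m0 m2; rewrite (big_rem m (mem_ball m2)) /= rmorphM -mulrA.
by have [_] := fP m; apply.
Qed.

Definition tors p v := forall z, exists N, forall c, act z (p ^+ N * c) v = 0.

Lemma tors_mono p z v N M : (N <= M)%N ->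
  (forall c, act z (p ^+ N * c) v = 0) -> forall c, act z (p ^+ M * c) v = 0.
Proof. by move=> NM H c; rewrite -(subnKC NM) exprD -mulrA. Qed.

Lemma tors_lin p : lin_closed (tors p).
Proof.
split=> [z|k v w Pv Pw z]; first by exists 0%N => c; apply: act_v0.
have [N NP] := Pv z; have [M MP] := Pw z; exists (maxn N M) => c.
rewrite gm_actV (tors_mono (leq_maxl N M) NP) (tors_mono (leq_maxr N M) MP).
by rewrite scaler0 addr0.
Qed.

Lemma tors_all p (v : V) : v != 0 -> tors p v -> forall w, tors p w.
Proof.
move=> v0 Pv; apply: (gm_irr (g := S) (tors_lin p)) => [x b w Pw z|]; last by exists v.
have [N NP] := Pw z; have [M MP] := Pw (br z x); exists (maxn N M) => c.
rewrite act_swap (tors_mono (leq_maxl N M) NP) act_v0 add0r -mulrA.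
exact: (tors_mono (leq_maxr N M) MP).
Qed.

(** A degree of norm at least 3 splits into one of smaller norm and a unit step, which are then
    distinct; degree 0 comes from brackets of opposite units. *)
Lemma tors_gen p v : (forall m c, m != 0 -> (nrm m <= 2)%N -> kill S v m (p * c)) -> tors p v.
Proof.
move=> H; pose K m := exists N, forall c, kill S v m (p ^+ N * c).
have Kb m : m != 0 -> (nrm m <= 2)%N -> K m by move=> m0 m2; exists 1%N => c; apply: H.
have Kadd m n : m != n -> n != 0 -> K m -> K n -> K (m + n).
  move=> mn n0 [N NP] [M MP]; exists (N + M)%N => c.
  by rewrite exprD -mulrA -[p ^+ N]mulr1 -mulrA mul1r -[p ^+ N]mulr1; apply: kill_add.
have Kall m : K m.
  have [->|m0] := eqVneq m 0.
    have e0 : unitd (ord0 : 'I_nu.+1) != 0 :> degree nu by rewrite -nrm_eq0 nrm_unitd.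
    rewrite -[0](addrN (unitd ord0)); apply: Kadd; rewrite ?oppr_eq0 //.
    - by rewrite -subr_eq0 opprK -mulr2n -nrm_eq0 nrmMn nrm_unitd.
    - by apply: Kb; rewrite ?nrm_unitd.
    - by apply: Kb; rewrite ?oppr_eq0 ?nrmN ?nrm_unitd.
  have [n] := ubnP (nrm m); elim: n m m0 => // n IHn m m0; rewrite ltnS => mn.
  have [m2|m3] := leqP (nrm m) 2; first exact: Kb.
  have [w ws e] := step_down m0; have w1 := nrm_steps ws.
  rewrite -(subrK w m).
  have w0 : w != 0 by apply/eqP => w0; move: e; rewrite w0 subr0; lia.
  have mw : (1 < nrm (m - w))%N by lia.
  apply: Kadd => //.
  - by apply: contraTneq mw => ->; lia.
  - by apply: IHn; rewrite -?e // -nrm_eq0 -lt0n ltnW.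
  by apply: Kb => //; lia.
move=> z; apply: (T_ind (S := S) (P := fun z => exists N, forall c, act z (p ^+ N * c) v = 0)).
  split=> [|k x y [N NP] [M MP]]; first by exists 0%N => c; apply: act0b.
  exists (maxn N M) => c; rewrite gm_actT (tors_mono (leq_maxl N M) NP).
  by rewrite (tors_mono (leq_maxr N M) MP) scaler0 addr0.
by move=> k m; have [N NP] := Kall m; exists N => c; apply: NP.
Qed.

Lemma tors_deg p v m : tors p v -> exists N, forall c, kill S v m (p ^+ N * c).
Proof.
move=> pv; have H k : exists N, forall c, act (u k m) (p ^+ N * c) v = 0 by apply: pv.
have [f fP] := choice H; exists (\max_k f k) => c k.
by apply: tors_mono (fP k) c; apply: leq_bigmax.
Qed.

(* (ad h (x) a)^j maps x (x) c to (ad h)^j x (x) a^j c, which by torsion kills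
   any given vector for large j. *)
Lemma tors_nil p (v0 : V) : v0 != 0 -> (forall v, tors p v) ->
  exists N, forall z c v, hl 0 0 z -> exists q, iter q (act z (p ^+ N * c)) v = 0.
Proof.
(* One factor p more than needed to kill [v0]: every commutator with Z has to gain a factor p, even
   when N = 0. *)
move=> v00 pV; have [N NP] := tors_deg 0 (pV v0); exists N.+1 => h c v hh.
have h1 : forall c, act h (p ^+ N.+1 * c) v0 = 0.
  by move=> c'; rewrite exprS -mulrA mulrCA; apply: kill_deg hh.
set Z := act h (p ^+ N.+1 * c); have Zl : linear Z by exact: gm_actV.
move: v; apply: (gm_irr (g := S) (W := fun v => exists q, iter q Z v = 0)); last first.
- by exists v0 => //; exists 1%N; apply: h1.
- move=> z b v [q0 qv]; move: z.
  apply: (T_ind (S := S) (P := fun z => exists q, iter q Z (act z b v) = 0)).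
    split=> [|k x y [q qP] [r rP]].
      by exists 0%N; apply: act0b.
    exists (maxn q r); rewrite gm_actT (iter_lin _ Zl).
    rewrite (iter0_mono Zl (leq_maxl q r) qP) (iter0_mono Zl (leq_maxr q r) rP).
    by rewrite scaler0 addr0.
  move=> k m.
  have [M MP] : exists M, forall i, (i < q0)%N -> forall c, kill S (iter i Z v) m (p ^+ M * c).
    have H i : exists M, forall c, kill S (iter i Z v) m (p ^+ M * c) by exact: tors_deg.
    have [f fP] := choice H; exists (\max_(i < q0) f i) => i iq c' k'.
    by apply: tors_mono (fun c => fP i c k') c'; apply: (leq_bigmax (Ordinal iq)).
  exists (q0 + M)%N.
  (* Each application of Z either passes on to the vector or raises the exponent of p, so
     [n + i + j] does not drop. At n = 0 either [iter i Z v = 0] or j reaches the torsion exponent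
     M. *)
  have step : forall n i j y c', hl (al k) m y -> (q0 + M <= n + i + j)%N ->
      iter n Z (act y (p ^+ j * c') (iter i Z v)) = 0.
    elim=> [|n IHn] i j y c' hy nij.
      have [qi|iq] := leqP q0 i; first by rewrite (iter0_mono Zl qi qv) /= act_v0.
      apply: (tors_mono (N := M)); first lia.
      by move=> c''; apply: kill_deg (MP i iq c'') hy.
    rewrite iterSr /Z act_swap -/Z (linD (iter_lin n Zl)) -iterS IHn //; last lia.
    rewrite add0r (_ : _ * _ = p ^+ j.+1 * (p ^+ N * c * c')).
      by apply: IHn; [rewrite -[m]add0r -[al k]add0r; apply: gm_hl_br|lia].
    by rewrite !exprS !mulrA; congr (_ * c'); rewrite [LHS]mulrAC; congr (_ * c); rewrite mulrAC.
  by have := step (q0 + M)%N 0%N 0%N (u k m) b (gm_hl_u k m); rewrite expr0 mul1r; apply; lia.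
split=> [|k x y [q qP] [r rP]]; first by exists 0%N.
exists (maxn q r); rewrite (iter_lin _ Zl).
rewrite (iter0_mono Zl (leq_maxl q r) qP) (iter0_mono Zl (leq_maxr q r) rP).
by rewrite scaler0 addr0.
Qed.

Variable gs : seq B.
Hypothesis gsP : forall P : {pred B}, subalg_closed P -> {subset gs <= P} -> P =i predT.
Hypothesis Vn0 : exists v : V, v != 0.
Hypothesis nM1 : ~ ann S 1.

Theorem poly_ann b : exists2 q : {poly C}, q != 0 & ann S (horner_alg b q).
Proof.
have [v [l [lv v0]]] : exists v l, Vw l v /\ v != 0.
  apply: contrapT => H; have [v v0] := Vn0; move/eqP: v0; apply; move: v.
  apply: (wind (gm_V_sum S)) => [|l v lv].
    by split=> // k x y -> ->; rewrite scaler0 addr0.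
  by apply/eqP/negPn/negP => v0; apply: H; exists v, l.
have [q q0 qP] := poly_kill_ball l b.
have tv : tors (horner_alg b q) v by apply: tors_gen => m c m0 m2; apply: qP.
have [N NP] := tors_nil v0 (tors_all v0 tv).
exists (q ^+ N); first by rewrite expf_neq0.
by rewrite rmorphXn; apply: (nil_ann gsP Vn0 nM1).
Qed.

End PolynomialRelation.

(** * Algebras that are algebraic modulo an ideal *)

Section Ideals.
Variables (C : numClosedFieldType) (B : comAlgType C) (M : B -> Prop).
Hypothesis M_lin : lin_closed M.
Hypothesis M_mul : forall b c, M b -> M (b * c).
Hypothesis nM1 : ~ M 1.

Local Notation "p @ b" := (horner_alg b p) (at level 10).

Lemma ideal_poly_mul (p q : {poly C}) b : M (p @ b) -> M ((p * q) @ b).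
Proof. by rewrite rmorphM; apply: M_mul. Qed.

Lemma ideal_poly_dvd (p q : {poly C}) b : p %| q -> M (p @ b) -> M (q @ b).
Proof. by move=> /dvdpP [r ->] Mp; rewrite mulrC; apply: ideal_poly_mul. Qed.

(** Let q be a minimal polynomial modulo M of some b outside C + M, and t a root. If q is a multiple
    of a power [(X - t)^k] by a constant, then k is at least 2 and [(X - t)^(k-1)] has square zero.
    Otherwise the Chinese remainder idempotent of the two coprime factors is nontrivial by
    minimality. *)
Lemma ideal_dichotomy :
  (forall b, exists2 q : {poly C}, q != 0 & M (q @ b)) ->
  [\/ forall b, exists t : C, M (b - t%:A),
      exists e, [/\ M (e * e - e), ~ M e & ~ M (1 - e)] |
      exists a, ~ M a /\ M (a * a)].
Proof.
move=> Mq; have [//|H] := pselect (forall b, exists t : C, M (b - t%:A)); first by constructor 1.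
have {H} [b nb] : exists b, ~ exists t : C, M (b - t%:A).
  by apply: contrapT => H'; apply: H => b; apply: contrapT => nb; apply: H'; exists b.
pose P n := `[< exists q : {poly C}, [/\ q != 0, M (q @ b) & size q = n] >].
have exP : exists n, P n by have [q q0 qM] := Mq b; exists (size q); apply/asboolP; exists q.
have [n /asboolP [q [q0 qM sq]] nmin] := ex_minnP exP.
have qmin (p : {poly C}) : p != 0 -> (size p < size q)%N -> ~ M (p @ b).
  move=> p0 pq pM; have : P (size p) by apply/asboolP; exists p.
  by move=> /nmin; rewrite -sq leqNgt pq.
have [sq1|sq1] := leqP (size q) 1.
  have : size q == 1%N by rewrite eqn_leq sq1 lt0n size_poly_eq0.
  move=> /size_poly1P [c c0 qc]; case: nM1; move: qM; rewrite qc horner_algC.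
  exact: lc_cancel.
have [t rt] : exists t, root q t by apply/closed_rootP; rewrite neq_ltn sq1 orbT.
have [k [r]] := multiplicity_XsubC q t; rewrite q0 /= => nrt qE.
have r0 : r != 0 by apply: contraNneq nrt => ->; rewrite root0.
have k0 : (0 < k)%N by case: k qE => // qE; move: nrt rt; rewrite qE mulr1 => /negPf ->.
have Xk0 : ('X - t%:P) ^+ k != 0 by rewrite expf_neq0 // polyXsubC_eq0.
have szq : size q = (size r + k)%N.
  by rewrite qE size_Mmonic ?monic_exp ?monicXsubC // size_exp_XsubC addnS.
have [r1|r1] := leqP (size r) 1.
  have : size r == 1%N by rewrite eqn_leq r1 lt0n size_poly_eq0.
  move=> /size_poly1P [c c0 rc].
  have XkM : M ((('X - t%:P) ^+ k) @ b).
    by apply: (lc_cancel M_lin c0); move: qM; rewrite qE rc mul_polyC linearZ /= mulr_algl.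
  have [k1|k1] := leqP k 1.
    have k_1 : k = 1%N by lia.
    case: nb; exists t; move: XkM; rewrite k_1 expr1 rmorphB /= horner_algX horner_algC //.
  constructor 3; exists ((('X - t%:P) ^+ k.-1) @ b); split.
    apply: qmin; first by rewrite expf_neq0 // polyXsubC_eq0.
    by rewrite szq rc size_polyC c0 size_exp_XsubC; lia.
  rewrite -rmorphM -exprD; apply: ideal_poly_dvd XkM.
  by apply: dvdp_exp2l; lia.
constructor 2.
have cop : coprimep (('X - t%:P) ^+ k) r by rewrite coprimep_expl // coprimep_sym coprimep_XsubC.
(* Bezout gives 1 only up to a nonzero constant, absorbed by [c1 / c2]. *)
have [[x y] /= /eqpP [[c1 c2] /= /andP [c10 c20] xy]] := Bezout_coprimepP _ _ cop.
pose x' := (c1 / c2) *: x; pose y' := (c1 / c2) *: y.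
have bez : x' * ('X - t%:P) ^+ k + y' * r = 1.
  rewrite /x' /y' -!scalerAl -scalerDr; apply: (scalerI c20).
  by rewrite scalerA mulrCA divff // mulr1 xy alg_polyC.
have e1 : 1 - (y' * r) @ b = (x' * ('X - t%:P) ^+ k) @ b.
  by rewrite -(rmorph1 (horner_alg b)) -bez rmorphD addrK.
exists ((y' * r) @ b); split.
- rewrite -[X in _ - X]mulr1 -mulrBr -opprB mulrN e1; apply: lcN => //.
  rewrite -rmorphM; apply: ideal_poly_dvd qM.
  by rewrite qE mulrACA dvdp_mull // mulrC.
- move=> Me; apply: (qmin r r0); first by rewrite szq -[X in (X < _)%N]addn0 ltn_add2l.
  rewrite -[r]mulr1 -bez mulrDr rmorphD; apply: lcD => //.
    by apply: ideal_poly_dvd qM; rewrite qE mulrCA dvdp_mull.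
  by apply: ideal_poly_dvd Me; rewrite dvdp_mull.
move=> Me; apply: (qmin _ Xk0); first by rewrite szq size_exp_XsubC -[k.+1]add1n ltn_add2r.
rewrite -[_ ^+ k]mulr1 -bez mulrDr rmorphD; apply: lcD => //.
  by rewrite e1 in Me; apply: ideal_poly_dvd Me; rewrite dvdp_mull.
by apply: ideal_poly_dvd qM; rewrite qE mulrCA mulrC dvdp_mull // mulrC.
Qed.

(** M contains no nonzero scalar, so t is determined by b, and uniqueness makes it linear and
    multiplicative. *)
Lemma ideal_point : (forall b, exists t : C, M (b - t%:A)) ->
  exists psi : {lrmorphism B -> C^o}, forall b, M (b - (psi b : C)%:A).
Proof.
move=> H; have [f fP] := choice H.
have funiq b t : M (b - t%:A) -> f b = t.
  move=> Mt; apply/eqP; rewrite -subr_eq0; apply/eqP/eqP/negPn/negP => ft; apply: nM1.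
  apply: (lc_cancel M_lin ft); rewrite scalerBl.
  have -> : (f b)%:A - t%:A = (b - t%:A) - (b - (f b)%:A) :> B by rewrite opprB [RHS]addrC addrA subrK.
  exact: lcB.
have flin : linear (f : B -> C^o).
  move=> k b c; apply: funiq.
  have -> : k *: b + c - (k *: (f b : C^o) + f c)%:A = k *: (b - (f b)%:A) + (c - (f c)%:A).
    by rewrite scalerDl scalerBr -scalerA addrACA opprD.
  by apply: (proj2 M_lin).
have fmul : monoid_morphism (f : B -> C^o).
  split=> [|b c]; apply: funiq; first by rewrite scale1r subrr; case: M_lin.
  have -> : b * c - (f b * f c)%:A = (b - (f b)%:A) * c + (c - (f c)%:A) * (f b)%:A.
    rewrite !mulrBl !mulr_algl mulr_algr !scalerA addrA subrK.
    by rewrite [f b * f c]mulrC.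
  by apply: lcD => //; apply: M_mul.
pose F1 := GRing.isLinear.Build C B (C^o) *:%R (f : B -> C^o) flin.
pose F2 := GRing.isMonoidMorphism.Build B (C^o) (f : B -> C^o) fmul.
pose psi : {lrmorphism B -> C^o} := HB.pack (f : B -> C^o) F1 F2.
by exists psi.
Qed.

End Ideals.

Lemma int_seq_bound (C : numDomainType) (F : seq C) :
  exists K, forall n : int, n%:~R \in F -> (`|n| <= K)%N.
Proof.
elim: F => [|x F [K KP]]; first by exists 0%N.
have [[n nx]|nx] := pselect (exists n : int, n%:~R = x).
  exists (maxn K `|n|) => m; rewrite inE -nx eqr_int => /orP [/eqP ->|/KP mK].
    exact: leq_maxr.
  exact: leq_trans mK (leq_maxl _ _).
exists K => m; rewrite inE => /orP [/eqP mx|]; last exact: KP.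
by case: nx; exists m.
Qed.

(** * Nontrivial idempotents modulo M *)

Section Idempotent.
Variables (C : numClosedFieldType) (nu : nat) (T V : lmodType C).
Variables (B : comAlgType C) (Wt : zmodType).
Variable S : graded_module nu T V B Wt.

Local Notation act := (gm_act S).
Local Notation Vw := (gm_V S).
Local Notation dl := (gm_dl S).
Local Notation al := (@gm_al _ _ _ _ _ _ S).
Local Notation d := (gm_d S).
Local Notation rk := (gm_rk S).

Lemma exists_weight_vector : (exists v : V, v != 0) -> exists l v, Vw l v /\ v != 0.
Proof.
move=> [v v0]; apply: contrapT => H; move/eqP: v0; apply; move: v.
apply: (wind (gm_V_sum S)) => [|l v lv].
  by split=> // k x y -> ->; rewrite scaler0 addr0.
by apply/eqP/negPn/negP => v0; apply: H; exists l, v.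
Qed.

Lemma eigen_values_finite (F : V -> V) (s : seq Wt) : linear F ->
  (forall l, wmaps Vw l l F) -> exists r : seq C,
  forall l c v, l \in s -> Vw l v -> v != 0 -> F v = c *: v -> c \in r.
Proof.
move=> Fl Fm; elim: s => [|l s [r rP]]; first by exists [::].
have [r' r'P] := weigen_finite (gm_V_lin S) (gm_V_fin S) Fl (Fm l).
exists (r' ++ r) => l' c v; rewrite inE mem_cat => /orP [/eqP ->|l's] lv v0 Fv.
  by rewrite (r'P c v).
by rewrite (rP l' c v) ?orbT.
Qed.

Variable gs : seq B.
Hypothesis gsP : forall P : {pred B}, subalg_closed P -> {subset gs <= P} -> P =i predT.
Hypothesis Vn0 : exists v : V, v != 0.
Hypothesis nu_gt0 : (0 < nu)%N.

Lemma act_modulo z b c v : ann S (b - c) -> act z b v = act z c v.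
Proof.
move=> h; apply/eqP; rewrite -subr_eq0 -(linB (gm_actB S z v)); apply/eqP.
exact: ann_act.
Qed.

(** Start from an eigenvector of [d_i (x) e]. An operator from [tau (x) e] of degree about g shifts
    the eigenvalue by about [g i]; one from [tau (x) (1 - e)] of degree about s - g leaves it alone,
    as e (1 - e) lies in M. The resulting nonzero vector lies in one of finitely many weight spaces
    independent of g, so [g i] takes finitely many values. *)
Theorem no_idempotent e : idem S e -> ~ ann S e -> ~ ann S (1 - e) -> False.
Proof.
move=> ide ne ne'.
have ide' : idem S (1 - e).
  rewrite /idem (_ : _ - _ = e * e - e) // mulrBr mulr1 mulrBl mul1r opprB.
  by rewrite addrAC subrr add0r.
apply: (@one_ended nu nu_gt0 (fun g => ~ pos S e g) (fun g => ~ pos S (1 - e) g)).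
- move=> g g0; have [pg|] := pselect (pos S e g); last by left.
  by right; apply: pos_anti.
- move=> g g0; have [pg|] := pselect (pos S (1 - e) g); last by left.
  by right; apply: pos_anti.
move=> s; have [l [v1 [lv1 v10]]] := exists_weight_vector Vn0.
pose Ls := [seq l + al kk.1 + al kk.2 + dl (s + pp.1.1 + pp.2.1) |
  kk <- allpairs pair (enum 'I_rk) (enum 'I_rk), pp <- allpairs pair (box nu gs) (box nu gs)].
have bnd i : exists K, forall g, ~ pos S e g -> ~ pos S (1 - e) (s - g) ->
    (3 <= nrm g)%N -> (3 <= nrm (s - g))%N -> (`|g i| <= K)%N.
  have dm m : wmaps Vw m m (act (d i) e) by move=> x; apply: hl0_V; apply: gm_hl_d.
  have [z [v [lv v0 dv]]] : exists z v, [/\ Vw l v, v != 0 & act (d i) e v = z *: v].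
    have [z [v lv [v0 dv]]] := weigen (gm_V_lin S) (gm_V_fin S) (gm_actV S (d i) e) (dm l) lv1 v10.
    by exists z, v.
  have [r rP] := eigen_values_finite Ls (gm_actV S (d i) e) dm.
  have [K KP] := int_seq_bound (flatten [seq [seq c - z - ((p : degree nu * B).1 i)%:~R | c <- r] | p <- box nu gs]).
  exists K => g pg p'g g3 sg3; apply: KP.
  have [p pb [k w10]] := not_pos_box gsP ide g3 v0 pg.
  set w1 := act _ _ v in w10.
  have [p' p'b [k' w20]] := not_pos_box gsP ide' sg3 w10 p'g.
  set w2 := act _ _ w1 in w20.
  apply/flatten_mapP; exists p => //; apply/mapP.
  exists (z + ((g + p.1) i)%:~R); last by rewrite ffunE intrD [z + _]addrC addrK addrK.
  have e1 : act (d i) e w1 = (z + ((g + p.1) i)%:~R) *: w1.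
    rewrite /w1 (act_d_swap _ _ _ _ (gm_hl_u k _)) dv (linZ (gm_actV S _ _)) scalerDl.
    congr (_ + _ *: _); apply: act_modulo.
    by rewrite mulrA -mulrBl; apply: ann_mul.
  have e2 : act (d i) e w2 = (z + ((g + p.1) i)%:~R) *: w2.
    rewrite /w2 (act_d_swap _ _ _ _ (gm_hl_u k' _)) e1 (linZ (gm_actV S _ _)).
    rewrite [X in _ + _ *: X](_ : _ = 0) ?scaler0 ?addr0 //.
    apply: ann_act; rewrite mulrA; apply: ann_mul; rewrite mulrBr mulr1.
    by rewrite -opprB; apply: (lcN (ann_lin S)); exact: ide.
  apply: (rP (l + al k + al k' + dl (s + p.1 + p'.1)) _ w2 _ _ w20 e2).
    apply/allpairsP; exists ((k, k'), (p, p')); split=> //; apply/allpairsP.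
      by exists (k, k'); rewrite !mem_enum.
    by exists (p, p').
  have := gm_hl_V ((1 - e) * p'.2) (gm_hl_u k' (s - g + p'.1))
    (gm_hl_V (e * p.2) (gm_hl_u k (g + p.1)) lv).
  have -> : s + p.1 + p'.1 = (g + p.1) + (s - g + p'.1).
    by rewrite [RHS]addrACA [g + _]addrC subrK addrA.
  by rewrite [dl (_ + (_ + _))]gm_dlD -/w1 -/w2 -!addrA [dl _ + (al k' + _)]addrCA.
have [f fP] := choice bnd.
exists (nu.+1 * (\max_i f i) + nrm s + 3)%N => g pg p'g.
have [g3|g3] := leqP 3 (nrm g); last lia.
have [sg3|sg3] := leqP 3 (nrm (s - g)).
  apply: leq_trans (nrm_bound (K := \max_i f i) _) _; last by rewrite -addnA leq_addr.
  by move=> i; apply: leq_trans (fP i g pg p'g g3 sg3) (leq_bigmax i).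
by have := nrmD s (- (s - g)); rewrite nrmN opprB addrCA subrr addr0; lia.
Qed.

End Idempotent.

(** * Elements of square zero *)

Section SquareZero.
Variables (C : numClosedFieldType) (nu : nat) (T V : lmodType C).
Variables (B : comAlgType C) (Wt : zmodType).
Variable S : graded_module nu T V B Wt.

Local Notation br := (gm_br S).
Local Notation act := (gm_act S).
Local Notation Vw := (gm_V S).
Local Notation dl := (gm_dl S).
Local Notation hl := (gm_hl S).
Local Notation rk := (gm_rk S).
Local Notation wdim := (wdim (gm_V_fin S)).
Local Notation wtr := (wtr (gm_V_fin S)).
Local Notation letter := (letter S).

HB.instance Definition _ := gen_eqMixin letter.

Variable a : B.
Hypothesis a2 : ann S (a * a).

Lemma a_comm x y v : act x a (act y a v) = act y a (act x a v).
Proof. by rewrite act_swap (ann_act _ _ a2) addr0. Qed.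

Lemma a_comm_mul x y b v : act x a (act y (a * b) v) = act y (a * b) (act x a v).
Proof. by rewrite act_swap mulrA (ann_act _ _ (ann_mul b a2)) addr0. Qed.

Definition shifted h (c : C) v := act h a v - c *: v.

Lemma shifted_lin h c : linear (shifted h c).
Proof.
move=> k v w; rewrite /shifted gm_actV scalerDr !scalerA [c * k]mulrC -scalerA opprD scalerBr.
by rewrite -!addrA; congr (_ + _); rewrite addrCA.
Qed.

Lemma shifted_maps h c l : hl 0 0 h -> wmaps Vw l l (shifted h c).
Proof.
by move=> hh v lv; apply: lcB; [exact: gm_V_lin|exact: hl0_V|apply: lcZ => //; exact: gm_V_lin].
Qed.

(** The commutator of [h (x) a] with [z (x) b] is [[h, z] (x) ab], which commutes with [h (x) a]
    because [a^2] lies in M. So nilpotency spreads from one vector to the submodule it generates,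
    the exponent growing by one with each factor. *)
Lemma shifted_all h c v : v != 0 -> (exists q, iter q (shifted h c) v = 0) ->
  forall w, exists q, iter q (shifted h c) w = 0.
Proof.
move=> v0 vP; have Nl := shifted_lin h c.
apply: (gm_irr (g := S) (W := fun v => exists q, iter q (shifted h c) v = 0)); last by exists v.
  split=> [|k x y [q qP] [r rP]]; first by exists 0%N.
  exists (maxn q r); rewrite (iter_lin _ Nl).
  rewrite (iter0_mono Nl (leq_maxl q r) qP) (iter0_mono Nl (leq_maxr q r) rP).
  by rewrite scaler0 addr0.
move=> z b w [q qw]; exists q.+1.
have swap x : shifted h c (act z b x) = act z b (shifted h c x) + act (br h z) (a * b) x.
  by rewrite /shifted act_swap (linB (gm_actV S z b)) (linZ (gm_actV S z b)) addrAC.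
have com n x : iter n (shifted h c) (act (br h z) (a * b) x) =
    act (br h z) (a * b) (iter n (shifted h c) x).
  elim: n x => //= n IHn x; rewrite IHn /shifted a_comm_mul.
  by rewrite (linB (gm_actV S _ _)) (linZ (gm_actV S _ _)).
elim: q w qw => [|q IHq] w qw.
  by rewrite /= swap; move: qw => /= ->; rewrite (lin0 Nl) !act_v0 addr0.
rewrite iterSr swap (linD (iter_lin _ Nl)) com qw act_v0 addr0.
by apply: IHq; rewrite -iterSr.
Qed.

Variables (l0 : Wt) (v0 : V).
Hypotheses (l0v0 : Vw l0 v0) (v00 : v0 != 0).

(** By [chi_nil] this is the only eigenvalue of [z (x) a] when z has weight and degree 0; as a trace
    it is visibly linear in z. *)
Definition wt_char z : C := wtr l0 (act z a) / (wdim l0)%:R.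

Let dim0 : (wdim l0)%:R != 0 :> C.
Proof. by rewrite pnatr_eq0 -lt0n; apply: wdim_gt0 l0v0 v00. Qed.

Lemma wtr_actD l z z' c b : (forall l, wmaps Vw l l (act z b)) -> (forall l, wmaps Vw l l (act z' b)) ->
  wtr l (act (c *: z + z') b) = c * wtr l (act z b) + wtr l (act z' b).
Proof.
move=> zm z'm; rewrite -(wtr_lin (gm_V_lin S)) //.
by apply: (eq_wtr (gm_V_lin S)) => v _; rewrite gm_actT.
Qed.

Lemma chi_nil h : hl 0 0 h -> forall v, exists q, iter q (shifted h (wt_char h)) v = 0.
Proof.
move=> hh; have hm : wmaps Vw l0 l0 (act h a) by move=> v; apply: hl0_V.
have [c [w lw [w0 hw]]] := weigen (gm_V_lin S) (gm_V_fin S) (gm_actV S h a) hm l0v0 v00.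
have cP : forall v, exists q, iter q (shifted h c) v = 0.
  by apply: (shifted_all w0); exists 1%N; rewrite /= /shifted hw subrr.
rewrite (_ : wt_char h = c) // /wt_char.
by rewrite (wtr_scal (gm_V_lin S) _ (gm_actV S h a) hm (fun v _ => cP v)) mulfK.
Qed.

Lemma chi_trace h l : hl 0 0 h -> wtr l (act h a) = wt_char h * (wdim l)%:R.
Proof.
move=> hh; apply: (wtr_scal (gm_V_lin S)); first exact: gm_actV.
  by move=> v; apply: hl0_V.
by move=> v _; apply: chi_nil.
Qed.

Definition a_traceless z := (forall l, wmaps Vw l l (act z a)) /\ forall l, wtr l (act z a) = 0.

Lemma a_traceless_lin : lin_closed a_traceless.
Proof.
split=> [|k x y [xm x0] [ym y0]].
  have m0 l : wmaps Vw l l (act 0 a) by move=> v _; rewrite act0b; case: (gm_V_lin S l).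
  split=> // l; apply: (wtr_nil (gm_V_lin S)) => //; first exact: gm_actV.
  by move=> v _; exists 1%N; rewrite /= act0b.
split=> l; last by rewrite wtr_actD // x0 y0 mulr0 addr0.
move=> v lv; rewrite gm_actT; apply: lcD; first exact: gm_V_lin.
  by apply: lcZ; [exact: gm_V_lin|exact: xm].
exact: ym.
Qed.

(* The traces of [x, y] (x) a telescope along the finite string of weights in
   the direction of x. *)
Lemma a_traceless_br al0 m x y : al0 != 0 -> hl al0 m x -> hl (- al0) (- m) y -> a_traceless (br x y).
Proof.
move=> a0 hx hy; have hbr : hl 0 0 (br x y).
  by rewrite -[0](addrN al0) -[X in hl _ X](addrN m); apply: gm_hl_br.
have brm l : wmaps Vw l l (act (br x y) a) by move=> v; apply: hl0_V.
split=> //.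
have brE v : act (br x y) a v = act x a (act y 1 v) - act y 1 (act x a v).
  by rewrite -gm_act_br mulr1.
suff c0 : wt_char (br x y) = 0 by move=> l; rewrite chi_trace // c0 mul0r.
have zero : (forall v, act (br x y) a v = 0) -> wt_char (br x y) = 0.
  move=> z; rewrite /wt_char (wtr_nil (gm_V_lin S)) ?mul0r //; first exact: gm_actV.
  by move=> v _; exists 1%N; rewrite /= z.
have [x0|/(_ l0) [k1 k1P]] := gm_string hx a0.
  by apply: zero => v; rewrite brE !x0 act_v0 subrr.
have na0 : - al0 != 0 by rewrite oppr_eq0.
have [y0|/(_ l0) [k2 k2P]] := gm_string hy na0.
  by apply: zero => v; rewrite brE !y0 act_v0 subrr.
set b := al0 + dl m in k1P; have eb : - al0 + dl (- m) = - b by rewrite dlN opprD.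
rewrite eb in k2P; pose f l := wtr l (fun v => act x a (act y 1 v)).
have fE l : wt_char (br x y) * (wdim l)%:R = f l - f (l + b).
  rewrite -chi_trace //.
  have -> : f (l + b) = wtr l (fun v => act y 1 (act x a v)).
    rewrite /f; apply: (wtr_comm (gm_V_lin S)); try exact: gm_actV.
      by move=> v lv; rewrite -[l](addrK b) -eb; apply: gm_hl_V hy lv.
    by move=> v lv; apply: gm_hl_V hx lv.
  have xy l' : wmaps Vw l' l' (fun v => act x a (act y 1 v)).
    move=> v lv; rewrite -[l'](subrK b); apply: gm_hl_V hx _.
    by rewrite -eb; apply: gm_hl_V hy lv.
  have yx l' : wmaps Vw l' l' (fun v => act y 1 (act x a v)).
    move=> v lv; rewrite -[l'](addrK b) -eb; apply: gm_hl_V hy _.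
    by apply: gm_hl_V hx lv.
  rewrite addrC -mulN1r -(wtr_lin (gm_V_lin S)) //.
  by apply: (eq_wtr (gm_V_lin S)) => v _; rewrite brE scaleN1r addrC.
(* The string through [l0] is followed from one zero weight space to another; [l0] itself has index
   [k2], so the dimensions do not sum to 0. *)
pose n := l0 - b *+ k2; pose N := (k1 + k2).+1.
have fn : f n = 0.
  by apply: (wtr_eq0 (gm_V_lin S)) => v; rewrite /n -mulNrn; exact: k2P.
have fN : f (n + b *+ N) = 0.
  apply: (wtr_eq0 (gm_V_lin S)) => v; rewrite /n /N -addSn mulrnDr addrA [_ + b *+ k1.+1]addrAC subrK.
  exact: k1P.
have : wt_char (br x y) * (\sum_(0 <= k < N) wdim (n + b *+ k)%R)%N%:R = 0.
  rewrite natr_sum mulr_sumr (eq_bigr (fun k => - (f (n + b *+ k.+1) - f (n + b *+ k)))) => [|k _].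
    by rewrite sumrN telescope_sumr // fN mulr0n addr0 fn subrr oppr0.
  by rewrite fE opprB mulrSr [n + (_ + _)]addrA.
move=> /eqP; rewrite mulf_eq0 => /orP [/eqP //|].
rewrite pnatr_eq0 big_mkord => /eqP s0; have k2N : (k2 < N)%N by rewrite /N ltnS leq_addl.
have : (wdim l0 <= 0)%N.
  by rewrite -s0 (bigD1 (Ordinal k2N)) //= /n subrK leq_addr.
by rewrite leqNgt (wdim_gt0 (gm_V_fin S) l0v0 v00).
Qed.

Section Words.
Implicit Types (l : letter) (w : seq letter).

(** Only the element of a letter matters from here on: it is taken with coefficient a, and in [fop]
    with coefficient 1. *)
Definition aop l v := act (lz l) a v.
Fixpoint aw w v := if w is l :: w' then aop l (aw w' v) else v.

Lemma aop_lin l : linear (aop l). Proof. exact: gm_actV. Qed.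

Lemma aw_lin w : linear (aw w).
Proof. by elim: w => //= l w IHw k x y; rewrite IHw aop_lin. Qed.

Lemma aop_comm l l' v : aop l (aop l' v) = aop l' (aop l v). Proof. exact: a_comm. Qed.

Lemma aw_aop w l v : aw w (aop l v) = aop l (aw w v).
Proof. by elim: w => //= l' w ->; rewrite aop_comm. Qed.

Lemma aw_cat w w' v : aw (w ++ w') v = aw w (aw w' v).
Proof. by elim: w => //= l w ->. Qed.

Lemma aw_rem w l v : l \in w -> aw w v = aop l (aw (rem l w) v).
Proof.
elim: w => //= l' w IHw; rewrite inE eq_sym; case: eqVneq => [-> //|_] /= /IHw ->.
exact: aop_comm.
Qed.

Lemma aw_perm w w' v : perm_eq w w' -> aw w v = aw w' v.
Proof.
elim: w w' => [|l w IHw] w'; first by rewrite perm_sym => /perm_nilP ->.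
move=> pww'; have lw' : l \in w' by rewrite -(perm_mem pww') mem_head.
rewrite (aw_rem _ lw') /= (IHw (rem l w')) // -(perm_cons l).
exact: perm_trans pww' (perm_to_rem lw').
Qed.

Lemma aw_V w mu v : Vw mu v -> Vw (mu + ww w) (aw w v).
Proof.
move=> mv; elim: w => [|l w IHw]; first by rewrite /ww big_nil addr0.
by rewrite /ww big_cons [lw l + _]addrC addrA; apply: gm_hl_V (lP l) IHw.
Qed.

(** Every factor a is produced by a commutator with [Z = dxi (x) a - chi], nilpotent on the weight
    space. A letter raised twice vanishes since [a^2] lies in M; a word with an unraised letter and
    the same total must contain one. *)
Lemma aw_vanish w mu v : Vw mu v -> (forall l, l \in w -> lm l != 0) -> ww w = 0 ->
  (wdim mu + wdim mu <= size w)%N -> aw w v = 0.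
Proof.
move=> mv wn0 w0 szw.
have [xi xiP] : exists xi : 'I_nu.+1 -> C, \prod_(l <- w) lform xi (lm l) != 0.
  have [|xi xiP] := @generic_form C nu (map (@lm _ _ _ _ _ _ S) w).
    by move=> m /mapP [l lw ->]; apply: wn0.
  exists xi; rewrite prodf_seq_neq0; apply/allP => l lw /=.
  by apply: xiP; apply/mapP; exists l.
have hxi := hl_dxi S xi; set Z := shifted (dxi S xi) (wt_char (dxi S xi)).
have Zl : linear Z by exact: shifted_lin.
have Zn y : Vw mu y -> iter (wdim mu) Z y = 0.
  move=> my; apply: (lnil_iter (gm_V_lin S)) my => //; first exact: shifted_maps.
  by move=> x _; apply: chi_nil.
pose F (l : letter) r v := act (lz l) (a ^+ r) v.
have Fl l r : linear (F l r) by exact: gm_actV.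
have F_ad l r x : Z (F l r x) - F l r (Z x) = lform xi (lm l) *: F l r.+1 x.
  rewrite /Z /F /shifted (act_dxi_swap _ _ _ _ (lP l)) (linB (gm_actV S _ _)) (linZ (gm_actV S _ _)).
  by rewrite -exprS opprB addrA subrK addrAC subrr add0r.
have awE x : aw w x = opr F [seq (l, 1%N) | l <- w] x.
  by elim: (w) => //= l s ->; rewrite /F /aop expr1.
rewrite awE; apply: (raise_all Zl Fl F_ad (pre := id) _ _ xiP) => [//|ps eps tps n0ps|].
  have [//|e] : (forall x, opr F ps x = 0) \/ (tot ps + n0 ps)%N = size ps.
    elim: ps {eps tps n0ps} => [|[l r] s [IHs|IHs]]; first by right.
      by left=> x /=; rewrite IHs; apply: act_v0.
    case: r => [|[|r]]; [right|right|left].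
    - by rewrite /tot /n0 /= add0n addnS -IHs.
    - by rewrite /tot /n0 /= add0n addSn -IHs.
    move=> x /=; rewrite /F !exprS mulrA.
    exact: ann_act _ _ (ann_mul _ a2).
  by move: n0ps; rewrite -eps size_map in tps e *; lia.
apply: ad_iter_eq0 => //; first exact: opr_lin.
move=> i j ij; have [dj|jd] := leqP (wdim mu) j.
  rewrite (iter0_mono Zl dj (Zn _ mv)) (lin0 (opr_lin Fl _)).
  exact: lin0 (iter_lin i Zl).
apply: (iter0_mono Zl (q := wdim mu)); first lia.
apply: Zn; rewrite -[mu]addr0 -w0; have jmv : Vw mu (iter j Z v).
  by elim: (j) => //= k; apply: shifted_maps.
elim: (w) => [|l s IHs]; first by rewrite /ww big_nil addr0.
by rewrite /ww big_cons [lw l + _]addrC addrA; apply: gm_hl_V (lP l) IHs.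
Qed.

Lemma iter_aw w q v : iter q (aw w) v = aw (flatten (nseq q w)) v.
Proof. by elim: q => //= q ->; rewrite aw_cat. Qed.

(* A weight-zero word is a product of commuting operators: its letters of
   nonzero degree multiply to a nilpotent operator. *)
Lemma aw_nil w mu v : Vw mu v -> (forall l, l \in w -> la l = 0) -> ww w = 0 ->
  has (fun l => lm l != 0) w -> exists q, iter q (aw w) v = 0.
Proof.
move=> mv wa w0 hw; pose P l := lm l != 0.
have pw : perm_eq w (filter (predC P) w ++ filter P w).
  by rewrite perm_sym perm_catC; apply/permPl/perm_filterC.
exists (wdim mu + wdim mu)%N.
rewrite (eq_iter (fun x => aw_perm x pw)) (eq_iter (fun x => aw_cat _ _ x)).
rewrite iter_comp_comm; last first.
  by move=> y; rewrite -!aw_cat; apply: aw_perm; rewrite perm_catC.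
rewrite [iter _ (aw (filter P w)) v]iter_aw (aw_vanish mv).
- exact: lin0 (iter_lin _ (aw_lin _)).
- by move=> l /flattenP [s /nseqP [-> _]]; rewrite mem_filter => /andP [].
- have e : ww (filter P w) = 0.
    rewrite -w0 /ww (perm_big _ pw) big_cat /= [X in _ = X + _]big1_seq ?add0r //.
    by move=> l /andP [_]; rewrite mem_filter /= /P negbK => /andP [/eqP m0 /wa a0]; rewrite /lw a0 m0 dl0 addr0.
  by elim: (_ + _)%N => [|q IHq]; rewrite /ww /= ?big_nil // big_cat /= -/(ww _) e -/(ww _) IHq addr0.
have : (0 < size (filter P w))%N by rewrite size_filter -has_count.
move=> s0; elim: (_ + _)%N => //= q IHq; rewrite size_cat.
by rewrite -add1n leq_add.
Qed.


Definition fop l v := act (lz l) 1 v.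
Fixpoint fw w v := if w is l :: w' then fop l (fw w' v) else v.

Lemma fop_lin l : linear (fop l). Proof. exact: gm_actV. Qed.

Lemma fw_V w mu v : Vw mu v -> Vw (mu + ww w) (fw w v).
Proof.
move=> mv; elim: w => [|l w IHw]; first by rewrite /ww big_nil addr0.
by rewrite /ww big_cons [lw l + _]addrC addrA; apply: gm_hl_V (lP l) IHw.
Qed.

Lemma aop_fop l l' v : aop l (fop l' v) = fop l' (aop l v) + aop (lbr l l') v.
Proof. by rewrite /aop /fop act_swap mulr1. Qed.

Lemma aw_fop w l' v : aw w (fop l' v) =
  fop l' (aw w v) + \sum_(l <- w) aop (lbr l l') (aw (rem l w) v).
Proof.
elim: w => [|l w IHw]; first by rewrite big_nil addr0.
rewrite [LHS]/= IHw (linD (aop_lin l)) aop_fop -addrA big_cons; congr (_ + _).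
rewrite /= eqxx; congr (_ + _); rewrite (lin_sum (aop_lin l)).
rewrite big_seq [RHS]big_seq; apply: eq_bigr => l1 l1w; rewrite aop_comm.
by case: eqVneq => //= ->; rewrite -(aw_rem _ l1w).
Qed.

Lemma rem_catE (l : letter) w w' : rem l (w ++ w') =
  if l \in w then rem l w ++ w' else w ++ rem l w'.
Proof. by elim: w => //= l1 w ->; rewrite inE [l == _]eq_sym; case: eqVneq => //= _; case: ifP. Qed.

Variable v : V.

(** Moving an operator of [ys] to the left contracts it with one operator with coefficient a.
    Contractions commute with all of [xs], so some uncontracted element of [xs] is left to kill
    [v]. *)
Lemma aw_more_fw ys xs xs' : (forall l, l \in xs -> aop l v = 0) -> (size ys < size xs)%N ->
  aw (xs ++ xs') (fw ys v) = 0.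
Proof.
elim: ys xs xs' => [|y ys IHys] xs xs' kx szx /=.
  case: xs kx szx => // l xs kx _.
  rewrite (aw_perm _ (w' := (xs ++ xs') ++ [:: l])); last by rewrite perm_sym perm_catC.
  by rewrite aw_cat /= kx ?mem_head // (lin0 (aw_lin _)).
rewrite aw_fop IHys // ?(lin0 (fop_lin y)) ?add0r; last exact: ltnW.
rewrite big1_seq // => l /andP [_ _]; rewrite rem_catE.
case: ifP => lx; rewrite IHys ?(lin0 (aop_lin _)) //; last exact: ltnW.
  by move=> l1 /mem_rem; apply: kx.
by rewrite size_rem // -ltnS prednK //; case: (xs) lx.
Qed.

(** One step of a Wick expansion: contractions of y with [xs'] drop out, since they leave too few
    [ys] for [xs]. *)
Lemma aw_fw_step xs xs' y ys : (forall l, l \in xs -> aop l v = 0) -> size xs = (size ys).+1 ->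
  aw (xs ++ xs') (fw (y :: ys) v) =
    \sum_(l <- xs) aop (lbr l y) (aw (rem l xs ++ xs') (fw ys v)).
Proof.
move=> kx szx; have lt : (size ys < size xs)%N by rewrite szx.
rewrite [fw _ _]/= aw_fop aw_more_fw // (lin0 (fop_lin y)) add0r big_cat /=.
rewrite [X in _ + X]big1_seq ?addr0 => [|l /andP [_ lx']].
  rewrite big_seq [RHS]big_seq; apply: eq_bigr => l lx.
  by rewrite rem_catE lx.
rewrite rem_catE; case: ifP => lx; last by rewrite aw_more_fw // (lin0 (aop_lin _)).
rewrite (aw_perm _ (w' := xs ++ rem l xs')) ?aw_more_fw ?(lin0 (aop_lin _)) //.
rewrite -(perm_cons l) -cat_cons -(permPl (perm_cat (perm_to_rem lx) (perm_refl xs'))).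
by rewrite perm_sym -cat1s perm_catCA perm_cat2l perm_sym perm_to_rem.
Qed.

Hypothesis v_word : forall w, (forall l, l \in w -> la l = 0) -> ww w = 0 ->
  has (fun l => lm l != 0) w -> aw w v = 0.
Hypothesis v_chi : forall h, hl 0 0 h -> act h a v = wt_char h *: v.

Lemma ww_perm w w' : perm_eq w w' -> ww w = ww w'.
Proof. exact: perm_big. Qed.

Lemma ww_cat w w' : ww (w ++ w') = ww w + ww w'. Proof. exact: big_cat. Qed.
Lemma ww_cons l w : ww (l :: w) = lw l + ww w. Proof. exact: big_cons. Qed.

(** After all contractions only operators with coefficient a act on [v]; they form a word of weight
    zero that still contains a letter of nonzero degree. *)
Lemma aw_fw_eq0 ys xs xs' : (forall l, l \in xs -> aop l v = 0) -> size xs = size ys ->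
  (forall l, l \in xs ++ xs' ++ ys -> la l = 0) -> ww (xs ++ xs' ++ ys) = 0 ->
  has (fun l => lm l != 0) xs' -> aw (xs ++ xs') (fw ys v) = 0.
Proof.
elim: ys xs xs' => [|y ys IHys] xs xs' kx szx a0 w0 hx'.
  by move: a0 w0; rewrite (size0nil szx) cats0 /= => a0 w0; apply: v_word.
rewrite (aw_fw_step _ _ kx szx) big1_seq // => l /andP [_ lx].
have p : perm_eq (lbr l y :: rem l xs ++ xs') (rem l xs ++ lbr l y :: xs').
  by rewrite -cat1s perm_catCA.
rewrite -[aop _ _]/(aw (lbr l y :: rem l xs ++ xs') _) (aw_perm _ p) IHys //.
- by move=> l1 /mem_rem; apply: kx.
- by rewrite size_rem // szx.
- move=> l1; rewrite !mem_cat !inE => h; have la0 l2 : l2 \in xs ++ xs' ++ y :: ys -> la l2 = 0 by apply: a0.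
  have [->|l1n] := eqVneq l1 (lbr l y); first by rewrite /= !la0 ?addr0 // !mem_cat ?lx // inE eqxx !orbT.
  apply: la0; move: h; rewrite (negPf l1n) !mem_cat !inE /= => /or3P [/mem_rem ->|->|->] //; rewrite ?orbT //.
- have := ww_perm (perm_to_rem lx); move: w0; rewrite !ww_cat !ww_cons => <- ->.
  have -> : lw (lbr l y) = lw l + lw y by rewrite /lw /= gm_dlD addrACA.
  move: (lw l) (lw y) (ww (rem l xs)) (ww xs') (ww ys) => L Y Q X Z.
  by rewrite -!addrA [LHS]addrCA; congr (_ + (_ + _)); rewrite [LHS]addrCA.
by rewrite /= hx' orbT.
Qed.

(** Commuting l past [ys] costs only terms with too few [ys] left for [xs], so l acts as it does on
    [v]. *)
Lemma aw_fw_chi ys xs l : (forall l, l \in xs -> aop l v = 0) -> size xs = size ys ->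
  hl 0 0 (lz l) -> aw xs (aop l (fw ys v)) = wt_char (lz l) *: aw xs (fw ys v).
Proof.
move=> + + hh; elim: ys xs => [|y ys IHys] xs kx szx.
  by rewrite (size0nil szx) /=; apply: v_chi.
have lt : (size ys < size xs)%N by rewrite szx.
have more x := aw_more_fw x kx lt.
rewrite [fw _ _]/= aop_fop (linD (aw_lin xs)).
have -> : aw xs (aop (lbr l y) (fw ys v)) = 0.
  by rewrite -[RHS](more [:: lbr l y]) aw_cat.
have m0 : aw xs (fw ys v) = 0 by rewrite -[RHS](more [::]) cats0.
rewrite addr0 !aw_fop aw_aop m0 !(lin0 (aop_lin _)) !(lin0 (fop_lin _)) !add0r scaler_sumr.
rewrite big_seq [RHS]big_seq; apply: eq_bigr => l1 lx.
rewrite IHys ?(linZ (aop_lin _)) //; first by move=> l2 /mem_rem; apply: kx.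
by rewrite size_rem // szx.
Qed.

End Words.

End SquareZero.

Section CountPairings.
Variable X : eqType.

(** For lists of equal length, the number of ways to match equal entries, that is the permanent of
    the matrix of equalities; it is the combinatorial factor in [pairing]. *)
Fixpoint npair (q p : seq X) : nat :=
  if p is g :: p' then (count_mem g q * npair (rem g q) p')%N else 1%N.

Lemma npair_gt0 q p : size q = size p -> (0 < npair q p)%N = perm_eq q p.
Proof.
elim: p q => [|g p IHp] q /=; first by move/size0nil ->.
move=> sq; rewrite muln_gt0 -has_count has_pred1.
have [gq|gq] /= := boolP (g \in q).
  rewrite IHp ?size_rem ?sq // (permPl (perm_to_rem gq)) perm_cons //.
by apply/esym/negP => /perm_mem /(_ g); rewrite mem_head (negPf gq).
Qed.

Lemma big_pred1_seq (M : zmodType) (q : seq X) g (x : M) :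
  \sum_(h <- q) (if h == g then x else 0) = x *+ count_mem g q.
Proof.
elim: q => [|h q IHq]; first by rewrite big_nil.
by rewrite big_cons IHq /=; case: eqP => _; rewrite ?add0r // mulrS.
Qed.

End CountPairings.

(* Greedy choice of degrees no two of which are equal or add up to [s]. *)
Lemma degree_family nu (P : degree nu -> Prop) s n :
  (forall K, exists2 m, P m & (K < nrm m)%N) ->
  exists ms : seq (degree nu), [/\ size ms = n, uniq ms, (forall m, m \in ms -> P m) &
    forall m m', m \in ms -> m' \in ms -> m != m' -> m != s - m'].
Proof.
move=> H; elim: n => [|n [ms [sz un msP msd]]]; first by exists [::].
have [g Pg gK] := H (\max_(m <- ms) nrm m + nrm s)%N.
have big m : m \in ms -> (nrm m + nrm s < nrm g)%N.
  move=> mm; apply: leq_ltn_trans gK; rewrite leq_add2r.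
  by rewrite (big_rem m) //= leq_maxl.
have gn m : m \in ms -> g != s - m /\ m != s - g.
  move=> /big mg; split; apply/eqP => e; move: mg; rewrite e => mg.
    by have := nrmD s (- m); rewrite nrmN leqNgt addnC mg.
  by have := nrmD s (- (s - g)); rewrite nrmN opprB addrCA subrr addr0 leqNgt addnC mg.
exists (g :: ms); split=> /=; first by rewrite sz.
- by rewrite un andbT; apply/negP => /big; rewrite -ltn_subRL subnn.
- by move=> m; rewrite inE => /orP [/eqP -> //|]; apply: msP.
move=> m m'; rewrite !inE => /orP [/eqP ->|mm] /orP [/eqP ->|mm'] mn.
- by rewrite eqxx in mn.
- by have [] := gn _ mm'.
- by have [] := gn _ mm.
exact: msd.
Qed.

Section NoSquareZero.
Variables (C : numClosedFieldType) (nu : nat) (T V : lmodType C).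
Variables (B : comAlgType C) (Wt : zmodType).
Variable S : graded_module nu T V B Wt.

Local Notation br := (gm_br S).
Local Notation act := (gm_act S).
Local Notation Vw := (gm_V S).
Local Notation dl := (gm_dl S).
Local Notation hl := (gm_hl S).
Local Notation d := (gm_d S).
Local Notation wdim := (wdim (gm_V_fin S)).
Local Notation wtr := (wtr (gm_V_fin S)).
Local Notation letter := (letter S).

(* Generated, up to elements acting as zero, by the brackets of opposite
   letters of nonzero weight. *)
Definition string_type z := forall P : T -> Prop, lin_closed P ->
  (forall z, (forall b v, act z b v = 0) -> P z) ->
  (forall al0 m x y, al0 != 0 -> hl al0 m x -> hl (- al0) (- m) y -> P (br x y)) -> P z.

Hypothesis hl0_decomp : forall z, hl 0 0 z -> exists xi z', string_type z' /\
  forall b v, act z b v = act (dxi S xi + z') b v.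
Hypothesis td_pair : forall i j m, exists x y z', [/\ hl 0 m x, hl 0 (- m) y, string_type z' &
  forall b v, act (br x y) b v =
    act (- ((m i)%:~R *: d j + (m j)%:~R *: d i) + z') b v].
Hypothesis nu_gt0 : (0 < nu)%N.

Section Vacuum.
Variable a : B.
Hypothesis a2 : ann S (a * a).
Variables (l0 : Wt) (v0 : V).
Hypotheses (l0v0 : Vw l0 v0) (v00 : v0 != 0).

Local Notation chi := (wt_char S a l0).
Local Notation aw := (aw a).
Local Notation aop := (aop a).
Local Notation a_traceless := (a_traceless S a).

Lemma string_traceless z : string_type z -> a_traceless z.
Proof.
move=> /(_ a_traceless (a_traceless_lin S a)); apply => [x x0|al0 m x y].
  split=> l; first by move=> v _; rewrite x0; case: (gm_V_lin S l).
  apply: (wtr_nil (gm_V_lin S)); first exact: gm_actV.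
    by move=> v _; rewrite x0; case: (gm_V_lin S l).
  by move=> v _; exists 1%N; rewrite /= x0.
exact: (a_traceless_br a2 l0v0 v00).
Qed.

Definition a_maps z := forall l, wmaps Vw l l (act z a).

Lemma a_maps_lin : lin_closed a_maps.
Proof.
split=> [l v _|k x y mx my l v lv]; first by rewrite act0b; case: (gm_V_lin S l).
rewrite gm_actT; apply: lcD; [exact: gm_V_lin|apply: lcZ; [exact: gm_V_lin|exact: mx]|exact: my].
Qed.

Lemma a_maps_hl z : hl 0 0 z -> a_maps z.
Proof. by move=> hz l v; apply: hl0_V. Qed.

Lemma chiD k x y : a_maps x -> a_maps y -> chi (k *: x + y) = k * chi x + chi y.
Proof. by move=> mx my; rewrite /wt_char wtr_actD // mulrDl mulrA. Qed.

Lemma chi0 : chi 0 = 0.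
Proof.
have m0 : a_maps 0 by case: a_maps_lin.
have := chiD 1 m0 m0; rewrite scaler0 addr0 mul1r => /eqP.
by rewrite -subr_eq0 opprD addrA subrr sub0r oppr_eq0 => /eqP.
Qed.

Lemma chiZ k x : a_maps x -> chi (k *: x) = k * chi x.
Proof. by move=> mx; rewrite -[k *: x]addr0 chiD ?chi0 ?addr0 //; case: a_maps_lin. Qed.

Lemma chi_string z : string_type z -> chi z = 0.
Proof. by move=> /string_traceless [_ z0]; rewrite /wt_char z0 mul0r. Qed.

Lemma chi_eq x y : (forall v, act x a v = act y a v) -> chi x = chi y.
Proof. by move=> e; congr (_ / _); apply: (eq_wtr (gm_V_lin S)) => v _. Qed.

Lemma d_maps i : a_maps (d i). Proof. by apply: a_maps_hl; apply: gm_hl_d. Qed.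

Lemma chi_dxi xi : chi (dxi S xi) = \sum_i xi i * chi (d i).
Proof.
rewrite /dxi; elim: (index_enum _) => [|i r IHr]; last first.
  rewrite !big_cons chiD ?IHr //; first exact: d_maps.
  by apply: (lc_sum (W := a_maps) a_maps_lin) => j _; (apply: (lcZ a_maps_lin); exact: d_maps).
by rewrite !big_nil chi0.
Qed.

(** [chi] vanishes on string type elements, so in weight and degree 0 it is determined by its values
    on the [d_i]. *)
Lemma chi_d_neq0 z : hl 0 0 z -> chi z != 0 -> exists i, chi (d i) != 0.
Proof.
move=> hz; have [xi [z' [sz' zE]]] := hl0_decomp hz.
rewrite (chi_eq (fun v => zE a v)) -[dxi S xi]scale1r chiD; first last.
- by case: (string_traceless sz').
- exact: a_maps_hl (hl_dxi S xi).
rewrite (chi_string sz') addr0 mul1r chi_dxi => c0.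
apply/existsP; apply: contraNT c0; rewrite negb_exists => /forallP d0.
by apply/eqP/big1 => i _; have := d0 i; rewrite negbK => /eqP ->; rewrite mulr0.
Qed.

(** By [td_pair] the value of [chi] can be made [- (g_i chi(d_j) + g_j chi(d_i))]. For g nonzero a
    choice with i = j works, or else a mixed one with [i0]. For g = 0 the pair is a dummy. *)
Lemma pairing_letters i0 g : chi (d i0) != 0 -> exists p : T * T,
  [/\ hl 0 g p.1, hl 0 (- g) p.2 & g != 0 -> chi (br p.1 p.2) != 0].
Proof.
move=> ci0; have [->|g0] := eqVneq g 0.
  by exists (0, 0); split=> //=; [case: (gm_hl_lin S 0 0)|rewrite oppr0; case: (gm_hl_lin S 0 0)].
have [i [j ij]] : exists i j, (g i)%:~R * chi (d j) + (g j)%:~R * chi (d i) != 0.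
  have [gi0|gi0] := eqVneq (g i0) 0; last first.
    exists i0, i0; rewrite -mulr2n mulrn_eq0 /= mulf_neq0 // intr_eq0 //.
  have [j gj] : exists j, g j != 0.
    apply/existsP; apply: contraNT g0; rewrite negb_exists => /forallP g0.
    by apply/eqP/ffunP => i; rewrite ffunE; apply/eqP; have := g0 i; rewrite negbK.
  have [cj|cj] := eqVneq (chi (d j)) 0.
    by exists i0, j; rewrite gi0 mul0r add0r mulf_neq0 // intr_eq0.
  by exists j, j; rewrite -mulr2n mulrn_eq0 /= mulf_neq0 // intr_eq0.
have [x [y [z' [hx hy sz' e]]]] := td_pair i j g; exists (x, y); split=> //= _.
rewrite (chi_eq (fun v => e a v)) -scaleN1r chiD; first last.
- by case: (string_traceless sz').
- by apply: (lcD a_maps_lin); apply: (lcZ a_maps_lin); exact: d_maps.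
rewrite (chi_string sz') addr0 mulN1r oppr_eq0 chiD; first by rewrite chiZ //; exact: d_maps.
- exact: d_maps.
by apply: (lcZ a_maps_lin); exact: d_maps.
Qed.

(** All operators in question preserve the weight space, commute because [a^2] lies in M, and are
    nilpotent by [aw_nil] and [chi_nil]. *)
Lemma vacuum : exists2 v, Vw l0 v & [/\ v != 0,
  forall w : seq letter, (forall l, l \in w -> la l = 0) -> ww w = 0 ->
     has (fun l => lm l != 0) w -> aw w v = 0 &
  forall h, hl 0 0 h -> act h a v = chi h *: v].
Proof.
pose Fam F := (exists w : seq letter, [/\ F = aw w, (forall l, l \in w -> la l = 0), ww w = 0 &
     has (fun l => lm l != 0) w]) \/ exists2 h, hl 0 0 h & F = shifted S a h (chi h).
have com_ws (w : seq letter) h c v : aw w (shifted S a h c v) = shifted S a h c (aw w v).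
  rewrite /shifted (linB (aw_lin a w)) (linZ (aw_lin a w)); congr (_ - _).
  by elim: (w) => //= l s ->; apply: a_comm.
have [F|F G x|v lv [vn0 vF]] := common_kernel (gm_V_lin S) (gm_V_fin S) (l := l0) (Fam := Fam) _ _ l0v0 v00.
- move=> [[w [-> wa w0 wm]]|[h hh ->]].
    split; [exact: aw_lin| |].
      by move=> v /(aw_V a w); rewrite w0 addr0.
    by move=> v lv; apply: (aw_nil a2 l0v0 v00 lv).
  split; [exact: shifted_lin|exact: shifted_maps|].
  by move=> v _; apply: (chi_nil a2 l0v0 v00).
- move=> [[w [-> _ _ _]]|[h hh ->]] [[w' [-> _ _ _]]|[h' hh' ->]] _.
  + by rewrite -!aw_cat; apply: (aw_perm a2); rewrite perm_catC.
  + exact: com_ws.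
  + by rewrite com_ws.
  rewrite /shifted !(linB (gm_actV S _ _)) !(linZ (gm_actV S _ _)) !scalerBr (a_comm a2 h h').
  by rewrite !scalerA [chi h * _]mulrC !opprB -!addrA; congr (_ + _); rewrite [LHS]addrCA [RHS]addrCA; congr (_ + _); exact: addrC.
exists v => //; split=> // [w wa w0 wm|h hh].
  by apply: vF; left; exists w.
by apply/eqP; rewrite -subr_eq0; apply/eqP; apply: (vF (shifted S a h (chi h))); right; exists h.
Qed.

Section Pairing.
Variables (x y : degree nu -> T).
Hypotheses (hx : forall g, hl 0 g (x g)) (hy : forall g, hl 0 (- g) (y g)).

Definition Lx g : letter := Letter 1 0 (hx g).
Definition Ly g : letter := Letter 1 0 (hy g).

Lemma rem_Lx q g : g \in q -> perm_eq (rem (Lx g) (map Lx q)) (map Lx (rem g q)).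
Proof.
move=> gq; rewrite -(perm_cons (Lx g)) -map_cons -(permPl (perm_to_rem (map_f Lx gq))).
by rewrite perm_map ?perm_to_rem.
Qed.

Lemma ww_Lx q : ww (map Lx q) = dl (\sum_(g <- q) g).
Proof.
elim: q => [|g q IHq]; first by rewrite /ww !big_nil dl0.
by rewrite [map _ _]/= ww_cons IHq big_cons gm_dlD /lw /= add0r.
Qed.

Lemma ww_Ly p : ww (map Ly p) = - dl (\sum_(g <- p) g).
Proof.
elim: p => [|g p IHp]; first by rewrite /ww !big_nil dl0 oppr0.
by rewrite [map _ _]/= ww_cons IHp big_cons gm_dlD /lw /= add0r dlN opprD.
Qed.

Variable v : V.
Hypothesis v_word : forall w : seq letter, (forall l, l \in w -> la l = 0) -> ww w = 0 ->
  has (fun l => lm l != 0) w -> aw w v = 0.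
Hypothesis v_chi : forall h, hl 0 0 h -> act h a v = chi h *: v.

(** Wick's formula. Contracting [y g] with [x h] gives the scalar [chi] if h = g; otherwise the
    contraction has nonzero degree and [aw_fw_eq0] removes it. What remains counts matchings, each
    with the product of the scalars. *)
Lemma pairing p q : size q = size p -> (forall g, g \in q -> act (x g) a v = 0) ->
  \sum_(g <- q) g = \sum_(g <- p) g ->
  aw (map Lx q) (fw (map Ly p) v) =
    ((npair q p)%:R * \prod_(g <- p) chi (br (x g) (y g))) *: v.
Proof.
elim: p q => [|g p IHp] q sq kx sum_q.
  by rewrite (size0nil sq) /= big_nil mulr1 scale1r.
have kX q' : {subset q' <= q} -> forall l, l \in map Lx q' -> aop l v = 0.
  by move=> q'q l /mapP [h hq ->]; apply: kx; apply: q'q.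
have step : forall h, h \in q -> aop (lbr (Lx h) (Ly g)) (aw (rem (Lx h) (map Lx q) ++ [::]) (fw (map Ly p) v)) =
    if h == g then ((npair (rem g q) p)%:R * \prod_(h <- g :: p) chi (br (x h) (y h))) *: v else 0.
  move=> h hq; rewrite cats0 (aw_perm a2 _ (rem_Lx hq)).
  have rq : {subset rem h q <= q} by move=> h'; apply: mem_rem.
  have sr : size (rem h q) = size p by rewrite size_rem // sq.
  case: eqVneq => [ehg|nhg].
    rewrite -(aw_aop a2) (aw_fw_chi a2 v_chi (kX _ rq)) ?size_map //; last first.
      by rewrite /= ehg -[0](addr0 0) -[X in hl _ X](addrN g); apply: gm_hl_br.
    rewrite IHp //; first by rewrite /= ehg big_cons scalerA mulrCA.
      by move=> h' h'r; apply: kx; apply: rq.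
    move: sum_q; rewrite (perm_big _ (perm_to_rem hq)) !big_cons ehg.
    exact: addrI.
  have := aw_fw_eq0 a2 v_word (kX _ rq) (ys := map Ly p) (xs' := [:: lbr (Lx h) (Ly g)]).
  rewrite aw_cat /= (aw_aop a2); apply; rewrite ?size_map ?orbF //.
  - move=> l; rewrite mem_cat inE => /or3P [/mapP [h' _ -> //]|/eqP ->|/mapP [h' _ -> //]] /=.
    exact: addr0.
  - rewrite ww_cat ww_cons ww_Lx ww_Ly /lw /= !addr0 add0r -dlN -!gm_dlD.
    rewrite -[RHS](dl0 S); congr (dl _).
    move: sum_q; rewrite (perm_big _ (perm_to_rem hq)) !big_cons => e.
    by rewrite !addrA [_ + h]addrC e [g + _]addrC addrK subrr.
  - by rewrite subr_eq0.
have kXq : forall l, l \in map Lx q -> aop l v = 0 by apply: kX => h.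
have sz : size (map Lx q) = (size (map Ly p)).+1 by rewrite !size_map sq.
rewrite -[map Lx q]cats0 (aw_fw_step a2 [::] (Ly g) kXq sz) big_map.
rewrite big_seq (eq_bigr _ step) -big_seq big_pred1_seq -scaler_nat scalerA mulrA -natrM.
by [].
Qed.

End Pairing.

End Vacuum.

Section NonzeroCharacter.
Variable a : B.
Hypothesis a2 : ann S (a * a).
Variables (l0 : Wt) (v0 : V).
Hypotheses (l0v0 : Vw l0 v0) (v00 : v0 != 0).
Variables (h : T) (v1 : V).
Hypotheses (hh : hl 0 0 h) (nnil : forall q, iter q (act h a) v1 != 0).

Lemma no_square_zero : False.
Proof.
have ch : wt_char S a l0 h != 0.
  apply/eqP => c0; have [q] := chi_nil a2 l0v0 v00 hh v1.
  rewrite c0 (eq_iter (f' := act h a)) => [/eqP|v]; first by rewrite (negPf (nnil q)).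
  by rewrite /shifted scale0r subr0.
have [i0 ci0] := chi_d_neq0 a2 l0v0 v00 hh ch.
have [f fP] := choice (fun g => pairing_letters a2 l0v0 v00 g ci0).
pose x g := (f g).1; pose y g := (f g).2.
have hx g : hl 0 g (x g) by have [] := fP g.
have hy g : hl 0 (- g) (y g) by have [] := fP g.
have cg g : g != 0 -> wt_char S a l0 (br (x g) (y g)) != 0 by have [] := fP g.
pose L := Lx hx; pose Nil g := g != 0 /\ forall v, exists q, iter q (act (x g) a) v = 0.
have inj g : g != 0 -> Nil g \/ forall v, v != 0 -> act (x g) a v != 0.
  move=> g0; have [|nN] := pselect (Nil g); [by left|right=> v vn0].
  apply/eqP => gv; apply: nN; split=> // w.
  have sE : shifted S a (x g) 0 =1 act (x g) a by move=> u; rewrite /shifted scale0r subr0.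
  have [|q] := shifted_all a2 (h := x g) (c := 0) vn0 _ w; first by exists 1%N; rewrite /= sE.
  by rewrite (eq_iter sE); exists q.
(* Were the operators of g and - g both injective, so would be their product, which is nilpotent at
   [v0] by [aw_nil]. *)
have cover g : g != 0 -> Nil g \/ Nil (- g).
  move=> g0; have [|i1] := inj g g0; first by left.
  have g0' : - g != 0 by rewrite oppr_eq0.
  have [|i2] := inj (- g) g0'; first by right.
  have ann_w : forall l, l \in [:: L g; L (- g)] -> la l = 0.
    by move=> l; rewrite !inE => /orP [/eqP ->|/eqP ->].
  have w0 : ww [:: L g; L (- g)] = 0.
    by rewrite -[ww _]/(ww (map L [:: g; - g])) ww_Lx big_cons big_seq1 subrr dl0.
  have hw : has (fun l => lm l != 0) [:: L g; L (- g)] by rewrite /= g0.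
  have [q /eqP q0] := aw_nil a2 l0v0 v00 l0v0 ann_w w0 hw.
  suff : iter q (aw a [:: L g; L (- g)]) v0 != 0 by rewrite q0.
  by elim: (q) => //= q' IHq; apply: i1; apply: i2.
apply: (one_ended nu_gt0 cover cover) => s.
have [v lv [vn0 v_word v_chi]] := vacuum a2 l0v0 v00.
apply: contrapT => nK; pose P m := Nil m /\ Nil (s - m).
have nb K : exists2 m, P m & (K < nrm m)%N.
  apply: contrapT => H; apply: nK; exists K => m Pm Pm'; rewrite leqNgt; apply/negP => lt.
  by apply: H; exists m.
pose D := wdim (l0 - dl s); have [ms [sz un msP msd]] := degree_family s D.+1 nb.
pose Ls := ms ++ [seq s - m | m <- ms].
have LsN g : g \in Ls -> Nil g.
  by rewrite mem_cat => /orP [/msP []|/mapP [m /msP [] ? ? ->]].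
(* The nilpotent operators are applied as often as possible, one degree after the other; the
   resulting w is killed by all of them and still satisfies the vacuum conditions. *)
have [r [rL wn0 wk]] : exists r : seq (degree nu), [/\ {subset r <= Ls}, aw a (map L r) v != 0 &
    forall g, g \in Ls -> act (x g) a (aw a (map L r) v) = 0].
  suff : forall Ms : seq (degree nu), {subset Ms <= Ls} -> exists r : seq (degree nu), [/\ {subset r <= Ls}, aw a (map L r) v != 0 &
    forall g, g \in Ms -> act (x g) a (aw a (map L r) v) = 0] by apply.
  elim=> [|g Ms IHM] sM; first by exists [::].
  have [|r [rL rn rk]] := IHM; first by move=> m mM; apply: sM; rewrite inE mM orbT.
  set w0 := aw a _ v in rn rk.
  have [_ /(_ w0) gn] := LsN g (sM g (mem_head _ _)).
  have ex : exists q, iter q (act (x g) a) w0 == 0 by have [q q0] := gn; exists q; apply/eqP.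
  have [[|q] /eqP q0 qmin] := ex_minnP ex; first by rewrite /= in q0; rewrite q0 eqxx in rn.
  exists (nseq q g ++ r).
  have -> : aw a (map L (nseq q g ++ r)) v = iter q (act (x g) a) w0.
    by rewrite map_cat aw_cat -/w0 /=; elim: (q) => //= q' ->.
  split.
  - by move=> m; rewrite mem_cat mem_nseq => /orP [/andP [_ /eqP ->]|/rL //]; apply: sM; apply: mem_head.
  - by apply/negP => /qmin; rewrite ltnn.
  move=> m; rewrite inE => /orP [/eqP ->|mM]; first by rewrite -iterS.
  have -> : act (x m) a (iter q (act (x g) a) w0) = iter q (act (x g) a) (act (x m) a w0).
    by elim: (q) => //= q' <-; apply: a_comm.
  by rewrite rk //; apply: lin0; apply: iter_lin; apply: gm_actV.
set w := aw a (map L r) v in wn0 wk.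
have w_word (t : seq letter) : (forall l, l \in t -> la l = 0) -> ww t = 0 ->
    has (fun l => lm l != 0) t -> aw a t w = 0.
  move=> ta t0 tm; rewrite /w -aw_cat (aw_perm a2 (w' := map L r ++ t)); last by rewrite perm_catC.
  by rewrite aw_cat v_word // (lin0 (aw_lin a _)).
have w_chi h' : hl 0 0 h' -> act h' a w = wt_char S a l0 h' *: w.
  move=> hh'; rewrite -(linZ (aw_lin a _)) -v_chi // /w.
  by elim: (map L r) => //= l t <-; apply: a_comm.
(* Lowering also along r undoes the degree gained in w, so these vectors have weight [l0 - dl s],
   whose dimension D was fixed before r was known. *)
pose E m := fw (map (Ly hy) (r ++ [:: m; s - m])) w.
have lE m : Vw (l0 - dl s) (E m).
  have := fw_V (map (Ly hy) (r ++ [:: m; s - m])) (aw_V a (map L r) lv).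
  rewrite ww_Ly ww_Lx big_cat /= big_cons big_seq1 [m + _]addrC subrK gm_dlD.
  by rewrite opprD addrA addrK.
have ED : (D < size ms)%N by rewrite sz.
pose us (i : 'I_(size ms)) := E (nth 0 ms i).
have [c c0 cE] := wdep (Vw_fin := gm_V_fin S) (us := us) (fun i => lE _) ED.
move/eqP: c0; apply; apply/rowP => j; rewrite mxE.
pose mj := nth 0 ms j; have mjms : mj \in ms by apply: mem_nth.
have mems m : m \in ms -> {subset r ++ [:: m; s - m] <= Ls}.
  move=> mm g; rewrite mem_cat !inE => /or3P [/rL //|/eqP ->|/eqP ->].
    by rewrite mem_cat mm.
  by rewrite mem_cat; apply/orP; right; apply/mapP; exists m.
pose N q p : C := (npair q p)%:R * \prod_(g <- p) wt_char S a l0 (br (x g) (y g)).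
have EN m : aw a (map L (r ++ [:: mj; s - mj])) (E m) =
    N (r ++ [:: mj; s - mj]) (r ++ [:: m; s - m]) *: w.
  rewrite /E (pairing a2 hx hy w_word w_chi) ?size_cat //.
    by move=> g /(mems _ mjms) /wk.
  by rewrite !big_cat /= !big_cons !big_nil !addr0 !(addrCA _ s) !subrr.
have := congr1 (aw a (map L (r ++ [:: mj; s - mj]))) cE.
rewrite (lin0 (aw_lin a _)) (lin_sum (aw_lin a _)) (bigD1 j) //= big1 ?addr0.
  rewrite (linZ (aw_lin a _)) EN scalerA => /eqP; rewrite scaler_eq0 (negPf wn0) orbF.
  rewrite mulf_eq0 => /orP [/eqP //|]; rewrite mulf_eq0 pnatr_eq0 -leqn0 leqNgt npair_gt0 // perm_refl /=.
  rewrite prodf_seq_eq0 => /hasP [g gin /=]; rewrite (negPf (cg g _)) //.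
  by have [] := LsN g (mems _ mjms _ gin).
move=> i ij; rewrite (linZ (aw_lin a _)) EN /N.
have mi : nth 0 ms i \in ms by apply: mem_nth.
have mij : mj != nth 0 ms i by rewrite /mj nth_uniq // eq_sym.
(* The matrix of pairings is diagonal: [mj] differs from [nth 0 ms i] and, by the choice of the
   family, from [s - nth 0 ms i], so no matching exists. *)
rewrite (_ : npair _ _ = 0%N) ?mul0r ?scale0r ?scaler0 //.
apply/eqP; rewrite -leqn0 leqNgt npair_gt0 ?size_cat // perm_cat2l.
apply/negP => /perm_mem /(_ mj); rewrite mem_head !inE (negPf mij) /=.
by rewrite (negPf (msd _ _ mjms mi mij)).
Qed.

End NonzeroCharacter.

Variable gs : seq B.
Hypothesis gsP : forall P : {pred B}, subalg_closed P -> {subset gs <= P} -> P =i predT.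
Hypothesis Vn0 : exists v : V, v != 0.
Hypothesis nM1 : ~ ann S 1.

Theorem graded_single_point :
  exists psi : {lrmorphism B -> C^o}, forall b, ann S (b - (psi b : C)%:A).
Proof.
apply: ideal_point => //; [exact: ann_lin|by move=> b c; apply: ann_mul|].
have [//|[e [ide ne ne']]|[a [na a2]]] := ideal_dichotomy (ann_lin S)
  (fun b c => @ann_mul _ _ _ _ _ _ S b c) nM1 (poly_ann gsP Vn0 nM1).
  by case: (no_idempotent gsP Vn0 nu_gt0 ide ne ne').
have [l0 [v0 [l0v0 v00]]] := exists_weight_vector S Vn0.
case: na; apply: (nil_ann gsP Vn0 nM1) => h c v hh; apply: contrapT => nq.
(* Nilpotency fails for some multiple [a * c], which has its square in M as well and takes the place
   of a. *)
apply: (@no_square_zero (a * c) _ l0 v0 l0v0 v00 h v hh).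
  by rewrite mulrACA; apply: ann_mul.
by move=> q; apply/eqP => q0; apply: nq; exists q.
Qed.

End NoSquareZero.

(** * The full toroidal Lie algebra *)

#[local] Opaque tau_g tau_k tau_d tau_bracket.

Section TauBracket.
Variables (C : numClosedFieldType) (nu : nat) (g : vectType C).
Variables (br : g -> g -> g) (kappa : g -> g -> C^o) (c1 c2 : C) (H : {vspace g}).
Hypotheses (br_bil : is_bilinear br) (kappa_bil : is_bilinear kappa).

Local Notation tb := (tau_bracket (nu := nu) br kappa c1 c2).
Local Notation ct := (tau_cartan_type nu H).

Lemma tb_linl z : linear (tb^~ z). Proof. by case: (tau_bracket_bilinear nu c1 c2 br_bil kappa_bil). Qed.
Lemma tb_linr z : linear (tb z). Proof. exact: (tau_bracket_bilinear nu c1 c2 br_bil kappa_bil).2. Qed.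

Lemma dk_sum0 (m : degree nu) : dk_sum (tau_k g) 0 m = 0.
Proof. by rewrite /dk_sum big1 // => p _; rewrite ffunE scale0r. Qed.

Lemma dk_sum_diag (m : degree nu) : dk_sum (tau_k g) m m = 0.
Proof. exact: tau_k_rel. Qed.

Lemma phi0l a (n : degree nu) b : toroidal_phi (tau_k g) c1 c2 0 a n b = 0.
Proof. by rewrite /toroidal_phi dk_sum0 !scaler0 addr0. Qed.

Definition deg_form (m : degree nu) (h : ct) : C := \sum_i (m i)%:~R * h.2 0 i.

Lemma lin_tau_cartan (M : lmodType C) (F : tau nu g -> M) (h : ct) z0 z (m : degree nu) :
  linear F -> F (tau_g (vsval h.1.1) 0) = z0 -> (forall i, F (tau_k g 0 i) = 0) ->
  (forall i, F (tau_d g 0 i) = (m i)%:~R *: z) ->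
  F (tau_cartan h) = z0 + deg_form m h *: z.
Proof.
move=> Fl e0 ek ed.
have eD a b c : F (a + b + c) = F a + F b + F c by rewrite 2!(linD Fl).
apply: etrans (eD _ _ _) _; rewrite e0 -[z0 in RHS]addr0; congr (_ + _ + _).
  by apply: etrans (lin_sum Fl _ _ _) _; apply: big1 => i _; rewrite (linZ Fl) ek scaler0.
apply: etrans (lin_sum Fl _ _ _) _; rewrite /deg_form scaler_suml; apply: eq_bigr => i _.
by rewrite (linZ Fl) ed scalerA mulrC.
Qed.

Lemma tb_d0_g i y m : tb (tau_d g 0 i) (tau_g y m) = (m i)%:~R *: tau_g y m.
Proof. by rewrite (tau_bracket_dg c1 c2 br_bil kappa_bil 0 i y m) add0r. Qed.

Lemma tb_d0_k i m p : tb (tau_d g 0 i) (tau_k g m p) = (m i)%:~R *: tau_k g m p.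
Proof. by rewrite (tau_bracket_dk c1 c2 br_bil kappa_bil 0 i m p) add0r dk_sum0 scaler0 addr0. Qed.

Lemma tb_d0_d i m p : tb (tau_d g 0 i) (tau_d g m p) = (m i)%:~R *: tau_d g m p.
Proof. by rewrite (tau_bracket_dd c1 c2 br_bil kappa_bil 0 i m p) phi0l add0r ffunE scale0r subr0 addr0. Qed.

Lemma tb_cartan_g (h : ct) y m : tb (tau_cartan h) (tau_g y m) =
  tau_g (br (vsval h.1.1) y) m + deg_form m h *: tau_g y m.
Proof.
apply: (@lin_tau_cartan _ (tb^~ (tau_g y m)) h _ _ _ (tb_linl (tau_g y m))) => [|i|i].
- rewrite (tau_bracket_gg c1 c2 br_bil kappa_bil (vsval h.1.1) 0 y m).
  by rewrite dk_sum0 scaler0 addr0 add0r.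
- exact: (tau_bracket_kg c1 c2 br_bil kappa_bil).
exact: tb_d0_g.
Qed.

Lemma tb_cartan_k (h : ct) m p : tb (tau_cartan h) (tau_k g m p) = deg_form m h *: tau_k g m p.
Proof.
rewrite -[RHS]add0r; apply: (@lin_tau_cartan _ (tb^~ (tau_k g m p)) h _ _ _ (tb_linl (tau_k g m p))) => [|i|i].
- exact: (tau_bracket_gk c1 c2 br_bil kappa_bil).
- exact: (tau_bracket_kk c1 c2 br_bil kappa_bil).
exact: tb_d0_k.
Qed.

Lemma tb_cartan_d (h : ct) m p : tb (tau_cartan h) (tau_d g m p) = deg_form m h *: tau_d g m p.
Proof.
rewrite -[RHS]add0r; apply: (@lin_tau_cartan _ (tb^~ (tau_d g m p)) h _ _ _ (tb_linl (tau_d g m p))) => [|i|i].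
- rewrite (tau_bracket_gd c1 c2 br_bil kappa_bil (vsval h.1.1) 0 m p).
  rewrite (tau_bracket_dg c1 c2 br_bil kappa_bil m p (vsval h.1.1) 0).
  by rewrite ffunE scale0r oppr0.
- rewrite (tau_bracket_kd c1 c2 br_bil kappa_bil 0 i m p).
  rewrite (tau_bracket_dk c1 c2 br_bil kappa_bil m p 0 i).
  by rewrite addr0 dk_sum_diag ffunE scale0r scaler0 addr0 oppr0.
exact: tb_d0_d.
Qed.

Definition e_d (i : 'I_nu.+1) : ct := (0, 0, delta_mx 0 i).

Lemma tau_cartan_e_d i : tau_cartan (e_d i) = tau_d g 0 i.
Proof.
have v0 : vsval (e_d i).1.1 = 0 := linear0 _.
have eg : tau_g (vsval (e_d i).1.1) 0 = 0 :> tau nu g by rewrite v0; exact: lin0 (tau_g_linear 0).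
have ek : \sum_j (e_d i).1.2 0 j *: tau_k g 0 j = 0.
  by apply: big1 => j _; rewrite mxE scale0r.
have ed : \sum_j (e_d i).2 0 j *: tau_d g 0 j = tau_d g 0 i.
  rewrite (bigD1 i) //= mxE !eqxx scale1r big1 ?addr0 // => j ji.
  by rewrite mxE (negPf ji) andbF scale0r.
exact: (etrans (congr2 +%R (etrans (congr2 +%R eg ek) (addr0 0)) ed) (add0r _)).
Qed.

Lemma phi_span (P : tau nu g -> Prop) m a n b : lin_closed P ->
  (forall p, P (tau_k g (m + n) p)) -> P (toroidal_phi (tau_k g) c1 c2 m a n b).
Proof.
move=> Pl Pk; have Pd : P (dk_sum (tau_k g) m (m + n)).
  by apply: (lc_sum Pl) => p _; apply: (lcZ Pl).
by apply: (lcD Pl); apply: (lcZ Pl); apply: (lcZ Pl).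
Qed.

Hypothesis kappa_n0 : exists x y, kappa x y != 0.

(** A derivation with [n p0 != 0] gives the g-part; subtracting it from a bracket with
    [kappa x y != 0] gives [dk_sum], hence the [k_p]. Finally [[t^m d_q, t^n d_q]] has leading
    coefficient [n q - m q], nonzero for some q as [m != n], and the other [d_p] follow from this
    one. *)
Lemma tb_span (P : tau nu g -> Prop) (m n : degree nu) : lin_closed P ->
  m != n -> n != 0 ->
  (forall x y, P (tb (tau_g x m) (tau_g y n))) -> (forall a y, P (tb (tau_d g m a) (tau_g y n))) ->
  (forall a b, P (tb (tau_d g m a) (tau_k g n b))) ->
  (forall a b, P (tb (tau_d g m a) (tau_d g n b))) ->
  [/\ forall x, P (tau_g x (m + n)), forall p, P (tau_k g (m + n) p) & forall p, P (tau_d g (m + n) p)].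
Proof.
move=> Pl mn n0 Pgg Pdg Pdk Pdd.
have nonz (r : degree nu) : r != 0 -> exists p, (r p)%:~R != 0 :> C.
  move=> r0; have [p rp] : exists p, r p != 0.
    apply/existsP; apply: contraNT r0; rewrite negb_exists => /forallP r0.
    by apply/eqP/ffunP => i; rewrite ffunE; apply/eqP; have := r0 i; rewrite negbK.
  by exists p; rewrite intr_eq0.
have [p0 np0] := nonz n n0.
have Pg x : P (tau_g x (m + n)).
  by apply: (lc_cancel Pl np0); have := Pdg p0 x; rewrite (tau_bracket_dg _ _ br_bil kappa_bil).
have PX : P (dk_sum (tau_k g) m (m + n)).
  have [x [y kxy]] := kappa_n0; apply: (lc_cancel Pl kxy).
  have := lcB Pl (Pgg x y) (Pg (br x y)).
  by rewrite (tau_bracket_gg _ _ br_bil kappa_bil) addrAC subrr add0r.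
have Pk p : P (tau_k g (m + n) p).
  apply: (lc_cancel Pl np0); have := lcB Pl (Pdk p0 p) (lcZ Pl (p0 == p)%:R PX).
  by rewrite (tau_bracket_dk _ _ br_bil kappa_bil) addrK.
split=> // p.
have Pdd' a b : P ((n a)%:~R *: tau_d g (m + n) b - (m b)%:~R *: tau_d g (m + n) a).
  have := lcB Pl (Pdd a b) (phi_span a b Pl Pk).
  by rewrite (tau_bracket_dd _ _ br_bil kappa_bil) addrK.
have [q nq] : exists q, (n q - m q)%:~R != 0 :> C.
  have [|q] := nonz (n - m); first by rewrite subr_eq0 eq_sym.
  by rewrite !ffunE => ?; exists q.
have Pq : P (tau_d g (m + n) q).
  by apply: (lc_cancel Pl nq); rewrite rmorphB scalerBl; apply: Pdd'.
have [nq0|nq0] := eqVneq ((n q)%:~R : C) 0; last first.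
  apply: (lc_cancel Pl nq0); have := lcD Pl (Pdd' q p) (lcZ Pl (m p)%:~R Pq).
  by rewrite subrK.
have mq0 : - (m q)%:~R != 0 :> C by move: nq; rewrite rmorphB /= nq0 sub0r.
apply: (lc_cancel Pl mq0); have := lcB Pl (Pdd' p q) (lcZ Pl (n p)%:~R Pq).
by rewrite addrAC subrr add0r scaleNr.
Qed.

End TauBracket.

Lemma zmod_addKr (M : zmodType) (a b : M) : a + b - a = b.
Proof. by rewrite addrAC subrr add0r. Qed.

Lemma scale_opp_pair (R : pzRingType) (M : lmodType R) (k l : R) (a b : M) :
  - k *: a - l *: b = - (k *: a + l *: b).
Proof. by rewrite scaleNr opprD. Qed.

Section LinearPredicates.
Variables (C : fieldType) (X Y Z : lmodType C).

Lemma lin_comp (F : X -> Y) (G : Y -> Z) : linear F -> linear G -> linear (fun z => G (F z)).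
Proof. by move=> Fl Gl k x y; rewrite Fl Gl. Qed.

Lemma lc_comp (F : X -> Y) (P : Y -> Prop) : linear F -> lin_closed P -> lin_closed (fun z => P (F z)).
Proof. by move=> Fl [P0 Pl]; split=> [|k x y Px Py]; [rewrite (lin0 Fl)|rewrite Fl; apply: Pl]. Qed.

Lemma lc_scale (F G : X -> Y) c : linear F -> linear G -> lin_closed (fun z => F z = c *: G z).
Proof.
move=> Fl Gl; split=> [|k x y ex ey]; first by rewrite (lin0 Fl) (lin0 Gl) scaler0.
by rewrite Fl Gl ex ey scalerDr !scalerA mulrC.
Qed.

Lemma lc_ker (F : X -> Y) : linear F -> lin_closed (fun z => F z = 0).
Proof. by move=> Fl; split=> [|k x y ex ey]; [rewrite (lin0 Fl)|rewrite Fl ex ey scaler0 addr0]. Qed.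

End LinearPredicates.

(** * The graded module of a module over tau (x) B *)

Section TauModule.
Variables (C : numClosedFieldType) (nu : nat) (g : vectType C).
Variables (br : g -> g -> g) (kappa : g -> g -> C^o) (c1 c2 : C) (H : {vspace g}).
Hypotheses (br_bil : is_bilinear br) (kappa_bil : is_bilinear kappa).
Hypothesis kappa_n0 : exists x y, kappa x y != 0.
Variables (B : comAlgType C) (V : lmodType C) (rho : tensor (tau nu g) B -> V -> V).

Local Notation tb := (tau_bracket (nu := nu) br kappa c1 c2).
Local Notation ct := (tau_cartan_type nu H).
Local Notation Wt := 'Hom(ct, C^o).
Local Notation T := (tau nu g).

Hypothesis rho_mod : is_lie_module (current_bracket tb (B := B)) rho.
Hypothesis rho_irr : is_irreducible rho.

Definition tact (z : T) (b : B) (v : V) : V := rho (tens z b) v.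
Definition tV (l : Wt) (v : V) : Prop := weight_space (tauB_cartan B) rho l v.

Hypothesis V_sum : is_direct_sum tV.
Hypothesis V_fin : forall l, is_fin_dim_subspace (tV l).

Lemma rho_linl v : linear (rho^~ v). Proof. by case: rho_mod => -[]. Qed.
Lemma rho_linr z : linear (rho z). Proof. by case: rho_mod => -[]. Qed.

Lemma tact_linT b v : linear (fun z => tact z b v).
Proof. by move=> k x y; rewrite /tact (proj1 (@tens_bilinear C T B)) rho_linl. Qed.

Lemma tact_linB z v : linear (fun b => tact z b v).
Proof. by move=> k x y; rewrite /tact (proj2 (@tens_bilinear C T B)) rho_linl. Qed.

Lemma tact_linV z b : linear (tact z b).
Proof. exact: rho_linr. Qed.

Lemma tact_br x y b c v :
  tact (tb x y) (b * c) v = tact x b (tact y c v) - tact y c (tact x b v).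
Proof.
rewrite /tact -(current_bracketE (tau_bracket_bilinear nu c1 c2 br_bil kappa_bil)).
by case: rho_mod => _; apply.
Qed.

Lemma tact0 b v : tact 0 b v = 0. Proof. exact: lin0 (tact_linT b v). Qed.

Lemma tact_irr (W : V -> Prop) : lin_closed W ->
  (forall z b v, W v -> W (tact z b v)) -> (exists2 v, W v & v != 0) -> forall v, W v.
Proof.
move=> Wl Wact [v0 Wv0 v00].
have [|x v /asboolP Wv|W0|WT v] := (proj2 rho_irr) (fun v => `[< W v >]).
- split=> [|k x y /asboolP Wx /asboolP Wy]; apply/asboolP; first by case: Wl.
  exact: (proj2 Wl).
- apply/asboolP; move: x; apply: tens_ind => [|k x y Wx Wy|z b]; last exact: Wact.
    by rewrite (lin0 (rho_linl v)); case: Wl.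
  by rewrite (rho_linl v); apply: (proj2 Wl).
- have : v0 \in pred1 0 by rewrite -W0; apply/asboolP.
  by rewrite inE (negPf v00).
by have /asboolP : v \in (fun v => `[< W v >] : bool) by rewrite WT.
Qed.

Lemma tV_lin l : lin_closed (tV l).
Proof.
split=> [h|k u v lu lv h]; first by rewrite (lin0 (rho_linr _)) scaler0.
by rewrite rho_linr lu lv scalerDr !scalerA mulrC.
Qed.

Lemma deg_form_lin m : linear (deg_form m : ct -> C^o).
Proof.
move=> k h h'; rewrite /deg_form scaler_sumr -big_split; apply: eq_bigr => i _.
by rewrite !mxE mulrDr /= mulrCA.
Qed.

HB.instance Definition _ m :=
  GRing.isLinear.Build C ct (C^o) *:%R (deg_form m : ct -> C^o) (deg_form_lin m).

Definition tdl (m : degree nu) : Wt := linfun (deg_form m : ct -> C^o).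
Definition tev (i : 'I_nu.+1) (l : Wt) : C := l (e_d H i).

Lemma tdlE m h : tdl m h = deg_form m h. Proof. exact: lfunE. Qed.

Lemma tevD i l l' : tev i (l + l') = tev i l + tev i l'.
Proof. by rewrite /tev add_lfunE. Qed.

Lemma tdlD m n : tdl (m + n) = tdl m + tdl n.
Proof.
apply/lfunP => h; rewrite add_lfunE !tdlE /deg_form -big_split; apply: eq_bigr => i _.
by rewrite ffunE rmorphD mulrDl.
Qed.

Lemma tev_dl i m : tev i (tdl m) = (m i)%:~R.
Proof.
rewrite /tev tdlE /deg_form (bigD1 i) //= mxE !eqxx mulr1 big1 ?addr0 // => j ji.
by rewrite mxE (negPf ji) andbF mulr0.
Qed.

(** The grading of g is abstract, and several conditions are imposed only after acting on V: this
    admits both the root decomposition and, when g acts by zero, the grading concentrated in weight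
    0. *)
Variable gw : Wt -> g -> Prop.
Hypothesis gw_lin : forall a, lin_closed (gw a).
Hypothesis gw_br : forall a b x y, gw a x -> gw b y -> gw (a + b) (br x y).
Variables (n : nat) (e : 'I_n -> g) (gal : 'I_n -> Wt).
Hypothesis gw_e : forall i, gw (gal i) (e i).
Hypothesis e_span : forall x, exists c : 'I_n -> C, x = \sum_i c i *: e i.
Hypothesis gw_wt : forall a x m h b v, gw a x ->
  tact (tau_g (br (vsval h.1.1) x) m) b v = (a h : C) *: tact (tau_g x m) b v.
Hypothesis gw_comm : forall x y b v, gw 0 x -> gw 0 y -> tact (tau_g (br x y) 0) b v = 0.
Hypothesis gw_kappa : forall a b x y, gw a x -> gw b y -> a + b != 0 -> kappa x y = 0.
Hypothesis gw_string : forall a x m, gw a x -> a != 0 ->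
  (forall b v, tact (tau_g x m) b v = 0) \/
  (forall l, exists k0, forall k v, (k0 <= k)%N -> tV (l + (a + tdl m) *+ k) v -> v = 0).

(** The span of the homogeneous generators, as an intersection of subspaces, so that linear
    properties need only be checked on generators. *)
Definition thl (a : Wt) (m : degree nu) (z : T) : Prop := forall P : T -> Prop,
  lin_closed P -> (forall x, gw a x -> P (tau_g x m)) ->
  (a = 0 -> (forall p, P (tau_k g m p)) /\ (forall p, P (tau_d g m p))) -> P z.

Lemma thl_lin a m : lin_closed (thl a m).
Proof.
split=> [P [] //|k x y hx hy P Pl Pg P0].
by apply: (proj2 Pl); [apply: hx|apply: hy].
Qed.

Lemma thl_g a x m : gw a x -> thl a m (tau_g x m).
Proof. by move=> gx P _ Pg _; apply: Pg. Qed.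

Lemma thl_k m p : thl 0 m (tau_k g m p).
Proof. by move=> P _ _ /(_ erefl) []. Qed.

Lemma thl_d m p : thl 0 m (tau_d g m p).
Proof. by move=> P _ _ /(_ erefl) []. Qed.

Lemma thl_n0 a m z : a != 0 -> thl a m z -> exists2 x, gw a x & z = tau_g x m.
Proof.
move=> a0 /(_ (fun z => exists2 x, gw a x & z = tau_g x m)).
apply=> [|x gx|/eqP]; [|by exists x|by rewrite (negPf a0)].
split; first by exists 0; [case: (gw_lin a)|rewrite (lin0 (tau_g_linear m))].
move=> k _ _ [x gx ->] [y gy ->]; exists (k *: x + y); first by apply: (proj2 (gw_lin a)).
by rewrite tau_g_linear.
Qed.

Lemma thl_br a m x a' m' y : thl a m x -> thl a' m' y -> thl (a + a') (m + m') (tb x y).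
Proof.
have Pl F : linear F -> lin_closed (fun z : T => thl (a + a') (m + m') (F z)).
  by move=> Fl; apply: (lc_comp Fl); apply: thl_lin.
have cl := thl_lin (a + a') (m + m'); have ad0 b : 0 + b = b :> Wt := add0r b.
have dkP r : a + a' = 0 -> thl (a + a') (m + m') (dk_sum (tau_k g) r (m + m')).
  by move=> e0; apply: (lc_sum cl) => p _; apply: (lcZ cl); rewrite e0; apply: thl_k.
move=> hx hy; apply: (hx (fun x => thl (a + a') (m + m') (tb x y))) => [|{hx}x gx|a0].
- exact: (Pl (tb^~ y) (tb_linl c1 c2 br_bil kappa_bil y)).
- apply: (hy (fun y => thl (a + a') (m + m') (tb (tau_g x m) y))) => [|{hy}y gy|a'0].
  + exact: (Pl (tb (tau_g x m)) (tb_linr c1 c2 br_bil kappa_bil _)).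
  + rewrite (tau_bracket_gg c1 c2 br_bil kappa_bil x m y m').
    apply: (lcD cl); first by apply: thl_g; apply: gw_br.
    have [e0|e0] := eqVneq (a + a') 0; first by apply: (lcZ cl); apply: dkP.
    by rewrite (gw_kappa gx gy e0) scale0r; case: cl.
  split=> p; first by rewrite (tau_bracket_gk c1 c2 br_bil kappa_bil x m m' p); case: cl.
  rewrite (tau_bracket_gd c1 c2 br_bil kappa_bil x m m' p).
  rewrite (tau_bracket_dg c1 c2 br_bil kappa_bil m' p x m).
  apply: (lcN cl); apply: (lcZ cl); rewrite [m + m']addrC; apply: thl_g.
  by rewrite a'0 addr0.
have e0 : a = 0 -> a' = 0 -> a + a' = 0 by move=> -> ->; rewrite addr0.
split=> p.
  apply: (hy (fun y => thl (a + a') (m + m') (tb (tau_k g m p) y))) => [|{hy}y gy|a'0].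
- exact: (Pl (tb (tau_k g m p)) (tb_linr c1 c2 br_bil kappa_bil _)).
- by rewrite (tau_bracket_kg c1 c2 br_bil kappa_bil m p y m'); case: cl.
- have e1 := e0 a0 a'0; split=> q; first by rewrite (tau_bracket_kk c1 c2 br_bil kappa_bil m p m' q); case: cl.
  rewrite (tau_bracket_kd c1 c2 br_bil kappa_bil m p m' q).
  rewrite (tau_bracket_dk c1 c2 br_bil kappa_bil m' q m p) [m' + m]addrC.
  apply: (lcN cl); apply: (lcD cl); apply: (lcZ cl); last exact: dkP.
  by rewrite e1; apply: thl_k.
apply: (hy (fun y => thl (a + a') (m + m') (tb (tau_d g m p) y))) => [|{hy}y gy|a'0].
- exact: (Pl (tb (tau_d g m p)) (tb_linr c1 c2 br_bil kappa_bil _)).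
- rewrite (tau_bracket_dg c1 c2 br_bil kappa_bil m p y m').
  by apply: (lcZ cl); apply: thl_g; rewrite a0 add0r.
have e1 := e0 a0 a'0; split=> q.
  rewrite (tau_bracket_dk c1 c2 br_bil kappa_bil m p m' q).
  apply: (lcD cl); apply: (lcZ cl); last exact: dkP.
  by rewrite e1; apply: thl_k.
rewrite (tau_bracket_dd c1 c2 br_bil kappa_bil m p m' q).
apply: (lcD cl); last first.
  by apply: (phi_span c1 c2 p q cl) => r; rewrite e1; apply: thl_k.
by apply: (lcB cl); apply: (lcZ cl); rewrite e1; apply: thl_d.
Qed.

Lemma thl_cartan a m z h b v : thl a m z ->
  tact (tb (tau_cartan h) z) b v = ((a h : C) + deg_form m h) *: tact z b v.
Proof.
move=> /(_ (fun z => tact (tb (tau_cartan h) z) b v = ((a h : C) + deg_form m h) *: tact z b v)).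
apply=> [|x gx|a0].
- apply: lc_scale; last exact: tact_linT.
  exact: lin_comp (tb_linr c1 c2 br_bil kappa_bil _) (tact_linT b v).
- rewrite (tb_cartan_g c1 c2 br_bil kappa_bil h x m) addrC.
  rewrite (tact_linT b v (deg_form m h) (tau_g x m) (tau_g (br (vsval h.1.1) x) m)).
  by rewrite (gw_wt _ _ _ _ gx) -scalerDl [X in X *: _]addrC.
have a0h : a h = 0 by rewrite a0 lfunE.
rewrite a0h add0r; split=> p.
  by rewrite (tb_cartan_k c1 c2 br_bil kappa_bil) (linZ (tact_linT _ _)).
by rewrite (tb_cartan_d c1 c2 br_bil kappa_bil) (linZ (tact_linT _ _)).
Qed.

Lemma thl_V a m z b l v : thl a m z -> tV l v -> tV (l + (a + tdl m)) (tact z b v).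
Proof.
move=> hz lv h; rewrite -/(tact (tau_cartan h) 1 _).
have E := tact_br (tau_cartan h) z 1 b v.
rewrite (mul1r b) in E.
have {}E := etrans (esym (thl_cartan h b v hz)) E.
move/esym/eqP: E; rewrite subr_eq => /eqP ->; have -> : tact (tau_cartan h) 1 v = (l h : C) *: v by exact: lv.
rewrite (linZ (tact_linV _ _)) -scalerDl !add_lfunE tdlE; congr (_ *: _).
by rewrite addrC.
Qed.

Lemma thl_d_br i a m z b v : thl a m z ->
  tact (tb (tau_d g 0 i) z) b v = (m i)%:~R *: tact z b v.
Proof.
move=> /(_ (fun z => tact (tb (tau_d g 0 i) z) b v = (m i)%:~R *: tact z b v)).
apply=> [|x gx|a0].
- apply: lc_scale; last exact: tact_linT.
  exact: lin_comp (tb_linr c1 c2 br_bil kappa_bil _) (tact_linT b v).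
- by rewrite (tb_d0_g c1 c2 br_bil kappa_bil) (linZ (tact_linT _ _)).
split=> p; rewrite -(linZ (tact_linT _ _)).
  by rewrite (tb_d0_k c1 c2 br_bil kappa_bil).
by rewrite (tb_d0_d c1 c2 br_bil kappa_bil).
Qed.

Lemma thl0_br x y b v : thl 0 0 x -> thl 0 0 y -> tact (tb x y) b v = 0.
Proof.
move=> hx hy.
have lc0 (F : T -> T) : linear F -> lin_closed (fun z => tact (F z) b v = 0).
  by move=> Fl; apply: lc_ker; apply: lin_comp Fl (tact_linT b v).
have zk p q : tact (tau_k g (0 + 0) p) q v = tact (tau_k g 0 p) q v by rewrite addr0.
apply: (hx (fun x => tact (tb x y) b v = 0)) => [|{hx}x gx|_]; first exact: (lc0 (tb^~ y) (tb_linl c1 c2 br_bil kappa_bil y)).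
  apply: (hy (fun y => tact (tb (tau_g x 0) y) b v = 0)) => [|{hy}y gy|_]; first exact: (lc0 (tb _) (tb_linr c1 c2 br_bil kappa_bil _)).
    rewrite (tau_bracket_gg c1 c2 br_bil kappa_bil x 0 y 0) dk_sum0 scaler0 !addr0.
    exact: gw_comm.
  split=> p; first by rewrite (tau_bracket_gk c1 c2 br_bil kappa_bil x 0 0 p) tact0.
  rewrite (tau_bracket_gd c1 c2 br_bil kappa_bil x 0 0 p).
  by rewrite (tb_d0_g c1 c2 br_bil kappa_bil) ffunE scale0r oppr0 tact0.
split=> p.
  apply: (hy (fun y => tact (tb (tau_k g 0 p) y) b v = 0)) => [|{hy}y gy|_].
  - exact: (lc0 (tb _) (tb_linr c1 c2 br_bil kappa_bil _)).
  - by rewrite (tau_bracket_kg c1 c2 br_bil kappa_bil 0 p y 0) tact0.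
  split=> q; first by rewrite (tau_bracket_kk c1 c2 br_bil kappa_bil 0 p 0 q) tact0.
  rewrite (tau_bracket_kd c1 c2 br_bil kappa_bil 0 p 0 q) (tb_d0_k c1 c2 br_bil kappa_bil).
  by rewrite ffunE scale0r oppr0 tact0.
apply: (hy (fun y => tact (tb (tau_d g 0 p) y) b v = 0)) => [|{hy}y gy|_].
- exact: (lc0 (tb _) (tb_linr c1 c2 br_bil kappa_bil _)).
- by rewrite (tb_d0_g c1 c2 br_bil kappa_bil) ffunE scale0r tact0.
split=> q; first by rewrite (tb_d0_k c1 c2 br_bil kappa_bil) ffunE scale0r tact0.
by rewrite (tb_d0_d c1 c2 br_bil kappa_bil) ffunE scale0r tact0.
Qed.

Definition trk := (n + (nu.+1 + nu.+1))%N.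
Definition tu (i : 'I_trk) (m : degree nu) : T :=
  match split i with
  | inl j => tau_g (e j) m
  | inr j => match split j with inl p => tau_k g m p | inr p => tau_d g m p end
  end.
Definition tal (i : 'I_trk) : Wt :=
  match split i with inl j => gal j | inr _ => 0 end.

Lemma tu_g (j : 'I_n) m : exists i, tu i m = tau_g (e j) m.
Proof. by exists (lshift _ j); rewrite /tu (unsplitK (inl j)). Qed.
Lemma tu_k p m : exists i, tu i m = tau_k g m p.
Proof.
exists (rshift n (lshift nu.+1 p)).
by rewrite /tu (unsplitK (inr (lshift nu.+1 p))) (unsplitK (inl p)).
Qed.
Lemma tu_d p m : exists i, tu i m = tau_d g m p /\ tal i = 0.
Proof.
exists (rshift n (rshift nu.+1 p)).
by rewrite /tu /tal (unsplitK (inr (rshift nu.+1 p))) (unsplitK (inr p)).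
Qed.

Lemma thl_u i m : thl (tal i) m (tu i m).
Proof.
rewrite /tal /tu; case: (split i) => [j|j]; first exact: thl_g.
by case: (split j) => p; [exact: thl_k|exact: thl_d].
Qed.

Lemma tu_span_deg (P : T -> Prop) m : lin_closed P -> (forall i, P (tu i m)) ->
  [/\ forall x, P (tau_g x m), forall p, P (tau_k g m p) & forall p, P (tau_d g m p)].
Proof.
move=> Pl Pu; split=> [x|p|p].
- have [c ->] := e_span x; rewrite (lin_sum (tau_g_linear m)).
  apply: (lc_sum Pl) => j _; rewrite (linZ (tau_g_linear m)); apply: (lcZ Pl).
  by have [i <-] := tu_g j m.
- by have [i <-] := tu_k p m.
by have [i [<- _]] := tu_d p m.
Qed.

Lemma tu_span (P : T -> Prop) : lin_closed P -> (forall i m, P (tu i m)) -> forall z, P z.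
Proof.
move=> Pl Pu; have sp m := tu_span_deg Pl (fun i => Pu i m).
apply: tau_ind => [|k x y Px Py|x m|m p|m p]; [by case: Pl|exact: (proj2 Pl)| | |];
  by have [? ? ?] := sp m.
Qed.

Lemma thl_deg a m z : thl a m z -> exists c : 'I_trk -> C, z = \sum_i c i *: tu i m.
Proof.
pose P z := exists c : 'I_trk -> C, z = \sum_i c i *: tu i m.
have Pl : lin_closed P.
  split; first by exists (fun=> 0); rewrite big1 // => i _; rewrite scale0r.
  move=> k _ _ [c ->] [c' ->]; exists (fun i => k * c i + c' i).
  by rewrite scaler_sumr -big_split; apply: eq_bigr => i _; rewrite scalerDl scalerA.
have Pu i : P (tu i m).
  exists (fun j => (j == i)%:R); rewrite (bigD1 i) //= eqxx scale1r big1 ?addr0 // => j ji.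
  by rewrite (negPf ji) scale0r.
have [Pg Pk Pd] := tu_span_deg Pl Pu.
by move=> /(_ P Pl); apply.
Qed.

Lemma tu_br_span (P : T -> Prop) m r : lin_closed P -> m != r -> r != 0 ->
  (forall i j, P (tb (tu i m) (tu j r))) -> forall k, P (tu k (m + r)).
Proof.
move=> Pl mr r0 Pu.
have PF (F : T -> T) : linear F -> lin_closed (fun z => P (F z)) by move/lc_comp; apply.
have Pr i := tu_span_deg (PF _ (tb_linr c1 c2 br_bil kappa_bil (tu i m))) (Pu i).
have Q y : lin_closed (fun z => P (tb z y)) by exact: PF (tb^~ y) (tb_linl c1 c2 br_bil kappa_bil y).
have Pg y := tu_span_deg (Q (tau_g y r)) (fun i => let: And3 h _ _ := Pr i in h y).
have Pk p := tu_span_deg (Q (tau_k g r p)) (fun i => let: And3 _ h _ := Pr i in h p).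
have Pd p := tu_span_deg (Q (tau_d g r p)) (fun i => let: And3 _ _ h := Pr i in h p).
have h1 x y : P (tb (tau_g x m) (tau_g y r)) by have [] := Pg y.
have h2 a y : P (tb (tau_d g m a) (tau_g y r)) by have [] := Pg y.
have h3 a b : P (tb (tau_d g m a) (tau_k g r b)) by have [] := Pk b.
have h4 a b : P (tb (tau_d g m a) (tau_d g r b)) by have [] := Pd b.
have [sg sk sd] := tb_span br_bil kappa_bil kappa_n0 Pl mr r0 h1 h2 h3 h4; move=> k.
rewrite /tu; case: (split k) => [j|j]; first exact: sg.
by case: (split j) => p; [exact: sk|exact: sd].
Qed.

Definition tau_graded_module : graded_module nu T V B Wt.
Proof.
apply: (@GradedModule C nu T V B Wt tb tact tV tev tdl thl trk tu tal (tau_d g 0)).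
- exact: tact_linT.
- exact: tact_linB.
- exact: tact_linV.
- exact: tact_br.
- exact: tact_irr.
- exact: tV_lin.
- exact: V_fin.
- exact: V_sum.
- exact: tevD.
- exact: tdlD.
- exact: tev_dl.
- exact: thl_lin.
- exact: thl_br.
- exact: thl_V.
- exact: thl_deg.
- exact: thl_u.
- by have [i [_ ?]] := tu_d ord0 0; exists i.
- exact: tu_span.
- exact: tu_br_span.
- by move=> i; apply: thl_d.
- by move=> i l v lv; rewrite -(tau_cartan_e_d H); exact: lv.
- exact: thl_d_br.
- move=> x y b c v hx hy; apply/eqP; rewrite -subr_eq0 -tact_br; apply/eqP.
  exact: thl0_br.
move=> a m z hz a0; have [x gx ->] := thl_n0 a0 hz; exact: gw_string.
Defined.

Hypothesis gw_H : forall x, gw 0 x -> forall P : g -> Prop, lin_closed P ->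
  (forall z, (forall b v, tact (tau_g z 0) b v = 0) -> P z) ->
  (forall a y z, a != 0 -> gw a y -> gw (- a) z -> P (br y z)) -> P x.
Hypothesis gw_K : (forall p b v, tact (tau_k g 0 p) b v = 0) \/
  exists a x y, [/\ a != 0, gw a x, gw (- a) y & kappa x y != 0].

Local Notation S := tau_graded_module.

Lemma tau_string_lin : lin_closed (string_type S).
Proof.
split=> [P [] //|k x y sx sy P Pl P0 Pbr].
by apply: (proj2 Pl); [apply: sx|apply: sy].
Qed.

Lemma tau_string_g x : gw 0 x -> string_type S (tau_g x 0).
Proof.
move=> gx P Pl P0 Pbr; apply: (gw_H gx (P := fun x => P (tau_g x 0))).
- exact: lc_comp (tau_g_linear 0) Pl.
- by move=> z z0; apply: P0.
move=> a y z a0 gy gz.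
have hz : thl (- a) (- 0) (tau_g z 0) by rewrite oppr0; exact: thl_g.
have := Pbr a 0 _ _ a0 (thl_g (m := 0) gy) hz; rewrite -[gm_br S]/tb.
by rewrite (tau_bracket_gg c1 c2 br_bil kappa_bil y 0 z 0) dk_sum0 scaler0 !addr0.
Qed.

(** For a root pair x, y the bracket in degrees [unitd p] and [- unitd p] differs from the one in
    degree 0 by [kappa x y] times [k_p]. *)
Lemma tau_string_k p : string_type S (tau_k g 0 p).
Proof.
have [K0 P Pl P0 _|[a [x [y [a0 gx gy kxy]]]] P Pl P0 Pbr] := gw_K; first by apply: P0 => b v; exact: K0.
have h0 : P (tau_g (br x y) 0).
  have hy : thl (- a) (- 0) (tau_g y 0) by rewrite oppr0; exact: thl_g.
  have h : P (tb (tau_g x 0) (tau_g y 0)) := Pbr a 0 _ _ a0 (thl_g (m := 0) gx) hy.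
  by move: h; rewrite (tau_bracket_gg c1 c2 br_bil kappa_bil x 0 y 0) dk_sum0 scaler0 !addr0.
have h1 : P (tb (tau_g x (unitd p)) (tau_g y (- unitd p))) := Pbr a (unitd p) _ _ a0 (thl_g gx) (thl_g gy).
rewrite (tau_bracket_gg c1 c2 br_bil kappa_bil x (unitd p) y (- unitd p)) addrN in h1.
have {h0 h1} h2 := lcB Pl h1 h0.
have {h2} h3 := eq_ind _ P h2 _ (zmod_addKr _ _).
have {h3} := lc_cancel Pl kxy h3.
have -> // : dk_sum (tau_k g) (unitd p) 0 = tau_k g 0 p.
rewrite /dk_sum (bigD1 p) //= ffunE eqxx scale1r big1 ?addr0 // => q qp.
by rewrite ffunE (negPf qp) scale0r.
Qed.

Lemma tau_hl0_decomp z : gm_hl S 0 0 z -> exists xi z', string_type S z' /\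
  forall b v, gm_act S z b v = gm_act S (dxi S xi + z') b v.
Proof.
move=> hz; suff [xi [z' [sz ->]]] : exists xi z', string_type S z' /\ z = dxi S xi + z'.
  by exists xi, z'.
have sl := tau_string_lin.
apply: (hz (fun z => exists xi z', string_type S z' /\ z = dxi S xi + z')) => [|x gx|_].
- split.
    exists (fun=> 0), 0; split; first by case: sl.
    by rewrite /dxi big1 ?addr0 // => i _; rewrite scale0r.
  move=> k _ _ [xi [x [sx ->]]] [xi' [x' [sx' ->]]].
  exists (fun i => k * xi i + xi' i), (k *: x + x'); split; first by apply: (proj2 sl).
  rewrite scalerDr addrACA; congr (_ + _); rewrite /dxi scaler_sumr -big_split.
  by apply: eq_bigr => i _; rewrite scalerDl scalerA.
- exists (fun=> 0), (tau_g x 0); split; first exact: tau_string_g.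
  by rewrite /dxi big1 ?add0r // => i _; rewrite scale0r.
split=> p.
  exists (fun=> 0), (tau_k g 0 p); split; first exact: tau_string_k.
  by rewrite /dxi big1 ?add0r // => i _; rewrite scale0r.
exists (fun i => (i == p)%:R), 0; split; first by case: sl.
rewrite addr0 /dxi (bigD1 p) //= eqxx scale1r big1 ?addr0 // => i ip.
by rewrite (negPf ip) scale0r.
Qed.

(** The cocycle contributes only a combination of the [k_p] in degree 0, which is of string type. *)
Lemma tau_td_pair i j (m : degree nu) : exists x y z',
  [/\ gm_hl S 0 m x, gm_hl S 0 (- m) y, string_type S z' &
  forall b v, gm_act S (gm_br S x y) b v =
    gm_act S (- ((m i)%:~R *: gm_d S j + (m j)%:~R *: gm_d S i) + z') b v].
Proof.
exists (tau_d g m i), (tau_d g (- m) j), (toroidal_phi (tau_k g) c1 c2 m i (- m) j); split.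
- exact: thl_d.
- exact: thl_d.
- by apply: (phi_span c1 c2 i j tau_string_lin) => p; rewrite addrN; apply: tau_string_k.
move=> b v; congr (tact _ b v).
apply: etrans (tau_bracket_dd c1 c2 br_bil kappa_bil m i (- m) j) _; rewrite (addrN m).
congr (_ + _); rewrite (_ : ((- m) i)%:~R = - (m i)%:~R :> C); first exact: scale_opp_pair.
by rewrite ffunE rmorphN.
Qed.

Lemma tau_single_point (gs : seq B) : (0 < nu)%N ->
  (forall P : {pred B}, subalg_closed P -> {subset gs <= P} -> P =i predT) ->
  ~ (forall z b v, tact z b v = 0) ->
  exists psi : {lrmorphism B -> C^o}, forall z b v, tact z b v = (psi b : C) *: tact z 1 v.
Proof.
move=> nu0 gsP nM; have nM1 : ~ ann S 1 by move=> M1; apply: nM => z b v; rewrite -[b]mul1r; apply: M1.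
have [psi psiP] := graded_single_point tau_hl0_decomp tau_td_pair nu0 gsP (proj1 rho_irr) nM1.
exists psi => z b v; have := psiP b z 1 v; rewrite mulr1 -[gm_act S]/tact => /eqP.
by rewrite (linB (tact_linB z v)) (linZ (tact_linB z v)) subr_eq0 => /eqP.
Qed.

End TauModule.

(** * Root strings *)

Section WeightStrings.
Variables (C : numClosedFieldType) (V : lmodType C) (I : zmodType) (Vw : I -> V -> Prop).
Hypothesis Vw_lin : forall l, lin_closed (Vw l).
Hypothesis Vw_fin : forall l, is_fin_dim_subspace (Vw l).
Variables (E F : V -> V) (b : I) (lam : I -> C) (c : C).
Hypotheses (E_lin : linear E) (F_lin : linear F).
Hypothesis E_V : forall m, wmaps Vw m (m + b) E.
Hypothesis F_V : forall m, wmaps Vw m (m - b) F.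
Hypothesis lamD : forall m, lam (m + b) = lam m + c.
Hypothesis EF : forall m v, Vw m v -> E (F v) = F (E v) + lam m *: v.
Hypothesis E_nil : forall v, exists q, iter q E v = 0.
Hypothesis F_nil : forall v, exists q, iter q F v = 0.

Lemma last_nonzero (G : V -> V) v : v != 0 -> (exists q, iter q G v = 0) ->
  exists q, iter q G v != 0 /\ iter q.+1 G v = 0.
Proof.
move=> v0 [q0 q0P].
have ex : exists q, iter q G v == 0 by exists q0; apply/eqP.
have [[|q] /eqP e qmin] := ex_minnP ex; first by rewrite -e eqxx in v0.
by exists q; split=> //; apply/negP => /qmin; rewrite ltnn.
Qed.

Lemma lamDn m k : lam (m + b *+ k) = lam m + c *+ k.
Proof. by elim: k => [|k IHk]; rewrite ?addr0 // !mulrSr !addrA lamD IHk. Qed.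

Lemma lamBn m k : lam (m - b *+ k) = lam m - c *+ k.
Proof. by rewrite -{2}[m](subrK (b *+ k)) lamDn addrK. Qed.

Lemma iterE_V m k : wmaps Vw m (m + b *+ k) (iter k E).
Proof.
move=> v mv; elim: k => [|k IHk]; first by rewrite addr0.
by rewrite mulrSr addrA; apply: E_V.
Qed.

Lemma iterF_V m k : wmaps Vw m (m - b *+ k) (iter k F).
Proof.
move=> v mv; elim: k => [|k IHk]; first by rewrite subr0.
by rewrite mulrSr opprD addrA; apply: F_V.
Qed.

Lemma bin2_double n : 2 * 'C(n.+1, 2)%:R = n.+1%:R * n%:R :> C.
Proof. by rewrite -!natrM -mul_bin_diag bin1. Qed.

(** For c nonzero E, F and [lam] behave as in sl2, for c = 0 as in a Heisenberg algebra; this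
    coefficient covers both. *)
Definition raise_coef (x : C) (i : nat) : C := i%:R * x - c * 'C(i, 2)%:R.

Lemma E_iterF m w i : Vw m w -> E w = 0 ->
  E (iter i.+1 F w) = raise_coef (lam m) i.+1 *: iter i F w.
Proof.
move=> mw Ew; elim: i => [|i IHi].
  by rewrite /= (EF mw) Ew (lin0 F_lin) add0r /raise_coef mul1r bin_small // mulr0 subr0.
rewrite iterS (EF (iterF_V i.+1 mw)) IHi (linZ F_lin) -iterS -scalerDl lamBn.
congr (_ *: _); rewrite /raise_coef [in RHS]binS bin1 natrD -mulr_natr.
by ring.
Qed.

(* A vector killed by [E] generates a string of length [2 lam / c]. *)
Lemma highest_weight m w : Vw m w -> w != 0 -> E w = 0 ->
  exists n, iter n F w != 0 /\ 2 * lam m = c * n%:R.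
Proof.
move=> mw w0 Ew; have [n [nz z]] := last_nonzero w0 (F_nil w); exists n; split=> //.
have /eqP := E_iterF n mw Ew; rewrite z (lin0 E_lin) eq_sym scaler_eq0 (negPf nz) orbF.
rewrite /raise_coef subr_eq0 => /eqP e; have n0 : n.+1%:R != 0 :> C by rewrite pnatr_eq0.
apply: (mulfI n0); rewrite mulrCA e mulrCA bin2_double; ring.
Qed.

Lemma highest_vector m v : Vw m v -> v != 0 ->
  exists j w, [/\ Vw (m + b *+ j) w, w != 0 & E w = 0].
Proof.
move=> mv v0; have [j [nz z]] := last_nonzero v0 (E_nil v).
by exists j, (iter j E v); split=> //; apply: iterE_V.
Qed.

(** For c = 0 the length formula of [highest_weight] reads [2 * lam = 0], and [lam] is constant
    along the string. *)
Lemma heisenberg_lam m v : c = 0 -> Vw m v -> v != 0 -> lam m = 0.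
Proof.
move=> c0 mv v0; have [j [w [jw w0 Ew]]] := highest_vector mv v0.
have [n [_ /eqP]] := highest_weight jw w0 Ew.
by rewrite lamDn c0 mul0rn addr0 mul0r mulf_eq0 pnatr_eq0 => /eqP.
Qed.

(** Otherwise highest vectors w of weight [l + b *+ k] exist for arbitrarily large k, and their
    strings reach a nonzero vector [iter k F w] of weight l. It is an eigenvector of FE with
    eigenvalue [k (z + k + 1) c / 2], where [z = 2 lam(l) / c] is a fixed integer. This is unbounded
    in k, while the weight space of l has finite dimension. *)
Lemma finite_string l : c != 0 ->
  exists k0, forall k v, (k0 <= k)%N -> Vw (l + b *+ k) v -> v = 0.
Proof.
move=> c0; apply: contrapT => H.
have high K : exists k w n, [/\ (K <= k)%N, Vw (l + b *+ k) w, E w = 0, iter n F w != 0 &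
    2 * lam l / c = (n%:Z - (k *+ 2)%:Z)%:~R].
  apply: contrapT => nh; apply: H; exists K => k v Kk kv; apply/eqP/negPn/negP => v0.
  apply: nh; have [j [w [jw w0 Ew]]] := highest_vector kv v0.
  rewrite -addrA -mulrnDr in jw; have [n [nz e]] := highest_weight jw w0 Ew.
  exists (k + j)%N, w, n; split=> //; first by rewrite (leq_trans Kk) ?leq_addr.
  apply: (mulIf c0); rewrite divfK //; move: e; rewrite lamDn mulrDr => /(canRL (addrK _)) ->.
  by rewrite rmorphB /= -!pmulrn -(mulr_natl c) mulr2n natrD; ring.
have [k1 [_ [n1 [_ _ _ _ qE]]]] := high 0%N; set z : int := _ - _ in qE; clearbody z.
have FEl : linear (fun v => F (E v)) by move=> k x y; rewrite E_lin F_lin.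
have FEm : wmaps Vw l l (fun v => F (E v)) by move=> v /E_V /F_V; rewrite addrK.
have [s sP] := weigen_finite Vw_lin Vw_fin FEl FEm.
have [K KP] := int_seq_bound [seq 2 * x / c | x <- s].
have [k [w [n [kK kw Ew nz q2]]]] := high (K + `|z| + 1)%N.
have en : n%:Z - (k *+ 2)%:Z = z by apply/eqP; rewrite -(eqr_int C) -q2 qE.
have kn : (k <= n)%N by lia.
have wk0 : iter k F w != 0.
  apply: contra nz => /eqP e; rewrite -(subnK kn) iterD e; apply/eqP.
  exact: lin0 (iter_lin _ F_lin).
have lw : Vw l (iter k F w) by rewrite -[l](addrK (b *+ k)); apply: iterF_V.
case: k kK kw q2 en kn wk0 lw => [|k] kK kw q2 en kn wk0 lw; first lia.
have := sP _ _ lw wk0 _; rewrite (E_iterF k kw Ew) (linZ F_lin) -iterS => /(_ _ erefl) ds.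
have : (`|(k.+1%:Z * (z + k.+1%:Z + 1))%R| <= K)%N.
  apply: KP; apply/mapP; exists (raise_coef (lam (l + b *+ k.+1)) k.+1) => //.
  have e2 : 2 * lam l = c * z%:~R by rewrite -qE [RHS]mulrC divfK.
  apply: (mulIf c0); rewrite divfK // /raise_coef lamDn mulrBr [X in _ - X]mulrCA bin2_double.
  rewrite rmorphM !rmorphD /= -!pmulrn -(mulr_natl c).
  have -> : 2 * (k.+1%:R * (lam l + k.+1%:R * c)) = k.+1%:R * (2 * lam l) + 2 * k.+1%:R * k.+1%:R * c.
    by ring.
  by rewrite e2 -(natr1 k); ring.
rewrite abszM => h; have p : (0 < `|(z + k.+1%:Z + 1)%R|)%N by lia.
by have := leq_trans (leq_pmulr `|k.+1%:Z|%N p) h; lia.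
Qed.

End WeightStrings.

(** * Nontrivial action of g *)

(** A subspace inside P of maximal dimension is all of P, since any further vector of P could be
    adjoined. *)
Lemma vspace_of_pred (C : fieldType) (g : vectType C) (P : g -> Prop) :
  lin_closed P -> exists U : {vspace g}, forall x, x \in U <-> P x.
Proof.
move=> Pl; pose ok k := `[< exists U : {vspace g}, \dim U = k /\ forall x, x \in U -> P x >].
have ok0 : ok 0%N.
  apply/asboolP; exists 0%VS; split; first exact: dimv0.
  by move=> x; rewrite memv0 => /eqP ->; case: Pl.
have okb k : ok k -> (k <= \dim {: g})%N by move=> /asboolP [U [<- _]]; apply: dimvS; apply: subvf.
have [k /asboolP [U [dU UP]] kmax] := ex_maxnP (ex_intro _ 0%N ok0) okb.
exists U => x; split=> [/UP //|Px]; apply: contraT => xU.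
have /kmax : ok k.+1; last by rewrite ltnn.
apply/asboolP; exists (U + <[x]>)%VS; split.
  rewrite dimv_disjoint_sum ?dU; last first.
    apply/eqP; rewrite -subv0; apply/subvP => y; rewrite memv_cap memv0 => /andP [yU /vlineP [t yt]].
    apply: contraNT xU => y0; have t0 : t != 0 by apply: contraNneq y0 => t0; rewrite yt t0 scale0r.
    by rewrite -[x](scalerK t0) memvZ // -yt.
  rewrite dim_vline; have -> : x != 0 by apply: contraNneq xU => ->; apply: mem0v.
  by rewrite addn1.
by move=> y /memv_addP [u uU [w /vlineP [t ->] ->]]; apply: lcD => //; [apply: UP|apply: lcZ].
Qed.

Lemma simple_ideal (C : fieldType) (g : vectType C) (br : g -> g -> g) (P : g -> Prop) :
  is_simple_lie br -> lin_closed P -> (forall x y, P y -> P (br x y)) ->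
  (exists2 x, P x & x != 0) -> forall x, P x.
Proof.
move=> [_ _ ideals] Pl Pbr [x0 Px0 x00] x; have [U UP] := vspace_of_pred Pl.
have [x1 y /UP Py|U0|UT] := ideals U; first by apply/UP/Pbr.
  by move/UP: Px0; rewrite U0 memv0 (negPf x00).
by apply/UP; rewrite UT memvf.
Qed.

(** * Simultaneous eigenspaces *)

Section EigenDecomposition.
Variables (C : closedFieldType) (g : vectType C).

Definition shift_op (F : g -> g) (c : C) (y : g) : g := F y - c *: y.

Lemma shift_op_lin F c : linear F -> linear (shift_op F c).
Proof.
move=> Fl k x y; rewrite /shift_op Fl scalerDr !scalerA [c * k]mulrC -scalerA opprD scalerBr.
by rewrite -!addrA; congr (_ + _); rewrite addrCA.
Qed.

Lemma shift_op_comm F c c' y : linear F ->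
  shift_op F c (shift_op F c' y) = shift_op F c' (shift_op F c y).
Proof.
move=> Fl; rewrite /shift_op !(linB Fl) !(linZ Fl) !scalerBr !scalerA [c * c']mulrC.
by rewrite !opprB -!addrA; congr (_ + _); rewrite [LHS]addrCA [RHS]addrCA; congr (_ + _); exact: addrC.
Qed.

Fixpoint shift_ops (F : g -> g) (s : seq C) (y : g) : g :=
  if s is c :: s' then shift_op F c (shift_ops F s' y) else y.

Lemma shift_ops_lin F s : linear F -> linear (shift_ops F s).
Proof. by move=> Fl; elim: s => //= c s IHs k x y; rewrite IHs shift_op_lin. Qed.

Lemma shift_ops_comm F c s y : linear F ->
  shift_op F c (shift_ops F s y) = shift_ops F s (shift_op F c y).
Proof. by move=> Fl; elim: s => //= c' s IHs; rewrite shift_op_comm // IHs. Qed.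

Lemma annihilating_roots F : linear F -> exists s, forall y, shift_ops F s y = 0.
Proof.
move=> Fl; pose co y := \row_i coord (vbasis {:g}) i y.
have col : linear co by move=> k x y; apply/rowP => i; rewrite !mxE linearP.
have coE y : y = \sum_i co y 0 i *: (vbasis {:g})`_i.
  by rewrite {1}(coord_vbasis (memvf y)); apply: eq_bigr => i _; rewrite mxE.
pose A := \matrix_(i < \dim {:g}) co (F (vbasis {:g})`_i).
have AE y : co (F y) = co y *m A.
  rewrite {1}(coE y) (lin_sum Fl) (lin_sum col) mulmx_sum_row.
  by apply: eq_bigr => i _; rewrite (linZ Fl) (linZ col) rowK.
have [s sP] : exists s : seq C, foldr (fun c (D : 'M_(\dim {:g})) => (A - c%:M) *m D) 1%:M s = 0.
  move: (A); case: (\dim {:g}) => [|n] A'; first by exists [::]; apply: flatmx0.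
  have [s sE] := closed_field_poly_normal (char_poly A'); exists s.
  have := Cayley_Hamilton A'; rewrite sE (monicP (char_poly_monic A')) scale1r rmorph_prod /=.
  move=> <-; elim: (s) => [|c s' IHs]; first by rewrite big_nil.
  by rewrite big_cons /= IHs rmorphB /= horner_mx_X horner_mx_C.
exists s => y; suff e : co (shift_ops F s y) = 0.
  by rewrite (coE (shift_ops F s y)) e big1 // => i _; rewrite mxE scale0r.
rewrite -[RHS](mulmx0 _ (co y)) -sP; elim: (s) y => [|c s' IHs] y /=; first by rewrite mulmx1.
rewrite shift_ops_comm // IHs mulmxA /shift_op (linB col) (linZ col) AE mulmxBr.
by rewrite mul_mx_scalar.
Qed.

Variable F : g -> g.
Hypothesis F_lin : linear F.

Lemma shift_ops_eigen s c y : F y = c *: y ->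
  shift_ops F s y = (\prod_(c' <- s) (c - c')) *: y.
Proof.
move=> Fy; elim: s => [|c' s IHs]; first by rewrite big_nil scale1r.
by rewrite /= IHs /shift_op (linZ F_lin) Fy big_cons !scalerA -scalerBl mulrBl [c * _]mulrC.
Qed.

Variable W : g -> Prop.
Hypothesis W_lin : lin_closed W.
Hypothesis W_F : forall y, W y -> W (F y).
Hypothesis F_semisimple : forall c y, shift_op F c (shift_op F c y) = 0 -> shift_op F c y = 0.

Lemma W_shift_ops s y : W y -> W (shift_ops F s y).
Proof.
by move=> Wy; elim: s => //= c s IHs; apply: lcB => //; [exact: W_F|apply: lcZ].
Qed.

(** Induction on a list of shifts killing x. A repeated shift is dropped by semisimplicity; a simple
    one splits off an eigencomponent, obtained by applying the other shifts and dividing by the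
    product of differences. *)
Lemma eigen_decomp (P : g -> Prop) : lin_closed P ->
  (forall c y, W y -> F y = c *: y -> P y) -> forall x, W x -> P x.
Proof.
move=> Pl PW; have [s0 s0P] := annihilating_roots F_lin; move=> x Wx; move: (s0P x) => {s0P}.
have [n] := ubnP (size s0); elim: n s0 x Wx => // n IHn [|c s] x Wx /=; rewrite ltnS => sn.
  by move=> ->; case: Pl.
move=> sx; have [cs|cs] := boolP (c \in s).
  have /permP ps := perm_to_rem cs.
  have rE y : shift_ops F s y = shift_op F c (shift_ops F (rem c s) y).
    elim: (s) cs {ps} => //= c' s' IHs; rewrite inE eq_sym; case: eqVneq => [-> //|_] /= /IHs ->.
    exact: shift_op_comm.
  apply: (IHn s x) => //; rewrite rE; apply: F_semisimple.
  by rewrite -rE.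
set y := shift_ops F s x in sx; have Fy : F y = c *: y.
  by apply/eqP; rewrite -subr_eq0; apply/eqP; exact: sx.
pose k := \prod_(c' <- s) (c - c'); have k0 : k != 0.
  rewrite prodf_seq_neq0; apply/allP => c' c's /=; rewrite subr_eq0.
  by apply: contraNneq cs => ->.
have Wy : W y by apply: W_shift_ops.
rewrite -[x](subrK (k^-1 *: y)); apply: lcD => //; last by apply: lcZ => //; apply: PW Fy.
apply: (IHn s) => //; first by apply: lcB => //; apply: lcZ.
by rewrite (linB (shift_ops_lin s F_lin)) (linZ (shift_ops_lin s F_lin)) (shift_ops_eigen s Fy) scalerA mulVf // scale1r subrr.
Qed.

End EigenDecomposition.

Lemma simultaneous_eigen (C : closedFieldType) (g : vectType C) (K : Type) (ops : K -> g -> g)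
  (ks : seq K) (P W : g -> Prop) : (forall k, linear (ops k)) ->
  (forall k c y, shift_op (ops k) c (shift_op (ops k) c y) = 0 -> shift_op (ops k) c y = 0) ->
  (forall k k' y, ops k (ops k' y) = ops k' (ops k y)) ->
  lin_closed W -> (forall k y, W y -> W (ops k y)) -> lin_closed P ->
  (forall y, W y -> (foldr (fun k Q => (exists c, ops k y = c *: y) /\ Q) True ks) -> P y) ->
  forall x, W x -> P x.
Proof.
move=> ol oss ocom + + Pl; elim: ks W => [|k ks IHks] W Wl Ws PW; first by move=> x Wx; apply: PW.
apply: (eigen_decomp (ol k) Wl (Ws k) (oss k) Pl) => c x Wx xc.
apply: (IHks (fun y => W y /\ ops k y = c *: y)) => // [|k' y [Wy yc]|y [Wy yc] Q].
- split=> [|t u v [Wu uc] [Wv vc]]; first by split; [case: Wl|rewrite (lin0 (ol k)) scaler0].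
  by split; [apply: (proj2 Wl)|rewrite ol uc vc scalerDr !scalerA mulrC].
- by split; [exact: Ws|rewrite ocom yc (linZ (ol k'))].
by apply: PW => //; split=> //; exists c.
Qed.

(** [is_direct_sum] allows repeated indices in a decomposition; terms of equal index coincide and
    merge into a multiple. *)
Lemma direct_sum_uniq (C : fieldType) (V : lmodType C) (I : eqType) (Vw : I -> V -> Prop) v :
  (forall l, lin_closed (Vw l)) -> is_direct_sum Vw ->
  exists (s : seq I) (w : I -> V), [/\ uniq s, forall i, Vw i (w i) & v = \sum_(i <- s) w i].
Proof.
move=> Vl [sp _]; have [s [w [wV ->]]] := sp v.
exists (undup s), (fun i => w i *+ count_mem i s); split; first exact: undup_uniq.
  by move=> i; rewrite -scaler_nat; apply: lcZ.
by rewrite -(big_undup_iterop_count _ s); apply: eq_bigr => i _.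
Qed.

(** * The structure of g read off from V *)

Section GStructure.
Variables (C : numClosedFieldType) (nu : nat) (g : vectType C).
Variables (br : g -> g -> g) (kappa : g -> g -> C^o) (c1 c2 : C) (H : {vspace g}).
Hypotheses (br_simple : is_simple_lie br) (H_cartan : is_cartan br H).
Hypothesis kappa_form : is_invariant_form br kappa.
Variables (B : comAlgType C) (V : lmodType C) (rho : tensor (tau nu g) B -> V -> V).

Local Notation tb := (tau_bracket (nu := nu) br kappa c1 c2).
Local Notation ct := (tau_cartan_type nu H).
Local Notation Wt := 'Hom(ct, C^o).
Local Notation tact := (tact rho).
Local Notation tV := (tV (H := H) rho).

Hypothesis rho_mod : is_lie_module (current_bracket tb (B := B)) rho.
Hypothesis V_sum : is_direct_sum tV.
Hypothesis V_fin : forall l, is_fin_dim_subspace (tV l).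
Hypothesis root_nil : forall z b v, root_vector br H z -> exists q, iter q (rho (tens z b)) v = 0.
Hypothesis g_nontriv : exists x m b v, tact (tau_g x m) b v != 0.

Lemma br_bil : is_bilinear br. Proof. by case: br_simple => -[]. Qed.
Lemma kappa_bil : is_bilinear kappa. Proof. by case: kappa_form. Qed.
Lemma br_linl y : linear (br^~ y). Proof. by case: br_bil. Qed.
Lemma br_linr x : linear (br x). Proof. by case: br_bil. Qed.
Lemma kappa_linl y : linear (kappa^~ y). Proof. by case: kappa_bil. Qed.
Lemma kappa_linr x : linear (kappa x). Proof. by case: kappa_bil. Qed.

Lemma br_anti x y : br x y = - br y x.
Proof.
have [[_ br0 _] _ _] := br_simple; apply/eqP; rewrite -addr_eq0.
have := br0 (x + y); rewrite (linD (br_linl _)) !(linD (br_linr _)) !br0 add0r addr0.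
by move=> ->.
Qed.

Lemma br_jacobi x y z : br x (br y z) = br (br x y) z + br y (br x z).
Proof.
have [[_ _ jac] _ _] := br_simple; apply/eqP; rewrite -subr_eq0 opprD addrA.
rewrite (br_anti (br x y) z) opprK addrAC (br_anti x z) (linN (br_linr _)) opprK.
by rewrite jac.
Qed.

Lemma kappa_n0 : exists x y, kappa x y != 0.
Proof.
have [[_ _ _] [x [y xy]] _] := br_simple; have [_ _ _ nd] := kappa_form.
apply: contrapT => nk; move/eqP: xy; apply; apply: nd => z; apply/eqP/negPn/negP => k.
by apply: nk; exists (br x y), z.
Qed.

Lemma tb_g0_g x y m : tb (tau_g x 0) (tau_g y m) = tau_g (br x y) m.
Proof.
rewrite (tau_bracket_gg c1 c2 br_bil kappa_bil x 0 y m) dk_sum0 scaler0 addr0.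
by rewrite add0r.
Qed.

(* Locked so that failing unifications do not unfold the tensor products. *)
Fact gact_key : unit. Proof. by []. Qed.
Definition gact := locked_with gact_key (fun (x : g) (m : degree nu) (b : B) (v : V) => tact (tau_g x m) b v).

Lemma gactE x m b v : gact x m b v = tact (tau_g x m) b v.
Proof. by rewrite /gact unlock. Qed.

Lemma gact_lin x m b : linear (gact x m b).
Proof. by move=> k v w; rewrite 3!gactE; apply: (tact_linV rho_mod). Qed.

Lemma gact_linl m b v : linear (fun x => gact x m b v).
Proof.
move=> k x y; rewrite 3!gactE.
exact: (lin_comp (tau_g_linear m) (tact_linT rho_mod b v)).
Qed.

Lemma gact_br x y m b v :
  gact (br x y) m b v = gact x 0 1 (gact y m b v) - gact y m b (gact x 0 1 v).
Proof.
rewrite 5!gactE -tb_g0_g; have := tact_br br_bil kappa_bil rho_mod (tau_g x 0) (tau_g y m) 1 b v.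
by rewrite (mul1r b).
Qed.

Lemma gact_br_killr x y m b v :
  (forall w, gact y m b w = 0) -> gact (br x y) m b v = 0.
Proof. by move=> y0; rewrite gact_br !y0 (lin0 (gact_lin _ _ _)) subr0. Qed.

Lemma gact_br_killl x y m b v :
  (forall w, gact x 0 1 w = 0) -> gact (br x y) m b v = 0.
Proof. by move=> x0; rewrite gact_br !x0 (lin0 (gact_lin _ _ _)) subr0. Qed.

Lemma lc_kill m b : lin_closed (fun x => forall v, gact x m b v = 0).
Proof.
split=> [v|k x y x0 y0 v]; first exact: lin0 (gact_linl m b v).
by rewrite (gact_linl m b v) x0 y0 scaler0 addr0.
Qed.

(** The kernel is an ideal. Were it all of g, then for each m and b the x such that
    [x (x) t^m (x) b] kills V would form an ideal containing all brackets, hence all of g, against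
    [g_nontriv]. *)
Lemma g_faithful x : (forall v, gact x 0 1 v = 0) -> x = 0.
Proof.
move=> x0; apply/eqP/negPn/negP => nx0.
have N_all : forall y, forall v, gact y 0 1 v = 0.
  apply: (simple_ideal br_simple (lc_kill 0 1)) => [y z z0 v|]; last by exists x.
  exact: gact_br_killr.
have [[_ _ _] [y [z yz]] _] := br_simple; have [w [m [b [v /eqP]]]] := g_nontriv; rewrite -gactE; apply.
move: w v; apply: (simple_ideal br_simple (lc_kill m b)) => [w w' w0 v|].
  exact: gact_br_killr.
by exists (br y z) => // v; apply: gact_br_killl.
Qed.

Definition hct (h : subvs_of H) : ct := (h, 0, 0).

Lemma tau_cartan_hct h : tau_cartan (hct h) = tau_g (vsval h) 0.
Proof.
have e1 : \sum_i (hct h).1.2 0 i *: tau_k g 0 i = 0 by apply: big1 => i _; rewrite mxE scale0r.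
have e2 : \sum_i (hct h).2 0 i *: tau_d g 0 i = 0 by apply: big1 => i _; rewrite mxE scale0r.
exact: (etrans (congr2 +%R (etrans (congr2 +%R erefl e1) (addr0 _)) e2) (addr0 _)).
Qed.

Lemma tact_cartan h l v : tV l v -> tact (tau_cartan h) 1 v = (l h : C) *: v.
Proof. by move=> lv; exact: lv. Qed.

Lemma tact_h h l v : tV l v -> gact (vsval h) 0 1 v = (l (hct h) : C) *: v.
Proof. by move=> lv; rewrite gactE -tau_cartan_hct; apply: tact_cartan. Qed.

Lemma faithful_on_weights x : (forall l v, tV l v -> gact x 0 1 v = 0) -> x = 0.
Proof.
move=> H0; apply: g_faithful; apply: (wind V_sum) => //.
exact: lc_ker (gact_lin _ _ _).
Qed.

(** [is_cartan] provides nilpotency and self-normalization only; commutativity and, next,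
    semisimplicity come from the faithful action on weight vectors. *)
Lemma cartan_abelian (h h' : subvs_of H) : br (vsval h) (vsval h') = 0.
Proof.
apply: faithful_on_weights => l v lv; rewrite gact_br (tact_h h' lv) (tact_h h lv).
rewrite !(linZ (gact_lin _ _ _)) (tact_h h' lv) (tact_h h lv) !scalerA mulrC.
exact: subrr.
Qed.

(** For v of weight l put [e = l(h) + c]. The hypothesis on y gives [(h - e)^2 (y v) = 0]; as h is
    diagonal on V, already [(h - e) (y v) = 0], and this is the shifted y acting on v. *)
Lemma cartan_semisimple (h : subvs_of H) c y :
  shift_op (br (vsval h)) c (shift_op (br (vsval h)) c y) = 0 -> shift_op (br (vsval h)) c y = 0.
Proof.
set z := shift_op _ c y => hz; have hz' : br (vsval h) z = c *: z.
  by apply/eqP; rewrite -subr_eq0; apply/eqP.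
have hy : br (vsval h) y = c *: y + z by rewrite /z /shift_op addrC subrK.
apply: faithful_on_weights => l v lv.
have tl x := gact_lin x 0 1.
pose e : C := (l (hct h) : C) + c; pose Hh := gact (vsval h) 0 1; have Hl : linear Hh := tl _.
have hx x : Hh (gact x 0 1 v) = gact (br (vsval h) x) 0 1 v + (l (hct h) : C) *: gact x 0 1 v.
  by rewrite gact_br (tact_h h lv) (linZ (tl _)) subrK.
have Zv : gact z 0 1 v = Hh (gact y 0 1 v) - e *: gact y 0 1 v.
  rewrite hx hy (gact_linl 0 1 v c y z) /e scalerDl.
  set Y := gact y 0 1 v; set Z := gact z 0 1 v.
  by rewrite opprD addrA addrK addrAC subrr add0r.
have HZ : Hh (gact z 0 1 v) - e *: gact z 0 1 v = 0.
  rewrite hx hz' (linZ (gact_linl 0 1 v)) /e scalerDl [c *: _ + _]addrC.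
  exact: subrr.
have [s [w [us wV Yw]]] := direct_sum_uniq (gact y 0 1 v) (tV_lin rho_mod) V_sum.
have Hw i : Hh (w i) - e *: w i = ((i (hct h) : C) - e) *: w i.
  by rewrite /Hh (tact_h h (wV i)) scalerBl.
have E1 : gact z 0 1 v = \sum_(i <- s) ((i (hct h) : C) - e) *: w i.
  rewrite Zv Yw (lin_sum Hl) scaler_sumr -sumrB.
  by apply: eq_bigr => i _; rewrite -Hw.
have E2 : \sum_(i <- s) ((i (hct h) : C) - e) *: (((i (hct h) : C) - e) *: w i) = 0.
  apply: etrans _ HZ; rewrite E1 (lin_sum Hl) scaler_sumr -sumrB.
  by apply: eq_bigr => i _; rewrite (linZ Hl) -[in LHS]Hw scalerBr !scalerA [e * _]mulrC.
rewrite E1 big_seq big1 // => i si; have [_ ind] := V_sum.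
have wV2 j : tV j (((j (hct h) : C) - e) *: (((j (hct h) : C) - e) *: w j)).
  by apply: (lcZ (tV_lin rho_mod j)); apply: (lcZ (tV_lin rho_mod j)).
have := ind s _ us wV2 E2 i si.
by move=> /eqP; rewrite scaler_eq0 => /orP [/eqP ->|/eqP //]; rewrite scale0r.
Qed.

Definition gw (a : Wt) (x : g) : Prop := forall h : ct, br (vsval h.1.1) x = (a h : C) *: x.

Lemma gw_lin a : lin_closed (gw a).
Proof.
split=> [h|k x y gx gy h]; first by rewrite (lin0 (br_linr _)) scaler0.
by rewrite (br_linr _ k x y) gx gy scalerDr !scalerA mulrC.
Qed.

Lemma gw_br a b x y : gw a x -> gw b y -> gw (a + b) (br x y).
Proof.
move=> gx gy h; rewrite br_jacobi gx gy (linZ (br_linl _)) (linZ (br_linr _)).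
by rewrite -scalerDl add_lfunE.
Qed.

Lemma gw_span (P : g -> Prop) : lin_closed P -> (forall a y, gw a y -> P y) -> forall x, P x.
Proof.
move=> Pl Pg x; pose ops (i : 'I_(\dim H)) := br (vbasis H)`_i.
have bH i : (vbasis H)`_(i : 'I_(\dim H)) \in H by apply: vbasis_mem; rewrite mem_nth ?size_tuple.
have opE i : ops i = br (vsval (Subvs (bH i))) by [].
apply: (simultaneous_eigen (ops := ops) (ks := enum 'I_(\dim H)) (W := fun=> True)) => //.
- by move=> i; apply: br_linr.
- by move=> i c y; rewrite opE; apply: cartan_semisimple.
- move=> i j y; rewrite {1}/ops br_jacobi.
  by rewrite (cartan_abelian (Subvs (bH i)) (Subvs (bH j)) : br (vbasis H)`_i (vbasis H)`_j = 0) (lin0 (br_linl _)) add0r.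
move=> y _ Q; have [->|y0] := eqVneq y 0; first by case: Pl.
have eig i : exists c, ops i y = c *: y.
  have : i \in enum 'I_(\dim H) by rewrite mem_enum.
  elim: (enum _) Q => //= j r IHr [cj Q]; rewrite inE => /orP [/eqP -> //|]; exact: IHr.
have eigH (h : subvs_of H) : exists c, br (vsval h) y = c *: y.
  have [f fP] := choice eig.
  exists (\sum_i coord (vbasis H) i (vsval h) * f i).
  rewrite {1}(coord_vbasis (subvsP h)) (lin_sum (br_linl y)) scaler_suml.
  by apply: eq_bigr => i _; rewrite (linZ (br_linl y)) -/(ops i y) fP scalerA.
have [f fP] := choice eigH.
have fl : linear (fun h : ct => f h.1.1 : C^o).
  move=> k h h'; have [_] := br_simple => _ _.
  apply/eqP; rewrite -subr_eq0; apply/eqP; have := fP (k *: h.1.1 + h'.1.1).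
  rewrite linearP (br_linl y k (vsval h.1.1) (vsval h'.1.1)) !fP scalerA -scalerDl => /eqP.
  by rewrite -subr_eq0 -scalerBl scaler_eq0 (negPf y0) orbF subr_eq0 => /eqP <-; rewrite subrr.
pose F1 := GRing.isLinear.Build C ct (C^o) *:%R (fun h : ct => f h.1.1 : C^o) fl.
pose F : {linear ct -> C^o} := HB.pack (fun h : ct => f h.1.1 : C^o) F1.
by apply: (Pg (linfun F)) => h; rewrite lfunE /= fP.
Qed.

Lemma gw0_mem x : gw 0 x -> x \in H.
Proof.
move=> gx; have [_ _ sn] := H_cartan; apply: sn => h hH.
have := gx (hct (Subvs hH)); rewrite /= br_anti lfunE scale0r => /eqP.
by rewrite oppr_eq0 => /eqP ->; apply: mem0v.
Qed.

Lemma gw0P x : gw 0 x -> exists h : subvs_of H, vsval h = x.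
Proof. by move=> /gw0_mem xH; exists (Subvs xH). Qed.

Lemma lfun_n0 (a : Wt) : a != 0 -> exists h, (a h : C) != 0.
Proof.
move=> a0; apply: contrapT => H0; move/eqP: a0; apply; apply/lfunP => h; rewrite lfunE.
by apply/eqP/negPn/negP => ah; apply: H0; exists h.
Qed.

Lemma gw_kappa a b x y : gw a x -> gw b y -> a + b != 0 -> kappa x y = 0.
Proof.
move=> gx gy /lfun_n0 [h]; rewrite add_lfunE => abh.
have [_ sym inv _] := kappa_form; have := inv (vsval h.1.1) x y.
rewrite gx (linZ (kappa_linl y)) -[kappa (vsval _) _]sym => e.
have e2 : kappa (br x y) (vsval h.1.1) = - ((b h : C) *: kappa x y).
  rewrite inv br_anti gy (linN (kappa_linr x)) (linZ (kappa_linr x)) //.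
move: e; rewrite e2 => /eqP; rewrite -subr_eq0 opprK -scalerDl scaler_eq0 => /orP [|/eqP //].
by rewrite (negPf abh).
Qed.

Lemma gw_pair a x : gw a x -> x != 0 -> exists2 y, gw (- a) y & kappa x y != 0.
Proof.
move=> gx x0; apply: contrapT => nP; move/eqP: x0; apply; have [_ _ _ nd] := kappa_form.
apply: nd; apply: gw_span; first exact: lc_ker (kappa_linr x).
move=> b y gy; have [e|e] := eqVneq (a + b) 0; last exact: gw_kappa gx gy e.
apply/eqP/negPn/negP => k; apply: nP; exists y => //.
by have <- : b = - a; [apply/eqP; rewrite -addr_eq0 addrC e|].
Qed.

Lemma gw_wt a x m h b v : gw a x ->
  tact (tau_g (br (vsval h.1.1) x) m) b v = (a h : C) *: tact (tau_g x m) b v.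
Proof.
by move=> gx; rewrite -!gactE gx; exact: linZ (gact_linl m b v) _ _.
Qed.

Lemma gact_V a x m b l v : gw a x -> tV l v -> tV (l + (a + tdl H m)) (gact x m b v).
Proof.
move=> gx; rewrite gactE.
exact: (thl_V br_bil kappa_bil rho_mod gw_wt b (thl_g gx)).
Qed.

Lemma tdl0 : tdl H (0 : degree nu) = 0.
Proof.
by apply/lfunP => h; rewrite tdlE lfunE /deg_form big1 // => i _; rewrite ffunE mul0r.
Qed.

Lemma tdlN (m : degree nu) : tdl H (- m) = - tdl H m.
Proof. by apply/eqP; rewrite -addr_eq0 -tdlD addNr tdl0. Qed.

Lemma gw_root_vector a x (m : degree nu) : gw a x -> a != 0 -> x != 0 -> root_vector br H (tau_g x m).
Proof.
move=> gx a0 x0.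
have fl : linear (fun h : subvs_of H => a (hct h) : C^o).
  move=> k h h'; rewrite -linearP; congr (a _).
  by rewrite /hct; congr (_, _, _); rewrite /= scaler0 addr0.
pose F1 := GRing.isLinear.Build C (subvs_of H) (C^o) *:%R (fun h : subvs_of H => a (hct h) : C^o) fl.
pose F : {linear subvs_of H -> C^o} := HB.pack (fun h : subvs_of H => a (hct h) : C^o) F1.
have FE h : linfun F h = a (hct h) by rewrite lfunE.
have rs : root_space br (linfun F) x by move=> h; rewrite FE; exact: (gx (hct h)).
apply: (RootVector (alpha := linfun F)) => //; split; last by exists x.
apply: contra a0 => /eqP F0; apply/eqP/lfunP => h; rewrite lfunE.
have := gx h; rewrite rs F0 lfunE scale0r => /eqP.
by rewrite eq_sym scaler_eq0 (negPf x0) orbF => /eqP.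
Qed.

Lemma gact_nil a x m b v : gw a x -> a != 0 -> x != 0 -> exists q, iter q (gact x m b) v = 0.
Proof.
move=> gx a0 x0; have [q qP] := root_nil b v (gw_root_vector m gx a0 x0); exists q.
by rewrite -qP; apply: eq_iter => w; rewrite gactE.
Qed.

Section RootString.
Variables (a : Wt) (x y : g).
Hypotheses (gx : gw a x) (gy : gw (- a) y) (a0 : a != 0) (kxy : kappa x y != 0).

Lemma root_x_n0 : x != 0.
Proof. by apply: contraNneq kxy => ->; rewrite (lin0 (kappa_linl y)). Qed.
Lemma root_y_n0 : y != 0.
Proof. by apply: contraNneq kxy => ->; rewrite (lin0 (kappa_linr x)). Qed.

Lemma br_xy_mem : br x y \in H.
Proof. by apply: gw0_mem; rewrite -(addrN a); apply: gw_br. Qed.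

(** The element [[x t^m, y t^-m]]; its components along the [k_i] are invisible to [a] and to
    [tdl]. *)
Definition coroot (m : degree nu) : ct :=
  (Subvs br_xy_mem, \row_i ((kappa x y : C) * (m i)%:~R), 0).

Lemma tb_coroot m : tb (tau_g x m) (tau_g y (- m)) = tau_cartan (coroot m).
Proof.
have e2 : \sum_i (coroot m).2 0 i *: tau_d g 0 i = 0 by apply: big1 => i _; rewrite mxE scale0r.
have e1 : \sum_i (coroot m).1.2 0 i *: tau_k g 0 i = (kappa x y : C) *: dk_sum (tau_k g) m 0.
  by rewrite /dk_sum scaler_sumr; apply: eq_bigr => i _; rewrite mxE scalerA.
apply: etrans (tau_bracket_gg c1 c2 br_bil kappa_bil x m y (- m)) _; rewrite (addrN m).
exact: esym (etrans (congr2 +%R (congr2 +%R erefl e1) e2) (addr0 _)).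
Qed.

Let beta m : Wt := a + tdl H m.
Let lam m (l : Wt) : C := l (coroot m).

Lemma coroot_comm m l v : tV l v ->
  gact x m 1 (gact y (- m) 1 v) = gact y (- m) 1 (gact x m 1 v) + lam m l *: v.
Proof.
move=> lv; rewrite !gactE; have := tact_br br_bil kappa_bil rho_mod (tau_g x m) (tau_g y (- m)) 1 1 v.
by rewrite tb_coroot (mul1r (1 : B)) (tact_cartan _ lv) => ->; rewrite addrC subrK.
Qed.

Lemma coroot_beta m : beta m (coroot m) = a (coroot m).
Proof.
rewrite add_lfunE tdlE /deg_form big1 ?addr0 // => i _; rewrite mxE mulr0 //.
Qed.

Lemma coroot_xV m l : wmaps tV l (l + beta m) (gact x m 1).
Proof. by move=> v; apply: gact_V. Qed.
Lemma coroot_yV m l : wmaps tV l (l - beta m) (gact y (- m) 1).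
Proof. by move=> v; rewrite opprD -tdlN; apply: gact_V. Qed.

Lemma lamD m l : lam m (l + beta m) = lam m l + a (coroot m).
Proof. by rewrite /lam add_lfunE coroot_beta. Qed.

(** The value does not depend on m. If it vanished, x, y and [[x, y]] would be of Heisenberg type,
    so [[x, y]] would act by 0 and be 0. Then [kappa [h, x] y = kappa h [x, y] = 0] with [a h]
    nonzero contradicts [kappa x y != 0]. *)
Lemma coroot_n0 m : (a (coroot m) : C) != 0.
Proof.
have na0 : - a != 0 by rewrite oppr_eq0.
have am : a (coroot m) = a (coroot 0) :> C.
  apply/eqP; rewrite -subr_eq0; have e : (a (coroot m) : C) *: x - (a (coroot 0) : C) *: x = 0.
    by apply/eqP; rewrite subr_eq0 -(gx (coroot m)) -(gx (coroot 0)).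
  by move/eqP: e; rewrite -scalerBl scaler_eq0 (negPf root_x_n0) orbF.
rewrite am; apply/eqP => c0.
have b0 : br x y = 0.
  apply: faithful_on_weights => l v lv; have [->|v0] := eqVneq v 0; first exact: lin0 (gact_lin _ _ _).
  have := heisenberg_lam (gact_lin x 0 1) (gact_lin y (- 0) 1) (@coroot_xV 0) (@coroot_yV 0)
    (@lamD 0) (@coroot_comm 0) (fun v => gact_nil 0 1 v gx a0 root_x_n0)
    (fun v => gact_nil (- 0) 1 v gy na0 root_y_n0) c0 lv v0.
  rewrite gactE => e; have := tact_cartan (coroot 0) lv; rewrite -/(lam 0 l) e scale0r => <-.
  rewrite -tb_coroot; congr (tact _ 1 v).
  apply: esym; apply: etrans (tau_bracket_gg c1 c2 br_bil kappa_bil x 0 y (- 0)) _.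
  by rewrite dk_sum0 scaler0 addr0 oppr0 addr0.
have [h ah] := lfun_n0 a0; have [_ _ inv _] := kappa_form.
have := inv (vsval h.1.1) x y; rewrite b0 (lin0 (kappa_linr _)) gx (linZ (kappa_linl y)) => /eqP.
by rewrite scaler_eq0 (negPf ah) (negPf kxy).
Qed.

Lemma root_string m l : exists k0, forall k v, (k0 <= k)%N -> tV (l + beta m *+ k) v -> v = 0.
Proof.
have na0 : - a != 0 by rewrite oppr_eq0.
exact: (finite_string (tV_lin rho_mod) V_fin (gact_lin x m 1) (gact_lin y (- m) 1) (@coroot_xV m) (@coroot_yV m)
    (@lamD m) (@coroot_comm m) (fun v => gact_nil m 1 v gx a0 root_x_n0)
    (fun v => gact_nil (- m) 1 v gy na0 root_y_n0) l (coroot_n0 m)).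
Qed.

End RootString.

Lemma gw_string a x m : gw a x -> a != 0 ->
  (forall b v, tact (tau_g x m) b v = 0) \/
  (forall l, exists k0, forall k v, (k0 <= k)%N -> tV (l + (a + tdl H m) *+ k) v -> v = 0).
Proof.
move=> gx a0; have [->|x0] := eqVneq x 0.
  by left=> b v; rewrite -gactE; exact: lin0 (gact_linl m b v).
by right=> l; have [y gy kxy] := gw_pair gx x0; apply: root_string gx gy a0 kxy m l.
Qed.

Lemma gw_comm x y b v : gw 0 x -> gw 0 y -> tact (tau_g (br x y) 0) b v = 0.
Proof.
move=> /gw0P [h <-] /gw0P [h' <-]; rewrite cartan_abelian -gactE.
exact: lin0 (gact_linl 0 b v).
Qed.

Definition off_cartan (x : g) : Prop := forall P : g -> Prop, lin_closed P ->
  (forall a z, a != 0 -> gw a z -> P z) -> P x.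

Lemma off_cartan_lin : lin_closed off_cartan.
Proof.
split=> [P [] //|k x y ox oy P Pl Pg].
by apply: (proj2 Pl); [apply: ox|apply: oy].
Qed.

(** On a weight vector a sum of root vectors changes the weight, while a Cartan element preserves
    it. *)
Lemma off_cartan0 x : gw 0 x -> off_cartan x -> x = 0.
Proof.
move=> gx ox; apply: faithful_on_weights => l v lv.
pose K := {p : Wt * V | p.1 != l /\ tV p.1 p.2}.
pose Q u := exists r : seq K, u = \sum_(p <- r) (sval p).2.
have Ql : lin_closed Q.
  split; first by exists [::]; rewrite big_nil.
  move=> k _ _ [r ->] [r' ->].
  have kP (p : K) : (sval p).1 != l /\ tV (sval p).1 (k *: (sval p).2).
    by case: p => p [pl pV]; split=> //; apply: (lcZ (tV_lin rho_mod _)).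
  exists ([seq exist _ ((sval p).1, k *: (sval p).2) (kP p) | p <- r] ++ r').
  by rewrite big_cat big_map scaler_sumr.
have [r rE] : Q (gact x 0 1 v).
  apply: (ox (fun x => Q (gact x 0 1 v))); first exact: lc_comp (gact_linl 0 1 v) Ql.
  move=> a z a0 gz.
  have pP : l + (a + tdl H 0) != l /\ tV (l + (a + tdl H 0)) (gact z 0 1 v).
    split; last exact: gact_V.
    rewrite -subr_eq0 addrC addKr; apply: contra a0 => /eqP e.
    by rewrite tdl0 addr0 in e; rewrite e.
  by exists [:: exist _ (l + (a + tdl H 0), gact z 0 1 v) pP]; rewrite big_seq1.
have xv : tV l (gact x 0 1 v).
  have [h hx] := gw0P gx; rewrite -hx (tact_h h lv).
  exact: (lcZ (tV_lin rho_mod l)).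
rewrite (wsum_proj (tV_lin rho_mod) V_sum (f := fun p : K => (sval p).1) (fun p => proj2 (svalP p)) xv rE).
by rewrite big1 // => -[p [pl pV]] /=; rewrite (negPf pl).
Qed.

(** The Cartan elements in P and the root spaces span an ideal [I], because brackets of opposite
    root vectors lie in P. Simplicity gives [I = g], and [off_cartan0] separates the two
    summands. *)
Lemma gw_H x : gw 0 x -> forall P : g -> Prop, lin_closed P ->
  (forall z, (forall b v, tact (tau_g z 0) b v = 0) -> P z) ->
  (forall a y z, a != 0 -> gw a y -> gw (- a) z -> P (br y z)) -> P x.
Proof.
move=> gx P Pl _ Pbr.
pose P0 z := gw 0 z /\ P z.
have P0l : lin_closed P0.
  split=> [|k u v [u1 u2] [v1 v2]]; first by split; [case: (gw_lin 0)|case: Pl].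
  by split; [apply: (proj2 (gw_lin 0))|apply: (proj2 Pl)].
pose I z := exists2 p, P0 p & off_cartan (z - p).
have oB := lcB off_cartan_lin; have oD := lcD off_cartan_lin; have oZ := lcZ off_cartan_lin.
have Il : lin_closed I.
  split; first by exists 0; [case: P0l|rewrite subr0; case: off_cartan_lin].
  move=> k u v [p Pp ou] [q Pq ov]; exists (k *: p + q); first exact: (proj2 P0l).
  have -> : k *: u + v - (k *: p + q) = k *: (u - p) + (v - q) by rewrite scalerBr addrACA opprD.
  by apply: oD => //; apply: oZ.
have Ioff z : off_cartan z -> I z by move=> oz; exists 0; [case: P0l|rewrite subr0].
have Iall : forall z, I z.
  have [//|I0] := pselect (forall z, I z); exfalso.
  have Ibr z w : I w -> I (br z w).
    move=> [p [gp Pp] ow]; rewrite -[w](subrK p) (linD (br_linr z)); apply: (lcD Il).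
      move: ow; set w' := w - p => ow; move: z; apply: gw_span.
        exact: lc_comp (br_linl w') Il.
      move=> b z gz; apply: (ow (fun w' => I (br z w'))); first exact: lc_comp (br_linr z) Il.
      move=> a u a0 gu; have [ba|ba] := eqVneq (b + a) 0; last first.
        by apply: Ioff => Q Ql Qg; apply: Qg ba _; apply: gw_br.
      have b0 : b != 0 by apply: contraNneq a0 => b0; rewrite b0 add0r in ba; rewrite ba.
      have gu' : gw (- b) u by have <- : a = - b by apply/eqP; rewrite -addr_eq0 addrC ba.
      exists (br z u); last by rewrite subrr; case: off_cartan_lin.
      by split; [rewrite -ba; apply: gw_br|apply: Pbr b0 gz gu'].
    move: z; apply: gw_span; first exact: lc_comp (br_linl p) Il.
    move=> b z gz; have [b0|b0] := eqVneq b 0; last first.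
      by apply: Ioff => Q Ql Qg; apply: Qg b0 _; rewrite -[b]addr0; apply: gw_br.
    rewrite b0 in gz; have [hz <-] := gw0P gz; have [hp <-] := gw0P gp.
    by rewrite cartan_abelian; case: Il.
  apply: I0; apply: (simple_ideal br_simple Il Ibr).
  (* A zero [I] would leave no root vector, so g would equal its abelian Cartan subalgebra. *)
  apply: contrapT => nI; have all0 : forall z, gw 0 z.
    apply: gw_span; first exact: gw_lin.
    move=> a z gz; have [<- //|a0] := eqVneq a 0.
    have -> : z = 0; last by case: (gw_lin 0).
    apply/eqP/negPn/negP => z0; apply: nI; exists z => //.
    by apply: Ioff => Q Ql Qg; apply: Qg a0 gz.
  have [_ [u [v uv]] _] := br_simple; move/eqP: uv; apply.
  by have [hu <-] := gw0P (all0 u); have [hv <-] := gw0P (all0 v); apply: cartan_abelian.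
have [p [gp Pp] ox] := Iall x; have -> // : x = p.
by apply/eqP; rewrite -subr_eq0; apply/eqP; apply: off_cartan0 ox; apply: (lcB (gw_lin 0)).
Qed.

Lemma gw_root : exists a x y, [/\ a != 0, gw a x, gw (- a) y & kappa x y != 0].
Proof.
apply: contrapT => nr.
have all0 : forall z, gw 0 z.
  apply: gw_span; first exact: gw_lin.
  move=> a z gz; have [<- //|a0] := eqVneq a 0.
  have [->|z0] := eqVneq z 0; first by case: (gw_lin 0).
  by have [y gy kzy] := gw_pair gz z0; case: nr; exists a, z, y.
have [_ [u [v uv]] _] := br_simple; move/eqP: uv; apply.
by have [hu <-] := gw0P (all0 u); have [hv <-] := gw0P (all0 v); apply: cartan_abelian.
Qed.

Lemma gw_basis : exists n (e : 'I_n -> g) (al : 'I_n -> Wt), (forall i, gw (al i) (e i)) /\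
  forall x, exists c : 'I_n -> C, x = \sum_i c i *: e i.
Proof.
pose K := {p : Wt * g | gw p.1 p.2}.
pose Q x := exists r : seq K, x = \sum_(p <- r) (sval p).2.
have Ql : lin_closed Q.
  split; first by exists [::]; rewrite big_nil.
  move=> k _ _ [r ->] [r' ->].
  have kP (p : K) : gw (sval p).1 (k *: (sval p).2).
    by case: p => p gp; apply: (lcZ (gw_lin _)).
  exists ([seq exist _ ((sval p).1, k *: (sval p).2) (kP p) | p <- r] ++ r').
  by rewrite big_cat big_map scaler_sumr.
have Qall : forall x, Q x.
  apply: gw_span => // a y gy; exists [:: exist _ (a, y) gy].
  by rewrite big_seq1.
have [f fP] := choice Qall.
pose L := flatten [seq f (vbasis {:g})`_(i : 'I_(\dim {:g})) | i <- enum 'I_(\dim {:g})].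
have p0 : K by exists (0, 0); case: (gw_lin 0).
exists (size L), (fun i => (sval (nth p0 L i)).2), (fun i => (sval (nth p0 L i)).1); split.
  by move=> i; exact: svalP (nth p0 L i).
pose P x := exists c : 'I_(size L) -> C, x = \sum_i c i *: (sval (nth p0 L i)).2.
have Pl : lin_closed P.
  split; first by exists (fun=> 0); rewrite big1 // => i _; rewrite scale0r.
  move=> k _ _ [c ->] [c' ->]; exists (fun i => k * c i + c' i).
  by rewrite scaler_sumr -big_split; apply: eq_bigr => i _; rewrite scalerDl scalerA.
have PL j : (j < size L)%N -> P (sval (nth p0 L j)).2.
  move=> jL; exists (fun i => (i == Ordinal jL)%:R).
  rewrite (bigD1 (Ordinal jL)) //= eqxx scale1r big1 ?addr0 // => i ij.
  by rewrite (negPf ij) scale0r.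
have PLs s1 s2 s3 : L = s1 ++ s2 ++ s3 -> P (\sum_(p <- s2) (sval p).2).
  elim: s2 s1 => [|p s2 IHs] s1 eL; first by rewrite big_nil; case: Pl.
  rewrite big_cons; apply: (lcD Pl); last by apply: (IHs (rcons s1 p)); rewrite cat_rcons.
  have := PL (size s1); rewrite eL nth_cat ltnn subnn /=; apply.
  by rewrite size_cat /= addnS ltnS leq_addr.
move=> x; rewrite (coord_vbasis (memvf x)); apply: (lc_sum Pl) => i _; apply: (lcZ Pl).
rewrite (fP (vbasis {:g})`_i).
have ie : i \in enum 'I_(\dim {:g}) by rewrite mem_enum.
move: PLs; rewrite /L; case/splitPr: ie => r1 r2; rewrite map_cat flatten_cat /=.
by move/(_ (flatten [seq f (vbasis {:g})`_(i : 'I_(\dim {:g})) | i <- r1]) _ _ erefl).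
Qed.

Theorem g_single_point (gs : seq B) : is_irreducible rho -> (0 < nu)%N ->
  (forall P : {pred B}, subalg_closed P -> {subset gs <= P} -> P =i predT) ->
  exists psi : {lrmorphism B -> C^o}, forall z b v, tact z b v = (psi b : C) *: tact z 1 v.
Proof.
move=> irr nu0 gsP; have [n [e [al [eP esp]]]] := gw_basis.
apply: (tau_single_point br_bil kappa_bil kappa_n0 rho_mod irr V_sum V_fin gw_lin gw_br eP esp
  gw_wt gw_comm gw_kappa gw_string gw_H (or_intror gw_root) nu0 gsP).
by move=> z0; have [x [m [b [v /eqP]]]] := g_nontriv; apply.
Qed.

End GStructure.

(** * Nullstellensatz over an uncountable field *)

From mathcomp Require Import classical_sets cardinality ereal lebesgue_measure.
From mathcomp Require Import set_interval finmap.

(** Uncountability in the form used below: among countably many parts one contains finite sets of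
    every size. *)
Definition big_fibres (T : eqType) : Prop := forall f : T -> nat, exists N, forall k,
  exists s : seq T, [/\ uniq s, size s = k & forall t, t \in s -> f t = N].

(** A countable line would have measure zero, but the unit interval has measure one. *)
Lemma real_uncountable (R : realType) : ~ countable [set: R]%classic.
Proof.
move=> cR; have := @lebesgue_measure_itv R `[0, 1]%R.
rewrite countable_lebesgue_measure0 /=; last by apply: sub_countable cR; apply: subset_card_le.
by rewrite lte_fin ltr01 oppr0 adde0 => /eqP; rewrite eq_sym onee_eq0.
Qed.

Lemma complex_big_fibres (R : realType) : big_fibres R[i].
Proof.
move=> f; apply: contrapT => nf; apply: (@real_uncountable R).
have -> : [set: R]%classic = (\bigcup_(N in [set: nat]) [set x | f x%:C%C = N])%classic.
  by apply/seteqP; split=> // x _; exists (f x%:C%C).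
apply: bigcup_countable => // N _; apply: finite_set_countable; apply: contrapT => inf.
apply: nf; exists N => k.
have [A AN kA] := infinite_set_fset k inf.
exists (map (fun x : R => x%:C%C) (take k A)); split.
- rewrite map_inj_uniq ?take_uniq ?fset_uniq // => x y; exact: fmorph_inj.
- by rewrite size_map size_take_min; apply/minn_idPl.
- by move=> t /mapP [x /mem_take xA ->]; apply: AN.
Qed.

Section SeqSpan.
Variables (C : fieldType) (V : lmodType C).

Definition seq_span (s : seq V) (v : V) : Prop := exists c : 'I_(size s) -> C, v = \sum_i c i *: s`_i.

Lemma seq_span_lin s : lin_closed (seq_span s).
Proof.
split; first by exists (fun=> 0); rewrite big1 // => i _; rewrite scale0r.
move=> k _ _ [c ->] [c' ->]; exists (fun i => k * c i + c' i).
by rewrite scaler_sumr -big_split; apply: eq_bigr => i _; rewrite scalerDl scalerA.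
Qed.

Lemma seq_span_mem s v : v \in s -> seq_span s v.
Proof.
move=> vs; have vi : (index v s < size s)%N by rewrite index_mem.
exists (fun i => (i == Ordinal vi)%:R).
rewrite (bigD1 (Ordinal vi)) //= eqxx scale1r nth_index // big1 ?addr0 // => i ij.
by rewrite (negPf ij) scale0r.
Qed.

Lemma seq_span_sub s (P : V -> Prop) : lin_closed P -> (forall v, v \in s -> P v) ->
  forall v, seq_span s v -> P v.
Proof.
move=> Pl sP _ [c ->]; apply: (lc_sum Pl) => i _; apply: (lcZ Pl).
by apply: sP; rewrite mem_nth.
Qed.

End SeqSpan.

Section Nullstellensatz.
Variables (C : numClosedFieldType) (B : comAlgType C) (gs : seq B).
Hypothesis C_big : big_fibres C.
Hypothesis gsP : forall P : {pred B}, subalg_closed P -> {subset gs <= P} -> P =i predT.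

Fixpoint monomials n : seq B :=
  if n is n'.+1 then monomials n' ++ [seq x * y | x <- gs, y <- monomials n'] else [:: 1].

Lemma monomials_sub m n : {subset monomials m <= monomials (m + n)}.
Proof.
elim: n => [|n IHn] x xm; first by rewrite addn0.
by rewrite addnS /= mem_cat IHn.
Qed.

Definition monomial_span (b : B) : Prop := exists n, seq_span (monomials n) b.

Lemma monomial_span_lin : lin_closed monomial_span.
Proof.
split; first by exists 0%N; case: (seq_span_lin (monomials 0)).
move=> k x y [m xm] [n yn]; exists (m + n)%N; apply: (proj2 (seq_span_lin _)).
  by apply: (seq_span_sub (seq_span_lin _)) xm => v /monomials_sub vm; apply: seq_span_mem.
apply: (seq_span_sub (seq_span_lin _)) yn => v vn; apply: seq_span_mem.
by rewrite addnC; apply: monomials_sub.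
Qed.

Lemma monomial_spanT b : monomial_span b.
Proof.
have [U0 Ul] := monomial_span_lin.
pose P : {pred B} := fun b => `[< forall y, monomial_span y -> monomial_span (b * y) >].
have Pb : b \in P.
  rewrite (gsP (P := P)) //.
    split; first by apply/asboolP => y; rewrite mul1r.
      move=> k x y /asboolP Px /asboolP Py; apply/asboolP => z zU.
      by rewrite mulrDl -scalerAl; apply: Ul; [apply: Px|apply: Py].
    move=> x y /asboolP Px /asboolP Py; apply/asboolP => z zU.
    by rewrite -mulrA; apply: Px; apply: Py.
  move=> x xg; apply/asboolP => y [n yn]; exists n.+1.
  have Pl : lin_closed (fun y => seq_span (monomials n.+1) (x * y)).
    split; first by rewrite mulr0; case: (seq_span_lin (monomials n.+1)).
    by move=> k u v Pu Pv; rewrite mulrDr -scalerAr; apply: (proj2 (seq_span_lin _)).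
  apply: (seq_span_sub Pl) yn => v vn; apply: seq_span_mem.
  by rewrite /= mem_cat; apply/orP; right; apply/allpairsP; exists (x, v).
move/asboolP: Pb => /(_ 1); rewrite mulr1; apply; exists 0%N.
by apply: seq_span_mem; rewrite inE.
Qed.

Definition proper_ideal (I : B -> Prop) : Prop :=
  [/\ lin_closed I, forall b c, I b -> I (b * c) & ~ I 1].

Definition ideal_add (I : B -> Prop) (x b : B) : Prop := exists u c, I u /\ b = u + x * c.

(** Otherwise every x - t is invertible modulo I, with inverse [b t]. As B has countable dimension,
    some span of [monomials n] contains more of the [b t] than its generators. Clearing denominators
    in a linear relation gives a nonzero polynomial q with q(x) in I, and its linear factors,
    invertible modulo I, cancel to put 1 in I. *)
Lemma ideal_add_proper I x : proper_ideal I ->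
  exists t : C, proper_ideal (ideal_add I (x - t%:A)).
Proof.
move=> [Il Im I1]; apply: contrapT => nt.
have inv (t : C) : exists c, I ((x - t%:A) * c - 1).
  apply: contrapT => nc; apply: nt; exists t; split.
  - split; first by exists 0, 0; rewrite mulr0 addr0; case: Il.
    move=> k _ _ [u [c [Iu ->]]] [u' [c' [Iu' ->]]]; exists (k *: u + u'), (k *: c + c').
    split; first by apply: (proj2 Il).
    by rewrite mulrDr -scalerAr scalerDr addrACA.
  - move=> _ d [u [c [Iu ->]]]; exists (u * d), (c * d); split; first exact: Im.
    by rewrite mulrDl mulrA.
  - move=> [u [c [Iu e]]]; apply: nc; exists c.
    have -> : (x - t%:A) * c = - u + 1 by rewrite [in RHS]e addKr.
    by rewrite addrK; apply: (lcN Il).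
have [b bP] := choice inv.
have cancel t y : I ((x - t%:A) * y) -> I y.
  move=> Iy; have -> : y = (x - t%:A) * y * b t - ((x - t%:A) * b t - 1) * y.
    by move: (x - t%:A) => X; rewrite mulrBl mul1r opprB mulrAC addrCA subrr addr0.
  by apply: (lcB Il); apply: Im.
have cancels s y : I (\prod_(t <- s) (x - t%:A) * y) -> I y.
  elim: s y => [|t s IHs] y; first by rewrite big_nil mul1r.
  by rewrite big_cons -mulrA => /cancel /IHs.
have [N NP] := choice (fun t => monomial_spanT (b t)).
have [n nP] := C_big N; pose d := size (monomials n).
have [s [su ss sN]] := nP d.+1.
have bspan (j : 'I_d.+1) : seq_span (monomials n) (b s`_j).
  by rewrite -(sN s`_j) ?mem_nth ?ss //; apply: NP.
have [a aP] := choice bspan.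
pose A := \matrix_(j, k) a j k : 'M[C]_(d.+1, d).
have [v [vA v0]] : exists v : 'rV[C]_d.+1, v *m A = 0 /\ v != 0.
  have k0 : kermx A != 0.
    by rewrite -mxrank_eq0 mxrank_ker subn_eq0 -ltnNge ltnS rank_leq_col.
  by have [v /sub_kermxP vA v0] := rowV0Pn k0; exists v.
have vb : \sum_j v 0 j *: b s`_j = 0.
  under eq_bigr do rewrite aP scaler_sumr.
  rewrite exchange_big /=; apply: big1 => k _.
  have /matrixP /(_ 0 k) := vA; rewrite !mxE => e.
  transitivity ((\sum_j v 0 j * A j k) *: (monomials n)`_k); last by rewrite e scale0r.
  by rewrite scaler_suml; apply: eq_bigr => j _; rewrite scalerA mxE.
(* The numerator of the sum of the fractions [v_j / (X - s_j)]; its value at [s_j] is a nonzero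
   multiple of [v_j]. *)
pose q := \sum_j v 0 j *: \prod_(i < d.+1 | i != j) ('X - (s`_i)%:P).
have qs (j : 'I_d.+1) : q.[s`_j] = v 0 j * \prod_(i < d.+1 | i != j) (s`_j - s`_i).
  rewrite horner_sum (bigD1 j) //= hornerZ horner_prod [X in _ + X]big1 ?addr0 => [|k kj].
    by congr (_ * _); apply: eq_bigr => i _; rewrite hornerXsubC.
  by rewrite hornerZ horner_prod (bigD1 j) 1?eq_sym //= hornerXsubC subrr mul0r mulr0.
have q0 : q != 0.
  have /rV0Pn [j vj] := v0; apply: contra_neq vj => q0; apply/eqP.
  have /eqP := qs j; rewrite q0 horner0 eq_sym mulf_eq0 => /orP [//|].
  rewrite prodf_seq_eq0 => /hasP [i _ /andP [ij]]; rewrite subr_eq0 nth_uniq ?ss // => /eqP e.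
  by move: ij; rewrite -val_eqE /= e eqxx.
have Iq : I (horner_alg x q).
  pose Q j := \prod_(i < d.+1 | i != j) (x - (s`_i)%:A).
  have -> : horner_alg x q = \sum_j v 0 j *: Q j.
    rewrite linear_sum; apply: eq_bigr => j _; rewrite linearZ /= rmorph_prod mulr_algl; congr (_ *: _).
    by apply: eq_bigr => i _; rewrite rmorphB /= horner_algX horner_algC.
  have QE j : Q j = (\prod_(i < d.+1) (x - (s`_i)%:A)) * b s`_j - ((x - (s`_j)%:A) * b s`_j - 1) * Q j.
    rewrite (bigD1 j) //= -/(Q j); move: (x - _) (Q j) => X Y.
    by rewrite mulrBl mul1r opprB [X * Y * _]mulrAC addrCA subrr addr0.
  under eq_bigr do rewrite QE scalerBr scalerAr.
  rewrite sumrB -mulr_sumr vb mulr0 sub0r; apply: (lcN Il); apply: (lc_sum Il) => j _.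
  by apply: (lcZ Il); apply: Im.
apply: I1.
have [r qE] := closed_field_poly_normal q.
have lq : lead_coef q != 0 by rewrite lead_coef_eq0.
apply: (cancels r); rewrite mulr1; apply: (lc_cancel Il lq).
move: Iq; rewrite {1}qE linearZ /= rmorph_prod mulr_algl.
suff -> : \prod_(t <- r) (x - t%:A) = \prod_(t <- r) horner_alg x ('X - t%:P) by [].
by apply: eq_bigr => t _; rewrite rmorphB /= horner_algX horner_algC.
Qed.

Lemma proper_ideal_points I (s : seq B) : proper_ideal I ->
  exists J, proper_ideal J /\ forall x, x \in s -> exists t : C, J (x - t%:A).
Proof.
elim: s I => [|x s IHs] I Ip; first by exists I.
have [J [Jp Js]] := IHs I Ip; have [t tP] := ideal_add_proper x Jp.
exists (ideal_add J (x - t%:A)); split=> // y; rewrite inE => /orP [/eqP ->|/Js [u uP]].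
  exists t, 0, 1; rewrite mulr1 add0r; split=> //.
  by case: Jp => -[].
by exists u, (y - u%:A), 0; rewrite mulr0 addr0.
Qed.

Theorem exists_character : exists psi : {lrmorphism B -> C^o}, True.
Proof.
have I0 : proper_ideal (fun b => b = 0).
  split; last by move/eqP; rewrite oner_eq0.
    by split=> // k _ _ -> ->; rewrite scaler0 addr0.
  by move=> _ c ->; rewrite mul0r.
have [J [[Jl Jm J1] Jg]] := proper_ideal_points gs I0.
pose P : {pred B} := fun b => `[< exists t : C, J (b - t%:A) >].
have Pb b : b \in P.
  rewrite (gsP (P := P)) //; last by move=> x /Jg Jx; apply/asboolP.
  split.
  - by apply/asboolP; exists 1; rewrite scale1r subrr; case: Jl.
  - move=> k x y /asboolP [t tP] /asboolP [u uP]; apply/asboolP; exists (k * t + u).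
    by rewrite scalerDl -scalerA opprD addrACA -scalerBr; apply: (proj2 Jl).
  - move=> x y /asboolP [t tP] /asboolP [u uP]; apply/asboolP; exists (t * u).
    have -> : x * y - (t * u)%:A = (x - t%:A) * y + t *: (y - u%:A).
      by rewrite mulrBl mulr_algl scalerBr scalerA addrA subrK.
    by apply: (lcD Jl); [apply: Jm|apply: lcZ].
have [psi _] : exists psi : {lrmorphism B -> C^o}, forall b, J (b - (psi b : C)%:A).
  by apply: ideal_point => // b; apply/asboolP; exact: (Pb b).
by exists psi.
Qed.

End Nullstellensatz.

(** * Trivial action of g, and conclusion *)

Section TrivialAction.
Variables (C : numClosedFieldType) (nu : nat) (g : vectType C).
Variables (br : g -> g -> g) (kappa : g -> g -> C^o) (c1 c2 : C) (H : {vspace g}).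
Hypotheses (br_bil : is_bilinear br) (kappa_bil : is_bilinear kappa).
Hypothesis kappa_n0 : exists x y, kappa x y != 0.
Variables (B : comAlgType C) (V : lmodType C) (rho : tensor (tau nu g) B -> V -> V).

Local Notation tb := (tau_bracket (nu := nu) br kappa c1 c2).
Local Notation ct := (tau_cartan_type nu H).
Local Notation Wt := 'Hom(ct, C^o).
Local Notation tact := (tact rho).
Local Notation tV := (tV (H := H) rho).

Hypothesis rho_mod : is_lie_module (current_bracket tb (B := B)) rho.
Hypothesis V_sum : is_direct_sum tV.
Hypothesis V_fin : forall l, is_fin_dim_subspace (tV l).
Hypothesis g0 : forall x m b v, tact (tau_g x m) b v = 0.

(** For [kappa x y != 0] the bracket in degrees [unitd p] and [- unitd p] acts by zero, and so does
    its g-part. *)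
Lemma k_trivial p b v : tact (tau_k g 0 p) b v = 0.
Proof.
have [x [y kxy]] := kappa_n0; have [m mE] : exists m : degree nu, m = unitd p by exists (unitd p).
have e : tact (tb (tau_g x m) (tau_g y (- m))) (b * 1) v = 0.
  apply: etrans (tact_br br_bil kappa_bil rho_mod _ _ b 1 v) _.
  apply: etrans (congr2 (fun u w => u - w) (g0 x m b _) (g0 y (- m) 1 _)) _.
  exact: subrr.
move: e; rewrite mulr1 (tau_bracket_gg c1 c2 br_bil kappa_bil) (addrN m).
rewrite (linD (tact_linT rho_mod b v)) (g0 _ 0 b v) add0r (linZ (tact_linT rho_mod b v)).
have -> : dk_sum (tau_k g) m 0 = tau_k g 0 p.
  rewrite /dk_sum mE (bigD1 p) //= big1 => [|q qp]; rewrite ffunE.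
    by rewrite eqxx scale1r addr0.
  by rewrite (negPf qp) scale0r.
by move/eqP; rewrite scaler_eq0 (negPf kxy) => /eqP.
Qed.

Lemma trivial_single_point (gs : seq B) : is_irreducible rho -> (0 < nu)%N ->
  (forall P : {pred B}, subalg_closed P -> {subset gs <= P} -> P =i predT) ->
  ~ (forall z b v, tact z b v = 0) ->
  exists psi : {lrmorphism B -> C^o}, forall z b v, tact z b v = (psi b : C) *: tact z 1 v.
Proof.
(* All of g gets weight 0; as g acts by zero, the conditions on weights still hold after acting on
   V. *)
move=> irr nu0 gsP nz; pose gw (a : Wt) (x : g) := a != 0 -> x = 0.
have gw_lin a : lin_closed (gw a).
  by split=> // k x y gx gy a0; rewrite gx // gy // scaler0 addr0.
have gw_br a b x y : gw a x -> gw b y -> gw (a + b) (br x y).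
  move=> gx gy ab; have [a0|a0] := eqVneq a 0.
    by rewrite gy ?(lin0 (br_bil.2 x)) //; apply: contra_neq ab => ->; rewrite a0 addr0.
  by rewrite gx // (lin0 (br_bil.1 y)).
pose e (i : 'I_(\dim {:g})) := (vbasis {:g})`_i.
have gw_e i : gw 0 (e i) by rewrite /gw eqxx.
have e_span x : exists c : 'I_(\dim {:g}) -> C, x = \sum_i c i *: e i.
  by exists (fun i => coord (vbasis {:g}) i x); exact: coord_vbasis (memvf x).
apply: (tau_single_point br_bil kappa_bil kappa_n0 rho_mod irr V_sum V_fin gw_lin gw_br gw_e
  e_span _ _ _ _ _ (or_introl k_trivial) nu0 gsP nz).
- by move=> a x m h b v _; rewrite g0 g0 scaler0.
- by move=> x y b v _ _; apply: g0.
- move=> a b x y gx gy ab; have [a0|a0] := eqVneq a 0.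
    by rewrite gy ?(lin0 (kappa_bil.2 x)) //; apply: contra_neq ab => ->; rewrite a0 addr0.
  by rewrite gx // (lin0 (kappa_bil.1 y)).
- by move=> a x m _ _; left; apply: g0.
- by move=> x _ P _ P0 _; apply: P0 => b v; apply: g0.
Qed.

End TrivialAction.

Theorem mainTheorem1 (R : realType)
    (g : vectType R[i]) (br : g -> g -> g) (H : {vspace g})
    (kappa : g -> g -> (R[i])^o) (nu : nat) (c1 c2 : R[i])
    (B : comAlgType R[i]) (V : lmodType R[i])
    (rho : tensor (tau nu g) B -> V -> V) :
  is_simple_lie br -> is_cartan br H -> is_invariant_form br kappa ->
  (1 <= nu)%N -> is_fin_gen_alg B ->
  is_lie_module (current_bracket (tau_bracket br kappa c1 c2) (B := B)) rho ->
  is_irreducible rho ->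
  in_C_fin br H rho ->
  is_single_point_evaluation rho /\
  (let rho1 := fun (x : tau nu g) (v : V) => rho (tens x 1) v in
   [/\ is_lie_module (tau_bracket br kappa c1 c2) rho1,
       is_irreducible rho1 &
       is_integrable_tau br H rho1]).
Proof.
move=> br_simple H_cartan kappa_form nu0 [gs gsP] rho_mod irr [[V_sum root_nil] V_fin].
have [br_bil kappa_bil] := (br_bil br_simple, kappa_bil kappa_form).
have [psi psiP] : is_single_point_evaluation rho.
  have [z0|nz] := pselect (forall z b v, rho (tens z b) v = 0).
    have [psi _] := exists_character (@complex_big_fibres R) gsP.
    by exists psi => z b v; apply: etrans (z0 z b v) _; rewrite (z0 z 1 v) scaler0.
  have [g0|ng0] := pselect (forall x m b v, rho (tens (tau_g x m) b) v = 0).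
    exact: (trivial_single_point br_bil kappa_bil (kappa_n0 br_simple kappa_form) rho_mod
      V_sum V_fin g0 irr nu0 gsP nz).
  apply: (g_single_point br_simple H_cartan kappa_form rho_mod V_sum V_fin root_nil _ irr nu0 gsP).
  apply: contrapT => ng; apply: ng0 => x m b v; apply/eqP/negPn/negP => n0.
  by apply: ng; exists x, m, b, v.
split; first by exists psi.
have [[rho_l rho_r] rho_br] := rho_mod; have [tl tr] := @tens_bilinear R[i] (tau nu g) B.
split.
- split; first by split=> [v k x y|x]; [rewrite tl rho_l|exact: rho_r].
  move=> x y v; rewrite -rho_br current_bracketE ?mulr1 //.
  exact: tau_bracket_bilinear.
(* A subspace stable under [tau (x) 1] is stable under every [x (x) b], which acts as a scalar
   multiple of [x (x) 1]. *)
- split=> [|W Wl Ws]; first by case: irr.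
  apply: (proj2 irr W Wl) => z v vW.
  elim/tens_ind: z => [|k x y xW yW|x b].
  + by rewrite (lin0 (rho_l v)); case: Wl.
  + by rewrite (rho_l v); apply: (proj2 Wl).
  + by rewrite psiP -[_ *: _]addr0; apply: (proj2 Wl); [apply: Ws|case: Wl].
- by split=> // z v; apply: root_nil.
Qed.
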